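(* Let $n\ge 0$ be an integer, $0\le\beta<1$ and $0<\alpha\le 1$. Let $f\in T_n^\alpha(\beta)$ and let $g\in\mathbb{A}$ be convex. Let $\phi$ be the quasi-convolution of $f$ and $g$, defined by $\phi(z)^\alpha=(f^\alpha*g^\alpha)(z)$. Then $\phi\in T_n^\alpha(\beta)$, that is, $$\operatorname{Re}\frac{D^n\phi(z)^\alpha}{\alpha^n z^\alpha}>\beta\qquad (z\in E).$$
   Context: $E=\{z\in\mathbb{C}:|z|<1\}$. $\mathbb{A}$ is the class of functions $f(z)=z+a_2z^2+\cdots$ analytic in $E$. A function $g\in\mathbb{A}$ is convex if it is univalent and maps $E$ onto a convex domain, equivalently $\operatorname{Re}\{(zg'(z))'/g'(z)\}>0$ in $E$. $D^n$ is the Salagean derivative operator: $D^0h(z)=h(z)$ and $D^nh(z)=z[D^{n-1}h(z)]'$. All powers are principal determinations; $D^nf(z)^\alpha$ means $D^n$ applied to the function $f(z)^\alpha$. For real $\alpha>0$, $0\le\beta<1$ and integer $n\ge0$, $T_n^\alpha(\beta)$ is the class of $f\in\mathbb{A}$ with $\operatorname{Re}\frac{D^nf(z)^\alpha}{\alpha^nz^\alpha}>\beta$ for $z\in E$. For $f,g\in\mathbb{A}$ and $\alpha>0$ write $f(z)^\alpha=z^\alpha+\sum_{k\ge2}A_k(\alpha)z^{\alpha+k-1}$ and $g(z)^\alpha=z^\alpha+\sum_{k\ge2}B_k(\alpha)z^{\alpha+k-1}$. The quasi-convolution $\phi$ of $f$ and $g$ is defined by $\phi(z)^\alpha=(f^\alpha*g^\alpha)(z)=z^\alpha+\sum_{k=2}^\infty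 A_k(\alpha)B_k(\alpha)z^{\alpha+k-1}$. *)

(* Defs.v *)
From Stdlib Require Import Reals.
From Coquelicot Require Import Coquelicot.

Open Scope R_scope.

Definition in_disc (z : C) : Prop := Cmod z < 1.

Definition analytic_on_disc (F : C -> C) : Prop :=
  exists a : nat -> C, forall z : C, in_disc z -> is_pseries a z (F z).

Definition class_A (f : C -> C) : Prop :=
  exists a : nat -> C,
    a 0%nat = RtoC 0 /\ a 1%nat = RtoC 1 /\
    forall z : C, in_disc z -> is_pseries a z (f z).

Definition univalent (g : C -> C) : Prop :=
  forall z w : C, in_disc z -> in_disc w -> g z = g w -> z = w.

Definition convex_image (g : C -> C) : Prop :=
  forall (z w : C) (t : R), in_disc z -> in_disc w -> 0 <= t <= 1 ->
    exists u : C, in_disc u /\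
      g u = (RtoC (1 - t) * g z + RtoC t * g w)%C.

Definition convex_map (g : C -> C) : Prop :=
  class_A g /\ univalent g /\ convex_image g.

(* Principal argument, in (-PI, PI] for z <> 0. *)
Definition Carg (z : C) : R :=
  if Rle_dec 0 (Im z) then acos (Re z / Cmod z) else - acos (Re z / Cmod z).

(* Principal power exp (s Log z), meaningful for z <> 0 only. *)
Definition Cpower (z : C) (s : R) : C :=
  (Rpower (Cmod z) s * cos (s * Carg z), Rpower (Cmod z) s * sin (s * Carg z)).

(* [power_coeffs alpha f a] says f(z)^alpha = z^alpha (a_0 + a_1 z + ...) near 0,
   so [a k] is the coefficient of z^(alpha + k). The ratio f(z)/z is close to 1
   there, so the principal power of it is analytic; a_0 = 1 is automatic for f in
   [class_A]. *)
Definition power_coeffs (alpha : R) (f : C -> C) (a : nat -> C) : Prop :=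
  exists r : R, 0 < r /\
    forall z : C, 0 < Cmod z < r -> is_pseries a z (Cpower (f z / z)%C alpha).

Fixpoint Salagean (n : nat) (h : C -> C) (z : C) : C :=
  match n with
  | O => h z
  | S m => (z * C_derive (Salagean m h) z)%C
  end.

Definition in_slit_disc (z : C) : Prop :=
  in_disc z /\ ~ (Im z = 0 /\ Re z <= 0).

(* The function f^alpha is z^alpha P(z), with P the analytic branch of
   (f(z)/z)^alpha equal to 1 at 0. The principal z^alpha is differentiable only
   off the cut (-oo, 0], whereas D^n f^alpha / (alpha^n z^alpha) has no
   singularity there or at 0: Q is its (unique) analytic extension to the disc. *)
Definition class_T (n : nat) (alpha beta : R) (f : C -> C) : Prop :=
  class_A f /\
  exists (a : nat -> C) (P Q : C -> C),
    power_coeffs alpha f a /\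
    (forall z : C, in_disc z -> is_pseries a z (P z)) /\
    analytic_on_disc Q /\
    (forall z : C, in_slit_disc z ->
       Q z = (Salagean n (fun w => Cpower w alpha * P w) z
              / (RtoC alpha ^ n * Cpower z alpha))%C) /\
    (forall z : C, in_disc z -> Re (Q z) > beta).

Definition quasi_convolution (alpha : R) (f g phi : C -> C) : Prop :=
  class_A phi /\
  exists a b : nat -> C,
    power_coeffs alpha f a /\ power_coeffs alpha g b /\
    power_coeffs alpha phi (fun k => (a k * b k)%C).

(* Main.v *)
Require Import Defs.
From Stdlib Require Import Reals Arith ZArith Lra Lia ClassicalEpsilon.
From Coquelicot Require Import Coquelicot.

(** Why the theorem holds.  Write (f(z)/z)^alpha and (g(z)/z)^alpha as power
    series with coefficients a_k and b_k.  On z^alpha times a power series the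
    operator D multiplies the k-th coefficient by alpha + k
    ([salagean_formula]).  Hence the quotient that defines the class has the
    coefficients q_k = ((alpha + k)/alpha)^n a_k for f and q_k b_k for phi, and
    the claim is that multiplying coefficientwise by b_k keeps the half-plane
    Re > beta.  If G(z) = sum b_k z^k has Re G >= 1/2, then 2 Re G - 1 is a
    nonnegative kernel of mean 1 on circles, and sum q_k b_k z^k is the average
    of sum q_k z^k against that kernel ([conv_formula], [conv_half_plane]).  So
    everything reduces to Re (g(z)/z)^alpha > 1/2 for convex g.  Since
    cos (alpha t) >= (cos t)^alpha, the case alpha = 1 suffices
    ([Cpower_Re_half]); that case is the theorem of Marx and Strohhaecker
    ([marx_strohhacker]).

    The Marx-Strohhaecker inequality.  By convexity (1-t) g(z) + t g(xz) with
    |x| <= 1 lies in the image of g, and composing with the inverse of g gives a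
    self-map of the disc fixing 0.  The Schwarz lemma and differentiation at
    t = 0 give Re ((g(z) - g(xz)) / (z g'(z))) >= 0 ([convex_tangent]).
    Averaging over |x| = 1 against 1 + cos isolates the first coefficient of g:
    Re ((g(z) - kappa z/2) / (z g'(z))) > 0 for every |kappa| = 1
    ([convex_strict]).  Put w = 1 - z/g(z); then Re (g(z)/z) > 1/2 means
    |w| < 1.  If |w| reached 1, then at a first such point Jack's lemma would
    give z w' = m w with m real, m >= 1, and the strict inequality for a suitable
    kappa would read |1 + (m-1) w| < 2 - m, which is false
    ([marx_algebra]).

    Existence of phi.  The series of q_k b_k has positive real part because
    beta >= 0.  Removing the weights (alpha + k)/alpha one at a time keeps this,
    because t^alpha times the real part is increasing along rays
    ([half_plane_step]); so the series of a_k b_k has positive real part in the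
    whole disc and a holomorphic power 1/alpha ([power_root_exists]).

    The function theory behind this starts from functions with a continuous
    complex derivative.  Cauchy's formula for the centred circles follows by
    contracting the circle to a point and differentiating under the integral
    sign, and it makes these functions power series on the whole disc
    ([taylor]).  The convolution formula with the geometric series yields
    Harnack's inequality and the maximum principle, from which come the local
    surjectivity of holomorphic functions and the holomorphy of inverses of
    univalent functions. *)

Open Scope R_scope.

(** * Complex numbers: elementary estimates *)

Lemma Cmod_tri_rev (x y : C) : Cmod x - Cmod y <= Cmod (x + y)%C.
Proof.
  pose proof (Cmod_triangle (x + y)%C (- y)%C) as H.
  rewrite Cmod_opp in H. replace (x + y + - y)%C with x in H by ring. lra.
Qed.

Lemma Cmod_sub_sym (x y : C) : Cmod (x - y)%C = Cmod (y - x)%C.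
Proof. rewrite <- (Cmod_opp (y - x)%C). f_equal. ring. Qed.

Lemma im_le_Cmod (c : C) : Rabs (Im c) <= Cmod c.
Proof. eapply Rle_trans; [ apply Rmax_r | apply (Rmax_Cmod c)]. Qed.

Lemma Cmod_le_ReIm (c : C) : Cmod c <= Rabs (Re c) + Rabs (Im c).
Proof.
  destruct c as [x y]; unfold Re, Im; simpl.
  replace (x, y) with (RtoC x + Ci * RtoC y)%C
    by (apply injective_projections; simpl; ring).
  eapply Rle_trans; [apply Cmod_triangle|].
  rewrite Cmod_mult, Cmod_Ci, !Cmod_R; lra.
Qed.

Lemma Re_le_Cmod (c : C) : Re c <= Cmod c.
Proof. eapply Rle_trans; [apply Rle_abs | apply re_le_Cmod]. Qed.

Lemma C_ext_ReIm (x y : C) : Re x = Re y -> Im x = Im y -> x = y.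
Proof. intros; now apply injective_projections. Qed.

Lemma Re_Cscal (r : R) (z : C) : Re (RtoC r * z)%C = r * Re z.
Proof. unfold Re; simpl; ring. Qed.

Lemma Cneq_of_Re (z : C) : Re z <> 0 -> z <> RtoC 0.
Proof. intros H ->; apply H; reflexivity. Qed.

Lemma ratio_lt_1 (x r : R) : 0 <= x < r -> 0 <= x / r < 1.
Proof.
  intros H. split; [apply Rdiv_le_0_compat; lra|].
  apply Rmult_lt_reg_r with r; [lra|]. unfold Rdiv. rewrite Rmult_assoc, Rinv_l; lra.
Qed.

Lemma pos_real_neq0 (x : R) : 0 < x -> RtoC x <> RtoC 0.
Proof. intros H. apply Cneq_of_Re. unfold Re; simpl. lra. Qed.

Lemma Cmod_pos_real (x : R) : 0 < x -> Cmod (RtoC x) = x.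
Proof. intros H. rewrite Cmod_R, Rabs_pos_eq; lra. Qed.

Lemma Cmod_div_real_lt_1 (z : C) (r : R) : 0 < r -> Cmod z < r -> Cmod (z / RtoC r)%C < 1.
Proof.
  intros Hr Hz. rewrite Cmod_div by (now apply pos_real_neq0). rewrite Cmod_pos_real by auto.
  apply ratio_lt_1. pose proof (Cmod_ge_0 z). lra.
Qed.

Lemma Cpow_1_l (k : nat) : Cpow (RtoC 1) k = RtoC 1.
Proof. induction k; simpl; [reflexivity|]. rewrite IHk. ring. Qed.

Lemma pow_n_Cpow (z : C) (k : nat) : pow_n (K := C_AbsRing) z k = Cpow z k.
Proof. induction k; [reflexivity|]. simpl. now rewrite <- IHk. Qed.

(** * Continuity of complex-valued functions *)

Lemma locally_Cmod (z : C) (d : R) : 0 < d -> locally z (fun w : C => Cmod (w - z)%C < d).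
Proof.
  intros Hd. apply locally_C. exists (mkposreal d Hd). intros y Hy. exact Hy.
Qed.

Lemma locally_Cmod_ex (z : C) (P : C -> Prop) :
  locally z P -> exists d, 0 < d /\ forall w, Cmod (w - z)%C < d -> P w.
Proof.
  intros H. apply locally_C in H. destruct H as [d Hd].
  exists d; split; [apply cond_pos|]. intros w Hw; apply Hd; exact Hw.
Qed.

Lemma locally_Cmod_lt (z : C) (r : R) : Cmod z < r -> locally z (fun w : C => Cmod w < r).
Proof.
  intros H. apply filter_imp with (2 := locally_Cmod z (r - Cmod z) ltac:(lra)).
  intros w Hw. pose proof (Cmod_triangle (w - z)%C z) as T.
  replace (w - z + z)%C with w in T by ring. lra.
Qed.

Section Continuity.
Context {U : UniformSpace}.
Implicit Types (f g : U -> C) (x : U).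

Lemma cont_eps f x :
  continuous f x <-> forall eps, 0 < eps -> locally x (fun w => Cmod (f w - f x)%C < eps).
Proof.
  split.
  - intros H eps He. apply (H (fun y : C => Cmod (y - f x)%C < eps)). now apply locally_Cmod.
  - intros H P HP. destruct (locally_Cmod_ex _ _ HP) as [d [Hd Hd']].
    specialize (H d Hd). unfold filtermap. revert H. apply filter_imp. auto.
Qed.

Lemma cont_Re f x : continuous f x -> continuous (fun w => Re (f w)) x.
Proof. intros H. apply (continuous_comp f Re x H). apply (continuous_fst (U:=R_UniformSpace) (V:=R_UniformSpace)). Qed.

Lemma cont_Im f x : continuous f x -> continuous (fun w => Im (f w)) x.
Proof. intros H. apply (continuous_comp f Im x H). apply (continuous_snd (U:=R_UniformSpace) (V:=R_UniformSpace)). Qed.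

Lemma cont_ReIm f x :
  continuous (fun w => Re (f w)) x -> continuous (fun w => Im (f w)) x -> continuous f x.
Proof.
  intros H1 H2. apply cont_eps. intros eps He.
  assert (A : forall h : U -> R, continuous h x -> locally x (fun w => Rabs (h w - h x) < eps / 2)).
  { intros h Hh. apply (Hh (fun y => Rabs (y - h x) < eps / 2)). exists (mkposreal (eps/2) ltac:(lra)). intros y Hy. exact Hy. }
  generalize (filter_and _ _ (A _ H1) (A _ H2)). apply filter_imp. intros w [B1 B2].
  eapply Rle_lt_trans; [apply Cmod_le_ReIm|].
  replace (Re (f w - f x)%C) with (Re (f w) - Re (f x)) by (unfold Re; simpl; ring).
  replace (Im (f w - f x)%C) with (Im (f w) - Im (f x)) by (unfold Im; simpl; ring).
  lra.
Qed.

Lemma cont_const (c : C) x : continuous (fun _ : U => c) x.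
Proof. apply continuous_const. Qed.

Lemma cont_RtoC (h : U -> R) x : continuous h x -> continuous (fun w => RtoC (h w)) x.
Proof. intros H; apply cont_ReIm; [exact H | apply continuous_const]. Qed.

Lemma cont_add f g x : continuous f x -> continuous g x -> continuous (fun w => f w + g w)%C x.
Proof.
  intros Hf Hg; apply cont_ReIm; unfold Re, Im; simpl;
  apply (continuous_plus (V:=R_NormedModule)); auto using cont_Re, cont_Im.
Qed.

Lemma cont_opp f x : continuous f x -> continuous (fun w => - f w)%C x.
Proof.
  intros Hf; apply cont_ReIm; unfold Re, Im; simpl;
  apply (continuous_opp (V:=R_NormedModule)); auto using cont_Re, cont_Im.
Qed.

Lemma cont_sub f g x : continuous f x -> continuous g x -> continuous (fun w => f w - g w)%C x.
Proof. intros Hf Hg. apply cont_add; auto using cont_opp. Qed.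

Lemma cont_mul f g x : continuous f x -> continuous g x -> continuous (fun w => f w * g w)%C x.
Proof.
  intros Hf Hg. pose proof (cont_Re _ _ Hf). pose proof (cont_Im _ _ Hf).
  pose proof (cont_Re _ _ Hg). pose proof (cont_Im _ _ Hg).
  apply cont_ReIm; unfold Re, Im; simpl.
  - apply (continuous_minus (V:=R_NormedModule)); apply (continuous_mult (K:=R_AbsRing)); auto.
  - apply (continuous_plus (V:=R_NormedModule)); apply (continuous_mult (K:=R_AbsRing)); auto.
Qed.

Lemma cont_inv f x : continuous f x -> f x <> RtoC 0 -> continuous (fun w => / f w)%C x.
Proof.
  intros Hf Hne. apply cont_eps. intros eps He.
  pose proof (proj1 (Cmod_gt_0 _) Hne) as Hm. set (m := Cmod (f x)) in *.
  assert (Hd : 0 < Rmin (m / 2) (eps * m * m / 2)).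
  { apply Rmin_pos; [lra|]. pose proof (Rmult_lt_0_compat _ _ (Rmult_lt_0_compat _ _ He Hm) Hm). lra. }
  generalize (proj1 (cont_eps _ _) Hf _ Hd). apply filter_imp. intros w Hw.
  pose proof (Rlt_le_trans _ _ _ Hw (Rmin_l _ _)) as H1.
  pose proof (Rlt_le_trans _ _ _ Hw (Rmin_r _ _)) as H2.
  assert (Hfw : m / 2 < Cmod (f w)).
  { pose proof (Cmod_tri_rev (f x) (f w - f x)%C) as T.
    replace (f x + (f w - f x))%C with (f w) in T by ring. fold m in T. lra. }
  assert (f w <> RtoC 0) by (apply Cmod_gt_0; lra).
  replace (/ f w - / f x)%C with (- (f w - f x) / (f w * f x))%C by (field; auto).
  rewrite Cmod_div by (apply Cmult_neq_0; auto). rewrite Cmod_opp, Cmod_mult. fold m.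
  apply Rmult_lt_reg_r with (Cmod (f w) * m); [nra|].
  unfold Rdiv. rewrite Rmult_assoc, Rinv_l, Rmult_1_r by nra.
  apply Rlt_trans with (1 := H2).
  pose proof (Rmult_lt_compat_l (eps * m) _ _ (Rmult_lt_0_compat _ _ He Hm) Hfw). lra.
Qed.

Lemma cont_div f g x :
  continuous f x -> continuous g x -> g x <> RtoC 0 -> continuous (fun w => f w / g w)%C x.
Proof. intros; apply cont_mul; auto using cont_inv. Qed.

Lemma cont_neq0 f x : continuous f x -> f x <> RtoC 0 -> locally x (fun w => f w <> RtoC 0).
Proof.
  intros Hf Hne. pose proof (proj1 (Cmod_gt_0 _) Hne) as Hm.
  generalize (proj1 (cont_eps _ _) Hf _ Hm). apply filter_imp. intros w Hw E.
  rewrite E, Cmod_sub_sym in Hw. replace (f x - 0)%C with (f x) in Hw by ring. lra.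
Qed.

Lemma cont_Re_gt f x (c : R) : continuous f x -> c < Re (f x) -> locally x (fun w => c < Re (f w)).
Proof.
  intros Hf H. generalize (proj1 (cont_eps _ _) Hf (Re (f x) - c) ltac:(lra)). apply filter_imp.
  intros w Hw. pose proof (re_le_Cmod (f w - f x)%C) as T.
  replace (Re (f w - f x)%C) with (Re (f w) - Re (f x)) in T by (unfold Re; simpl; ring).
  apply Rabs_le_between in T. lra.
Qed.

Lemma cont_Cmod_lt f x (c : R) : continuous f x -> Cmod (f x) < c -> locally x (fun w => Cmod (f w) < c).
Proof. intros Hf H. apply (Hf (fun y : C => Cmod y < c)). now apply locally_Cmod_lt. Qed.

Lemma cont_Cmod f x : continuous f x -> continuous (fun w => Cmod (f w)) x.
Proof.
  intros Hf P [d Hd]. unfold filtermap. generalize (proj1 (cont_eps _ _) Hf d (cond_pos d)). apply filter_imp.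
  intros w Hw. apply Hd. change (Rabs (Cmod (f w) - Cmod (f x)) < d).
  apply Rle_lt_trans with (2 := Hw).
  apply Rabs_le. split.
  - pose proof (Cmod_tri_rev (f x) (f w - f x)%C) as T.
    replace (f x + (f w - f x))%C with (f w) in T by ring. lra.
  - pose proof (Cmod_triangle (f x) (f w - f x)%C) as T.
    replace (f x + (f w - f x))%C with (f w) in T by ring. lra.
Qed.

Lemma cont_ext_loc f g x : locally x (fun w => f w = g w) -> continuous f x -> continuous g x.
Proof.
  intros E H. apply continuous_ext_loc with (2 := H).
  revert E; apply filter_imp; auto.
Qed.

Lemma cont_pow f x (n : nat) : continuous f x -> continuous (fun w => f w ^ n)%C x.
Proof.
  intros H. induction n; simpl; [apply continuous_const|]. now apply cont_mul.
Qed.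

End Continuity.

Lemma cont_id (z : C) : continuous (fun w : C => w) z.
Proof. apply continuous_id. Qed.

(** * Derivatives over the reals and over the complex numbers *)

(** Caratheodory's form of differentiability: the increment of [f] is the
    increment of [iota] times a function continuous at [x].  Taking [iota] to be
    the identity of the complex numbers or the embedding of the reals gives the
    complex derivative and the velocity of a curve, with one proof of each rule
    of differentiation. *)
Definition cara_deriv {U : UniformSpace} (iota f : U -> C) (x : U) (l : C) : Prop :=
  exists phi : U -> C, continuous phi x /\ phi x = l /\
    locally x (fun w => f w - f x = phi w * (iota w - iota x))%C.

Definition cder : (C -> C) -> C -> C -> Prop := @cara_deriv C_UniformSpace (fun z => z).
Definition rder : (R -> C) -> R -> C -> Prop := @cara_deriv R_UniformSpace RtoC.

Section Derivation.
Context {U : UniformSpace} (iota : U -> C).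
Implicit Types (f g : U -> C) (x : U).

Lemma cara_deriv_const (c : C) x : cara_deriv iota (fun _ => c) x (RtoC 0).
Proof.
  exists (fun _ => RtoC 0); split; [apply continuous_const|]. split; auto.
  apply filter_forall. intros; ring.
Qed.

Lemma cara_deriv_iota x : cara_deriv iota iota x (RtoC 1).
Proof.
  exists (fun _ => RtoC 1); split; [apply continuous_const|]. split; auto.
  apply filter_forall. intros; ring.
Qed.

Lemma cara_deriv_add f g x l m : cara_deriv iota f x l -> cara_deriv iota g x m -> cara_deriv iota (fun w => f w + g w)%C x (l + m)%C.
Proof.
  intros [p [Cp [Ep Hp]]] [q [Cq [Eq Hq]]].
  exists (fun w => p w + q w)%C. split; [now apply cont_add|]. split; [now rewrite Ep, Eq|].
  generalize (filter_and _ _ Hp Hq). apply filter_imp. intros w [A B].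
  rewrite Cmult_plus_distr_r, <- A, <- B. ring.
Qed.

Lemma cara_deriv_cont f x l : continuous iota x -> cara_deriv iota f x l -> continuous f x.
Proof.
  intros Ci [p [Cp [Ep Hp]]].
  apply cont_ext_loc with (f := fun w => (f x + p w * (iota w - iota x))%C).
  - revert Hp. apply filter_imp. intros w <-. ring.
  - apply cont_add; [apply cont_const|]. apply cont_mul; auto.
    apply cont_sub; auto. apply cont_const.
Qed.

Lemma cara_deriv_mul f g x l m : continuous iota x -> cara_deriv iota f x l -> cara_deriv iota g x m ->
  cara_deriv iota (fun w => f w * g w)%C x (l * g x + f x * m)%C.
Proof.
  intros Ci Hf Hg. pose proof (cara_deriv_cont _ _ _ Ci Hg) as Cg.
  destruct Hf as [p [Cp [Ep Hp]]], Hg as [q [Cq [Eq Hq]]].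
  exists (fun w => p w * g w + f x * q w)%C.
  split; [|split; [now rewrite Ep, Eq|]].
  - apply cont_add; apply cont_mul; auto. apply cont_const.
  - generalize (filter_and _ _ Hp Hq). apply filter_imp. intros w [A B].
    transitivity (g w * (p w * (iota w - iota x)) + f x * (q w * (iota w - iota x)))%C; [|ring].
    rewrite <- A, <- B. ring.
Qed.

Lemma cara_deriv_inv f x l : continuous iota x -> cara_deriv iota f x l -> f x <> RtoC 0 ->
  cara_deriv iota (fun w => / f w)%C x (- l / (f x * f x))%C.
Proof.
  intros Ci Hf Hne. pose proof (cara_deriv_cont _ _ _ Ci Hf) as Cf.
  pose proof (cont_neq0 _ _ Cf Hne) as Hloc.
  destruct Hf as [p [Cp [Ep Hp]]].
  exists (fun w => - p w / (f w * f x))%C. split; [|split; [now rewrite Ep|]].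
  - apply cont_div; [now apply cont_opp| |now apply Cmult_neq_0].
    apply cont_mul; auto. apply cont_const.
  - generalize (filter_and _ _ Hp Hloc). apply filter_imp. intros w [A B].
    transitivity (- (p w * (iota w - iota x)) / (f w * f x))%C; [|field; auto].
    rewrite <- A. field; auto.
Qed.

Lemma cara_deriv_ext_loc f g x l : locally x (fun w => f w = g w) -> cara_deriv iota f x l -> cara_deriv iota g x l.
Proof.
  intros E [p [Cp [Ep Hp]]]. exists p. split; [|split]; auto.
  pose proof (locally_singleton _ _ E) as E0.
  generalize (filter_and _ _ Hp E). apply filter_imp. intros w [A B].
  now rewrite <- B, <- E0.
Qed.

Lemma cara_deriv_comp (F : C -> C) f x l m : continuous iota x -> cder F (f x) l -> cara_deriv iota f x m ->
  cara_deriv iota (fun w => F (f w)) x (l * m)%C.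
Proof.
  intros Ci HF Hf. pose proof (cara_deriv_cont _ _ _ Ci Hf) as Cf.
  destruct HF as [p [Cp [Ep Hp]]], Hf as [q [Cq [Eq Hq]]].
  exists (fun w => p (f w) * q w)%C. split; [|split; [now rewrite Ep, Eq|]].
  - apply cont_mul; auto. now apply continuous_comp.
  - assert (Hp' : locally x (fun w => F (f w) - F (f x) = p (f w) * (f w - f x))%C) by exact (Cf _ Hp).
    generalize (filter_and _ _ Hp' Hq). apply filter_imp. intros w [A B].
    rewrite A, B. ring.
Qed.

Lemma cara_deriv_cmul (c : C) f x l : continuous iota x -> cara_deriv iota f x l ->
  cara_deriv iota (fun w => c * f w)%C x (c * l)%C.
Proof.
  intros Ci Hf. replace (c * l)%C with (RtoC 0 * f x + c * l)%C by ring.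
  apply cara_deriv_mul; auto. apply cara_deriv_const.
Qed.

Lemma cara_deriv_opp f x l : continuous iota x -> cara_deriv iota f x l -> cara_deriv iota (fun w => - f w)%C x (- l)%C.
Proof.
  intros Ci Hf. replace (- l)%C with (RtoC (-1) * l)%C by (apply C_ext_ReIm; simpl; unfold Re, Im; simpl; ring).
  apply cara_deriv_ext_loc with (f := fun w => (RtoC (-1) * f w)%C).
  - apply filter_forall; intros; apply C_ext_ReIm; unfold Re, Im; simpl; ring.
  - now apply cara_deriv_cmul.
Qed.

Lemma cara_deriv_sub f g x l m : continuous iota x -> cara_deriv iota f x l -> cara_deriv iota g x m ->
  cara_deriv iota (fun w => f w - g w)%C x (l - m)%C.
Proof. intros; apply cara_deriv_add; auto. now apply cara_deriv_opp. Qed.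

End Derivation.

Lemma cder_cont f z l : cder f z l -> continuous f z.
Proof. apply cara_deriv_cont. apply cont_id. Qed.

Lemma cont_RtoC_id (t : R) : continuous RtoC t.
Proof. apply (cont_RtoC (U:=R_UniformSpace) (fun s => s)). apply continuous_id. Qed.

Lemma rder_comp (F : C -> C) (f : R -> C) (t : R) (l m : C) :
  cder F (f t) l -> rder f t m -> rder (fun s => F (f s)) t (l * m)%C.
Proof. apply cara_deriv_comp. apply cont_RtoC_id. Qed.

Lemma rder_mul (f g : R -> C) (t : R) (l m : C) :
  rder f t l -> rder g t m -> rder (fun s => f s * g s)%C t (l * g t + f t * m)%C.
Proof. apply cara_deriv_mul. apply cont_RtoC_id. Qed.

Lemma rder_cmul (c : C) (f : R -> C) (t : R) (l : C) : rder f t l -> rder (fun s => c * f s)%C t (c * l)%C.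
Proof. apply cara_deriv_cmul. apply cont_RtoC_id. Qed.

Lemma rder_sub (f g : R -> C) (t : R) (l m : C) :
  rder f t l -> rder g t m -> rder (fun s => f s - g s)%C t (l - m)%C.
Proof. apply cara_deriv_sub. apply cont_RtoC_id. Qed.

Lemma rder_scaled (d : C) (t : R) : rder (fun s => RtoC s * d)%C t d.
Proof.
  apply (cara_deriv_ext_loc RtoC (fun s : R => (d * RtoC s)%C)).
  - apply filter_forall. intros s. apply Cmult_comm.
  - pose proof (rder_cmul d RtoC t _ (cara_deriv_iota RtoC t)) as H. now rewrite Cmult_1_r in H.
Qed.

Lemma rder_affine (c d : C) (t : R) : rder (fun s => c + RtoC s * d)%C t d.
Proof.
  pose proof (cara_deriv_add RtoC _ _ t _ _ (cara_deriv_const RtoC c t) (rder_scaled d t)) as H.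
  now rewrite Cplus_0_l in H.
Qed.

Lemma cder_id (z : C) : cder (fun w => w) z (RtoC 1).
Proof. apply (cara_deriv_iota (U := C_UniformSpace) (fun w => w)). Qed.

Lemma cder_comp (F f : C -> C) (z l m : C) : cder F (f z) l -> cder f z m -> cder (fun w => F (f w)) z (l * m)%C.
Proof. apply (cara_deriv_comp (U := C_UniformSpace)). apply cont_id. Qed.

Lemma cder_mul (f g : C -> C) (z l m : C) :
  cder f z l -> cder g z m -> cder (fun w => f w * g w)%C z (l * g z + f z * m)%C.
Proof. apply (cara_deriv_mul (U := C_UniformSpace)). apply cont_id. Qed.

Lemma cder_cmul (c : C) (f : C -> C) (z l : C) : cder f z l -> cder (fun w => c * f w)%C z (c * l)%C.
Proof. apply (cara_deriv_cmul (U := C_UniformSpace)). apply cont_id. Qed.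

Lemma cder_sub (f g : C -> C) (z l m : C) :
  cder f z l -> cder g z m -> cder (fun w => f w - g w)%C z (l - m)%C.
Proof. apply (cara_deriv_sub (U := C_UniformSpace)). apply cont_id. Qed.

(** Connects with the filter-based derivative, and through it with
    [C_derive], in terms of which the Salagean operator is defined. *)
Lemma cder_is_derive (f : C -> C) z l : cder f z l ->
  @is_derive C_AbsRing C_NormedModule f z l.
Proof.
  intros [p [Cp [Ep Hp]]]. split.
  - apply (is_linear_scal_l (K := C_AbsRing) (V:=C_NormedModule)).
  - intros x Hx. assert (Hx' := is_filter_lim_locally_unique _ _ Hx). subst x.
    intros eps. apply locally_C.
    generalize (filter_and _ _ Hp (proj1 (cont_eps _ _) Cp eps (cond_pos eps))).
    apply filter_imp. intros w [A B].
    change (Cmod ((f w - f z) - (w - z) * l)%C <= eps * Cmod (w - z)%C).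
    rewrite A, <- Ep. replace (p w * (w - z) - (w - z) * p z)%C with ((p w - p z) * (w - z))%C by ring.
    rewrite Cmod_mult. apply Rmult_le_compat_r; [apply Cmod_ge_0|lra].
Qed.

Lemma cder_C_derive f z l : cder f z l -> C_derive f z = l.
Proof. intros H. apply is_C_derive_unique. now apply cder_is_derive. Qed.

Lemma cder_unique f z l m : cder f z l -> cder f z m -> l = m.
Proof. intros H1 H2. now rewrite <- (cder_C_derive _ _ _ H1), <- (cder_C_derive _ _ _ H2). Qed.

Lemma is_derive_caratheodory (f p : R -> R) (t : R) :
  continuous p t -> locally t (fun s => f s - f t = p s * (s - t)) -> is_derive f t (p t).
Proof.
  intros Cp Hp. split.
  - apply (is_linear_scal_l (K := R_AbsRing) (V:=R_NormedModule)).
  - intros x Hx. assert (Hx' := is_filter_lim_locally_unique _ _ Hx). subst x.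
    intros eps.
    assert (B : locally t (fun s => Rabs (p s - p t) < eps)).
    { apply (Cp (fun y => Rabs (y - p t) < eps)). exists eps. intros y Hy. exact Hy. }
    generalize (filter_and _ _ Hp B).
    apply filter_imp. intros w [A B'].
    change (Rabs ((f w - f t) - (w - t) * p t) <= eps * Rabs (w - t)).
    rewrite A. replace (p w * (w - t) - (w - t) * p t) with ((p w - p t) * (w - t)) by ring.
    rewrite Rabs_mult. apply Rmult_le_compat_r; [apply Rabs_pos|lra].
Qed.

Lemma rder_Re f t l : rder f t l -> is_derive (fun s => Re (f s)) t (Re l).
Proof.
  intros [p [Cp [Ep Hp]]]. rewrite <- Ep.
  apply (is_derive_caratheodory (fun s => Re (f s)) (fun s => Re (p s))); [now apply cont_Re|].
  revert Hp. apply filter_imp. intros s Hs. apply (f_equal Re) in Hs. revert Hs.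
  unfold Re; simpl. intros; lra.
Qed.

Lemma rder_Im f t l : rder f t l -> is_derive (fun s => Im (f s)) t (Im l).
Proof.
  intros [p [Cp [Ep Hp]]]. rewrite <- Ep.
  apply (is_derive_caratheodory (fun s => Im (f s)) (fun s => Im (p s))); [now apply cont_Im|].
  revert Hp. apply filter_imp. intros s Hs. apply (f_equal Im) in Hs. revert Hs.
  unfold Im; simpl. intros; lra.
Qed.

Lemma caratheodory_of_is_derive (f : R -> R) (t l : R) : is_derive f t l ->
  exists p : R -> R, continuous p t /\ p t = l /\ forall s, f s - f t = p s * (s - t).
Proof.
  intros H.
  exists (fun s => if Req_EM_T s t then l else (f s - f t) / (s - t)).
  split; [|split].
  - intros P [eps Heps]. destruct H as [_ H].
    specialize (H t (fun P H => H) (mkposreal (eps / 2) ltac:(destruct eps; simpl; lra))).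
    unfold filtermap. revert H. apply filter_imp. intros s Hs. apply Heps.
    destruct (Req_EM_T t t); [|lra].
    destruct (Req_EM_T s t).
    + apply ball_center.
    + change (Rabs ((f s - f t) / (s - t) - l) < eps).
      change (Rabs ((f s - f t) - (s - t) * l) <= eps / 2 * Rabs (s - t)) in Hs.
      assert (Hp : 0 < Rabs (s - t)) by (apply Rabs_pos_lt; lra).
      replace ((f s - f t) / (s - t) - l) with (((f s - f t) - (s - t) * l) / (s - t)) by (field; lra).
      unfold Rdiv. rewrite Rabs_mult, Rabs_inv.
      apply Rmult_lt_reg_r with (Rabs (s - t)); auto.
      rewrite Rmult_assoc, Rinv_l, Rmult_1_r by lra. pose proof (cond_pos eps). nra.
  - destruct (Req_EM_T t t); lra.
  - intros s. destruct (Req_EM_T s t); [subst; ring | field; lra].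
Qed.

Lemma rder_ReIm (f : R -> C) t (l : C) :
  is_derive (fun s => Re (f s)) t (Re l) -> is_derive (fun s => Im (f s)) t (Im l) -> rder f t l.
Proof.
  intros H1 H2. destruct (caratheodory_of_is_derive _ _ _ H1) as [p [Cp [Ep Hp]]].
  destruct (caratheodory_of_is_derive _ _ _ H2) as [q [Cq [Eq Hq]]].
  exists (fun s => (p s, q s)). split; [|split].
  - now apply cont_ReIm.
  - now apply C_ext_ReIm.
  - apply filter_forall. intros s. specialize (Hp s). specialize (Hq s).
    apply C_ext_ReIm; unfold Re, Im in *; simpl in *; lra.
Qed.

Lemma cder_eps (f : C -> C) z l :
  (forall eps, 0 < eps -> locally z (fun w => Cmod (f w - f z - l * (w - z))%C <= eps * Cmod (w - z)%C)) ->
  cder f z l.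
Proof.
  intros H.
  assert (D : forall w z : C, w <> z -> (w - z)%C <> RtoC 0).
  { intros a b Hab E. apply Hab. replace a with (a - b + b)%C by ring. rewrite E; ring. }
  assert (Dec : forall w : C, {w = z} + {w <> z}).
  { intros [a b]. destruct z as [c d]. destruct (Req_EM_T a c), (Req_EM_T b d); subst; auto; right; congruence. }
  exists (fun w => if Dec w then l else ((f w - f z) / (w - z))%C).
  split; [|split].
  - apply cont_eps. intros eps He. generalize (H (eps / 2) ltac:(lra)). apply filter_imp.
    intros w Hw. destruct (Dec z); [|congruence]. destruct (Dec w).
    + replace (l - l)%C with (RtoC 0) by ring. rewrite Cmod_0; lra.
    + replace ((f w - f z) / (w - z) - l)%C with ((f w - f z - l * (w - z)) / (w - z))%C
        by (field; auto).
      assert (0 < Cmod (w - z)%C) by (apply Cmod_gt_0; auto).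
      rewrite Cmod_div by auto. apply Rmult_lt_reg_r with (Cmod (w - z)%C); auto.
      unfold Rdiv. rewrite Rmult_assoc, Rinv_l, Rmult_1_r by lra. nra.
  - destruct (Dec z); congruence.
  - apply filter_forall. intros w. destruct (Dec w); [subst; ring | field; auto].
Qed.

(** * Complex power series *)

Notation cpseries := (@is_pseries C_AbsRing C_NormedModule).
Implicit Types (a b : nat -> C) (z w : C).

Fixpoint psum (a : nat -> C) (z : C) (n : nat) : C :=
  match n with
  | O => a O
  | S m => (psum a z m + a (S m) * z ^ (S m))%C
  end.

Lemma psum_sum_n a z n : psum a z n = sum_n (fun k => scal (V := C_NormedModule) (pow_n (K := C_AbsRing) z k) (a k)) n.
Proof.
  induction n.
  - rewrite sum_O, pow_n_Cpow. simpl. change (a 0%nat = (RtoC 1 * a 0%nat)%C). ring.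
  - rewrite sum_Sn, <- IHn, pow_n_Cpow. change (psum a z (S n) = (psum a z n + z ^ S n * a (S n))%C).
    simpl; ring.
Qed.

(** The filter in a convergent series is that of a product of two lines;
    this trades it for the modulus. *)
Lemma pseries_eps a z (l : C) :
  cpseries a z l <->
  forall eps, 0 < eps -> exists N, forall n, (N <= n)%nat -> Cmod (psum a z n - l)%C < eps.
Proof.
  unfold is_pseries, is_series. split.
  - intros H eps He. specialize (H _ (locally_Cmod l eps He)).
    destruct H as [N HN]. exists N. intros n Hn. rewrite psum_sum_n. now apply HN.
  - intros H P HP. destruct (locally_Cmod_ex _ _ HP) as [d [Hd Hd']].
    destruct (H d Hd) as [N HN]. exists N. intros n Hn. apply Hd'.
    rewrite <- psum_sum_n. now apply HN.
Qed.

Lemma le_of_le_plus_eps (x y : R) : (forall eps, 0 < eps -> x <= y + eps) -> x <= y.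
Proof. intros H. apply le_epsilon. exact H. Qed.

Lemma pseries_unique a z (l m : C) : cpseries a z l -> cpseries a z m -> l = m.
Proof.
  rewrite !pseries_eps. intros H1 H2.
  assert (E : Cmod (l - m)%C = 0).
  { apply Rle_antisym; [|apply Cmod_ge_0]. apply le_of_le_plus_eps. intros eps He.
    destruct (H1 (eps/2) ltac:(lra)) as [N1 K1]. destruct (H2 (eps/2) ltac:(lra)) as [N2 K2].
    specialize (K1 (N1 + N2)%nat ltac:(lia)). specialize (K2 (N1 + N2)%nat ltac:(lia)).
    set (s := psum a z (N1 + N2)) in *.
    replace (l - m)%C with ((l - s) + (s - m))%C by ring.
    pose proof (Cmod_triangle (l - s)%C (s - m)%C).
    rewrite (Cmod_sub_sym l s) in H. lra. }
  apply Cmod_eq_0 in E. replace l with (l - m + m)%C by ring. rewrite E; ring.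
Qed.

(** Total, so that sums can be formed before convergence is known; equal to the
    sum wherever the series converges. *)
Definition pseries_value (a : nat -> C) (z : C) : C :=
  (Series (fun k => Re (a k * z ^ k)%C), Series (fun k => Im (a k * z ^ k)%C)).

Lemma psum_Re a z n : Re (psum a z n) = sum_n (fun k => Re (a k * z ^ k)%C) n.
Proof.
  induction n.
  - rewrite sum_O. change (z ^ 0)%C with (RtoC 1). now rewrite Cmult_1_r.
  - rewrite sum_Sn, <- IHn. reflexivity.
Qed.

Lemma psum_Im a z n : Im (psum a z n) = sum_n (fun k => Im (a k * z ^ k)%C) n.
Proof.
  induction n.
  - rewrite sum_O. change (z ^ 0)%C with (RtoC 1). now rewrite Cmult_1_r.
  - rewrite sum_Sn, <- IHn. reflexivity.
Qed.

Lemma real_series_eps (u : nat -> R) (l : R) :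
  (forall eps, 0 < eps -> exists N, forall n, (N <= n)%nat -> Rabs (sum_n u n - l) < eps) <->
  is_series u l.
Proof.
  split.
  - intros H P [d Hd]. destruct (H d (cond_pos d)) as [N HN]. exists N. intros n Hn.
    apply Hd. apply HN; auto.
  - intros H eps He.
    assert (L : locally l (fun y => Rabs (y - l) < eps)).
    { exists (mkposreal eps He). intros y Hy; exact Hy. }
    specialize (H _ L). exact H.
Qed.

Lemma pseries_value_correct a z (l : C) : cpseries a z l -> pseries_value a z = l.
Proof.
  rewrite pseries_eps. intros H.
  apply C_ext_ReIm.
  - change (Series (fun k => Re (a k * z ^ k)%C) = Re l).
    apply is_series_unique, real_series_eps. intros eps He; destruct (H eps He) as [N HN]; exists N; intros n Hn.
    apply Rle_lt_trans with (2 := HN n Hn). rewrite <- psum_Re.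
    change (Rabs (Re (psum a z n - l)%C) <= Cmod (psum a z n - l)). apply re_le_Cmod.
  - change (Series (fun k => Im (a k * z ^ k)%C) = Im l).
    apply is_series_unique, real_series_eps. intros eps He; destruct (H eps He) as [N HN]; exists N; intros n Hn.
    apply Rle_lt_trans with (2 := HN n Hn). rewrite <- psum_Im.
    change (Rabs (Im (psum a z n - l)%C) <= Cmod (psum a z n - l)). apply im_le_Cmod.
Qed.

(** * Geometric bounds, convergence and uniqueness of coefficients *)

(** Cauchy-type bound at radius [r]; convergence of power series and
    bounds of their tails are derived from it by comparison with a geometric
    series. *)
Definition coef_bound (a : nat -> C) (r M : R) : Prop :=
  forall k, Cmod (a k) * r ^ k <= M.

Lemma nat_bound (u : nat -> R) N : exists M, forall n, (n <= N)%nat -> u n <= M.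
Proof.
  induction N.
  - exists (u O). intros n Hn. replace n with O by lia. lra.
  - destruct IHN as [M HM]. exists (Rmax M (u (S N))). intros n Hn.
    destruct (Nat.eq_dec n (S N)) as [->|E]; [apply Rmax_r|].
    eapply Rle_trans; [apply HM; lia | apply Rmax_l].
Qed.

Lemma pseries_coef_bound a z (l : C) : cpseries a z l -> exists M, coef_bound a (Cmod z) M.
Proof.
  rewrite pseries_eps. intros H. destruct (H 1 ltac:(lra)) as [N HN].
  destruct (nat_bound (fun k => Cmod (a k) * Cmod z ^ k) N) as [M HM].
  exists (Rmax M 2). intros k. destruct (le_lt_dec k N) as [L|L].
  - eapply Rle_trans; [now apply HM | apply Rmax_l].
  - eapply Rle_trans; [|apply Rmax_r]. destruct k; [lia|].
    rewrite <- Cmod_pow, <- Cmod_mult.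
    pose proof (HN (S k) ltac:(lia)) as H1. pose proof (HN k ltac:(lia)) as H2.
    change (psum a z (S k)) with (psum a z k + a (S k) * z ^ S k)%C in H1.
    replace (a (S k) * z ^ S k)%C with ((psum a z k + a (S k) * z ^ S k - l) - (psum a z k - l))%C by ring.
    eapply Rle_trans; [apply Cmod_triangle|]. rewrite Cmod_opp. lra.
Qed.

Lemma coef_bound_nonneg a r M : coef_bound a r M -> 0 <= M.
Proof.
  intros H. specialize (H O). simpl in H. pose proof (Cmod_ge_0 (a O)). lra.
Qed.

Lemma term_bound a r M z q k : coef_bound a r M -> 0 <= r -> 0 <= q -> Cmod z <= q * r ->
  Cmod (a k * z ^ k)%C <= M * q ^ k.
Proof.
  intros H Hr Hq Hz. rewrite Cmod_mult, Cmod_pow.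
  pose proof (pow_incr (Cmod z) (q * r) k ltac:(split; [apply Cmod_ge_0|lra])) as P.
  rewrite Rpow_mult_distr in P.
  pose proof (Rmult_le_compat_l _ _ _ (Cmod_ge_0 (a k)) P).
  pose proof (Rmult_le_compat_r _ _ _ (pow_le q k Hq) (H k)). lra.
Qed.

Lemma psum_tail a r M z q n m : coef_bound a r M -> 0 <= r -> 0 <= q < 1 -> Cmod z <= q * r ->
  (n <= m)%nat ->
  Cmod (psum a z m - psum a z n)%C <= M / (1 - q) * (q ^ S n - q ^ S m).
Proof.
  intros H Hr Hq Hz Hnm. induction Hnm as [|m Hnm IH].
  - replace (psum a z n - psum a z n)%C with (RtoC 0) by ring. rewrite Cmod_0. lra.
  - change (psum a z (S m)) with (psum a z m + a (S m) * z ^ S m)%C.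
    replace (psum a z m + a (S m) * z ^ S m - psum a z n)%C
      with ((psum a z m - psum a z n) + a (S m) * z ^ S m)%C by ring.
    eapply Rle_trans; [apply Cmod_triangle|].
    pose proof (term_bound a r M z q (S m) H Hr (proj1 Hq) Hz).
    replace (M / (1 - q) * (q ^ S n - q ^ S (S m))) with
      (M / (1 - q) * (q ^ S n - q ^ S m) + M * q ^ S m); [lra|].
    simpl; field; lra.
Qed.

Lemma psum_tail_geometric a r M z q n m : coef_bound a r M -> 0 <= r -> 0 <= q < 1 -> Cmod z <= q * r ->
  (n <= m)%nat ->
  Cmod (psum a z m - psum a z n)%C <= M / (1 - q) * q ^ S n.
Proof.
  intros H Hr Hq Hz Hnm. eapply Rle_trans; [now apply (psum_tail a r M z q)|].
  pose proof (coef_bound_nonneg _ _ _ H). pose proof (pow_le q (S m) (proj1 Hq)).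
  assert (0 <= M / (1 - q)) by (apply Rdiv_le_0_compat; lra). nra.
Qed.

Lemma pseries_tail a r M z q n (l : C) : coef_bound a r M -> 0 <= r -> 0 <= q < 1 -> Cmod z <= q * r ->
  cpseries a z l -> Cmod (l - psum a z n)%C <= M / (1 - q) * q ^ S n.
Proof.
  intros H Hr Hq Hz Hl. rewrite pseries_eps in Hl. apply le_of_le_plus_eps. intros eps He.
  destruct (Hl eps He) as [N HN]. specialize (HN (N + n)%nat ltac:(lia)).
  pose proof (psum_tail_geometric a r M z q n (N + n) H Hr Hq Hz ltac:(lia)).
  replace (l - psum a z n)%C with ((psum a z (N + n) - psum a z n) + (l - psum a z (N + n)))%C by ring.
  eapply Rle_trans; [apply Cmod_triangle|]. rewrite (Cmod_sub_sym l). lra.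
Qed.

Lemma pseries_head a r M z q (l : C) : coef_bound a r M -> 0 <= r -> 0 <= q < 1 -> Cmod z <= q * r ->
  cpseries a z l -> Cmod (l - a O)%C <= M / (1 - q) * q.
Proof.
  intros H Hr Hq Hz Hl. pose proof (pseries_tail a r M z q O l H Hr Hq Hz Hl) as T.
  simpl in T. now rewrite Rmult_1_r in T.
Qed.

Lemma coef_bound_converges_ratio a r M z q : coef_bound a r M -> 0 <= r -> 0 <= q < 1 -> Cmod z <= q * r ->
  cpseries a z (pseries_value a z).
Proof.
  intros H Hr Hq Hz.
  assert (E : ex_series (K := C_AbsRing) (V := C_CompleteNormedModule)
     (fun k => scal (V := C_NormedModule) (pow_n (K := C_AbsRing) z k) (a k))).
  { apply (ex_series_le (K := C_AbsRing) (V := C_CompleteNormedModule)) with (b := fun k => M * q ^ k).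
    - intros k.
      rewrite pow_n_Cpow. change (norm ?x) with (Cmod x).
      change (Cmod (z ^ k * a k)%C <= M * q ^ k). rewrite Cmult_comm.
      now apply (term_bound a r).
    - apply (ex_series_scal (K:=R_AbsRing) (V:=R_NormedModule)). apply ex_series_geom.
      rewrite Rabs_pos_eq; lra. }
  destruct E as [l Hl].
  assert (Hl' : is_pseries (K := C_AbsRing) (V := C_NormedModule) a z l) by exact Hl.
  now rewrite (pseries_value_correct a z l Hl').
Qed.

(** The sum differs from its constant term by O(x) as x tends to 0.  Positive
    real points are enough, which matters for expansions known off a slit
    only. *)
Lemma pseries_zero_coeff (c : nat -> C) (r : R) : 0 < r ->
  (forall x, 0 < x < r -> cpseries c (RtoC x) (RtoC 0)) -> c O = RtoC 0.
Proof.
  intros Hr H. destruct (pseries_coef_bound _ _ _ (H (r / 2) ltac:(lra))) as [M HM].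
  rewrite Cmod_R, Rabs_pos_eq in HM by lra.
  pose proof (coef_bound_nonneg _ _ _ HM) as HM0.
  apply Cmod_eq_0. apply Rle_antisym; [|apply Cmod_ge_0]. apply le_of_le_plus_eps. intros eps He.
  set (q := Rmin (1 / 2) (eps / (2 * M + 1))).
  assert (Hq : 0 < q <= 1 / 2).
  { split; [|apply Rmin_l]. apply Rmin_pos; [lra|]. apply Rdiv_lt_0_compat; lra. }
  assert (Hq2 : q * (2 * M + 1) <= eps).
  { apply Rle_trans with (eps / (2 * M + 1) * (2 * M + 1)); [|right; field; lra].
    apply Rmult_le_compat_r; [lra|apply Rmin_r]. }
  pose proof (pseries_head c (r/2) M (RtoC (q * (r / 2))) q (RtoC 0) HM ltac:(lra) ltac:(lra)) as T.
  rewrite Cmod_R, Rabs_pos_eq in T by nra.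
  assert (Hx : 0 < q * (r / 2) < r).
  { split; [apply Rmult_lt_0_compat; lra|].
    apply Rle_lt_trans with (1 * (r / 2)); [apply Rmult_le_compat_r|]; lra. }
  specialize (T ltac:(lra) (H _ Hx)).
  rewrite Cmod_sub_sym in T. replace (c O - 0)%C with (c O) in T by ring.
  assert (M / (1 - q) * q <= 2 * M * q).
  { apply Rmult_le_compat_r; [lra|]. apply Rmult_le_reg_r with (1 - q); [lra|].
    unfold Rdiv. rewrite Rmult_assoc, Rinv_l, Rmult_1_r by lra. nra. }
  nra.
Qed.

Lemma psum_shift a z n : psum a z (S n) = (a O + z * psum (fun k => a (S k)) z n)%C.
Proof.
  induction n; [simpl; ring|].
  change (psum a z (S (S n))) with (psum a z (S n) + a (S (S n)) * z ^ (S (S n)))%C.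
  rewrite IHn. simpl. ring.
Qed.

Lemma pseries_shift a z (l : C) : z <> RtoC 0 -> cpseries a z l ->
  cpseries (fun k => a (S k)) z ((l - a O) / z)%C.
Proof.
  rewrite !pseries_eps. intros Hz H eps He. pose proof (proj1 (Cmod_gt_0 z) Hz) as Hp.
  destruct (H (eps * Cmod z) ltac:(nra)) as [N HN]. exists N. intros n Hn.
  specialize (HN (S n) ltac:(lia)). rewrite psum_shift in HN.
  apply Rmult_lt_reg_r with (Cmod z); [auto|]. rewrite <- Cmod_mult.
  replace ((psum (fun k => a (S k)) z n - (l - a O) / z) * z)%C with
    (a O + z * psum (fun k => a (S k)) z n - l)%C by (field; auto). exact HN.
Qed.

Lemma pseries_unshift a z (l : C) : cpseries (fun k => a (S k)) z l ->
  cpseries a z (a O + z * l)%C.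
Proof.
  rewrite !pseries_eps. intros H eps He. pose proof (Cmod_ge_0 z) as Hp.
  destruct (H (eps / (Cmod z + 1))) as [N HN]; [apply Rdiv_lt_0_compat; lra|].
  exists (S N). intros n Hn. destruct n; [lia|]. rewrite psum_shift.
  specialize (HN n ltac:(lia)).
  replace (a O + z * psum (fun k => a (S k)) z n - (a O + z * l))%C
    with (z * (psum (fun k => a (S k)) z n - l))%C by ring.
  rewrite Cmod_mult. set (x := Cmod (psum _ z n - l)%C) in *.
  apply Rle_lt_trans with (Cmod z * (eps / (Cmod z + 1))).
  - apply Rmult_le_compat_l; lra.
  - apply Rmult_lt_reg_r with (Cmod z + 1); [lra|]. unfold Rdiv.
    rewrite Rmult_assoc, Rmult_assoc, Rinv_l by lra. nra.
Qed.

Lemma pseries_at0 a : cpseries a (RtoC 0) (a O).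
Proof.
  apply pseries_eps. intros eps He. exists O. intros n _.
  replace (psum a 0 n) with (a O).
  - replace (a O - a O)%C with (RtoC 0) by ring. rewrite Cmod_0; lra.
  - induction n; [reflexivity|]. simpl. rewrite <- IHn. ring.
Qed.

Lemma pseries_plus a b z (l m : C) : cpseries a z l -> cpseries b z m ->
  cpseries (fun k => a k + b k)%C z (l + m)%C.
Proof. intros H1 H2. exact (is_pseries_plus (K := C_AbsRing) (V := C_NormedModule) a b z l m H1 H2). Qed.

Lemma pseries_scal c a z (l : C) : cpseries a z l -> cpseries (fun k => c * a k)%C z (c * l)%C.
Proof.
  intros H.
  exact (is_pseries_scal (K := C_AbsRing) (V := C_NormedModule) c a z l (Cmult_comm z c) H).
Qed.

Lemma pseries_ext a b z (l : C) : (forall k, a k = b k) -> cpseries a z l -> cpseries b z l.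
Proof. intros E. exact (is_pseries_ext (K := C_AbsRing) (V := C_NormedModule) a b z l E). Qed.

(** Divide the difference of the two series by x repeatedly and read off the
    constant term each time. *)
Lemma pseries_coeff_unique (a b : nat -> C) (F : C -> C) (r : R) : 0 < r ->
  (forall x, 0 < x < r -> cpseries a (RtoC x) (F (RtoC x))) ->
  (forall x, 0 < x < r -> cpseries b (RtoC x) (F (RtoC x))) -> forall k, a k = b k.
Proof.
  intros Hr Ha Hb.
  assert (Z : forall k (c : nat -> C), (forall x, 0 < x < r -> cpseries c (RtoC x) (RtoC 0)) -> c k = RtoC 0).
  { induction k; intros c Hc.
    - now apply (pseries_zero_coeff c r).
    - apply (IHk (fun k => c (S k))). intros x Hx.
      assert (N : RtoC x <> RtoC 0) by (intros E; apply (f_equal Re) in E; unfold Re in E; simpl in E; lra).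
      pose proof (pseries_shift _ _ _ N (Hc x Hx)) as S.
      rewrite (pseries_zero_coeff c r Hr Hc) in S.
      replace ((0 - 0) / x)%C with (RtoC 0) in S by (field; auto). exact S. }
  intros k. specialize (Z k (fun k => a k + (RtoC (-1)) * b k)%C). simpl in Z.
  replace (a k) with (a k + RtoC (-1) * b k + b k)%C.
  2:{ apply C_ext_ReIm; unfold Re, Im; simpl; ring. }
  rewrite Z; [ring|]. intros x Hx.
  replace (RtoC 0) with (F (RtoC x) + RtoC (-1) * F (RtoC x))%C.
  2:{ apply C_ext_ReIm; unfold Re, Im; simpl; ring. }
  apply pseries_plus; [auto|]. apply pseries_scal; auto.
Qed.

(** * Termwise differentiation *)

Definition expands (a : nat -> C) (R0 : R) (F : C -> C) : Prop :=
  forall z, Cmod z < R0 -> cpseries a z (F z).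

Definition deriv_coef (a : nat -> C) : nat -> C := fun k => (RtoC (INR (S k)) * a (S k))%C.

Lemma expands_coef_bound a R0 F r : expands a R0 F -> 0 <= r < R0 -> exists M, coef_bound a r M.
Proof.
  intros H Hr. destruct (pseries_coef_bound a (RtoC r) (F (RtoC r))) as [M HM].
  - apply H. rewrite Cmod_R, Rabs_pos_eq; lra.
  - exists M. rewrite Cmod_R, Rabs_pos_eq in HM by lra. exact HM.
Qed.

(** Bernoulli's inequality for (1/s)^k. *)
Lemma linear_geom_bound (s : R) : 0 < s < 1 -> exists C0, 0 < C0 /\ forall k, INR k * s ^ k <= C0.
Proof.
  intros Hs. set (h := / s - 1).
  assert (Hi : 1 < / s) by (rewrite <- Rinv_1; apply Rinv_lt_contravar; lra).
  assert (Hh : 0 < h) by (unfold h; lra).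
  exists (/ h). split; [now apply Rinv_0_lt_compat|]. intros k.
  pose proof (poly k h Hh) as P. replace (1 + h) with (/ s) in P by (unfold h; ring).
  rewrite pow_inv in P.
  assert (Hsk : 0 < s ^ k) by (apply pow_lt; lra).
  apply Rmult_le_reg_l with h; [auto|]. rewrite Rinv_r by lra.
  assert (Q : (1 + INR k * h) * s ^ k <= 1).
  { apply Rle_trans with (/ s ^ k * s ^ k); [|right; field; lra]. apply Rmult_le_compat_r; lra. }
  nra.
Qed.

Lemma coef_bound_index_weight a r r' M : 0 < r' < r -> coef_bound a r M ->
  exists M', coef_bound (fun k => RtoC (INR k) * a k)%C r' M'.
Proof.
  intros Hr H. pose proof (coef_bound_nonneg _ _ _ H).
  destruct (linear_geom_bound (r' / r)) as [C0 [HC0 HC]].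
  { split; [apply Rdiv_lt_0_compat; lra|]. apply ratio_lt_1; lra. }
  exists (M * C0). intros k. rewrite Cmod_mult, Cmod_R, Rabs_pos_eq by apply pos_INR.
  specialize (HC k). specialize (H k).
  replace (INR k * Cmod (a k) * r' ^ k) with ((Cmod (a k) * r ^ k) * (INR k * (r' / r) ^ k)).
  2:{ unfold Rdiv. rewrite Rpow_mult_distr, pow_inv. field. apply pow_nonzero; lra. }
  assert (0 <= Cmod (a k) * r ^ k) by (apply Rmult_le_pos; [apply Cmod_ge_0|apply pow_le; lra]).
  assert (0 <= INR k * (r' / r) ^ k).
  { apply Rmult_le_pos; [apply pos_INR|]. apply pow_le. apply Rlt_le, Rdiv_lt_0_compat; lra. }
  apply Rmult_le_compat; lra.
Qed.

Lemma coef_bound_converges a r M z : coef_bound a r M -> Cmod z < r -> cpseries a z (pseries_value a z).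
Proof.
  intros H Hz. pose proof (Cmod_ge_0 z).
  apply coef_bound_converges_ratio with (r := r) (M := M) (q := Cmod z / r); auto; try lra.
  - apply ratio_lt_1; lra.
  - right; field; lra.
Qed.

Lemma expands_index_weight a R0 F : expands a R0 F -> expands (fun k => RtoC (INR k) * a k)%C R0 (pseries_value (fun k => RtoC (INR k) * a k)%C).
Proof.
  intros H z Hz. pose proof (Cmod_ge_0 z).
  destruct (expands_coef_bound a R0 F ((Cmod z + 2 * R0) / 3) H ltac:(lra)) as [M HM].
  destruct (coef_bound_index_weight a ((Cmod z + 2 * R0) / 3) ((2 * Cmod z + R0) / 3) M ltac:(lra) HM) as [M' HM'].
  apply (coef_bound_converges _ _ _ _ HM'). lra.
Qed.

Lemma expands_shift a R0 F : expands a R0 F -> expands (fun k => a (S k)) R0 (pseries_value (fun k => a (S k))).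
Proof.
  intros H z Hz.
  destruct (Req_EM_T (Cmod z) 0) as [E|E].
  - apply Cmod_eq_0 in E. subst z. rewrite (pseries_value_correct _ _ _ (pseries_at0 _)).
    apply pseries_at0.
  - assert (N : z <> RtoC 0) by (apply Cmod_gt_0; pose proof (Cmod_ge_0 z); lra).
    pose proof (pseries_shift a z _ N (H z Hz)) as S.
    now rewrite (pseries_value_correct _ _ _ S).
Qed.

Lemma expands_deriv_coef a R0 F : expands a R0 F -> expands (deriv_coef a) R0 (pseries_value (deriv_coef a)).
Proof. intros H. exact (expands_shift _ _ _ (expands_index_weight _ _ _ H)). Qed.

(** Second-order Taylor remainder of the k-th power between [z] and [w]; the
    truncated predecessor of 0 is avoided by the case distinction. *)
Definition powrem (w z : C) (k : nat) : C :=
  match k with O => RtoC 0 | S j => (w ^ S j - z ^ S j - RtoC (INR (S j)) * z ^ j * (w - z))%C end.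

(** Induction on the identity R_{k+1} = w R_k + k z^{k-1} (w - z)^2.  The factor
    r^2 on the left avoids a negative power of r. *)
Lemma powrem_bound w z r k : 0 < r -> Cmod w <= r -> Cmod z <= r ->
  Cmod (powrem w z k) * r ^ 2 <= INR k * INR k * r ^ k * (Cmod (w - z)%C) ^ 2.
Proof.
  intros Hr Hw Hz. set (d := Cmod (w - z)%C).
  assert (Hd : 0 <= d ^ 2) by apply pow2_ge_0.
  induction k as [|k IH].
  - simpl. rewrite Cmod_0. right; ring.
  - destruct k as [|k].
    + simpl powrem. replace (w * 1 - z * 1 - RtoC 1 * 1 * (w - z))%C with (RtoC 0) by ring.
      rewrite Cmod_0. simpl. nra.
    + assert (E : powrem w z (S (S k)) =
        (w * powrem w z (S k) + RtoC (INR (S k)) * z ^ k * ((w - z) * (w - z)))%C).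
      { unfold powrem. rewrite (S_INR (S k)), RtoC_plus. simpl Cpow. ring. }
      rewrite E.
      assert (B1 : Cmod (powrem w z (S (S k))) <= r * Cmod (powrem w z (S k)) + INR (S k) * r ^ k * d ^ 2).
      { rewrite E. eapply Rle_trans; [apply Cmod_triangle|]. rewrite !Cmod_mult, Cmod_pow.
        rewrite Cmod_R, Rabs_pos_eq by apply pos_INR. fold d.
        apply Rplus_le_compat; [apply Rmult_le_compat_r; [apply Cmod_ge_0|auto]|].
        replace (d * d) with (d ^ 2) by ring. apply Rmult_le_compat_r; auto.
        apply Rmult_le_compat_l; [apply pos_INR|]. apply pow_incr. split; [apply Cmod_ge_0|auto]. }
      rewrite <- E. assert (Hr2 : 0 < r ^ 2) by nra.
      apply Rle_trans with ((r * Cmod (powrem w z (S k)) + INR (S k) * r ^ k * d ^ 2) * r ^ 2).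
      { apply Rmult_le_compat_r; lra. }
      rewrite (S_INR (S k)). set (n := INR (S k)) in *.
      assert (Hn : 0 <= n) by apply pos_INR.
      assert (Hrk : 0 <= r ^ S (S k)) by (apply pow_le; lra).
      apply Rle_trans with (r * (n * n * r ^ S k * d ^ 2) + n * r ^ S (S k) * d ^ 2).
      { assert (r * (Cmod (powrem w z (S k)) * r ^ 2) <= r * (n * n * r ^ S k * d ^ 2))
          by (apply Rmult_le_compat_l; lra).
        simpl in *. lra. }
      assert (0 <= r ^ S (S k) * d ^ 2) by (apply Rmult_le_pos; auto).
      simpl in *. nra.
Qed.

Lemma psum_remainder a w z n :
  (psum a w (S n) - psum a z (S n) - psum (deriv_coef a) z n * (w - z))%C =
  psum (fun k => a k * powrem w z k)%C (RtoC 1) (S n).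
Proof.
  induction n.
  - simpl. unfold deriv_coef, powrem. simpl. ring.
  - change (psum (fun k => a k * powrem w z k)%C 1 (S (S n))) with
      (psum (fun k => a k * powrem w z k)%C 1 (S n) + a (S (S n)) * powrem w z (S (S n)) * 1 ^ (S (S n)))%C.
    rewrite <- IHn, Cpow_1_l.
    change (psum a w (S (S n))) with (psum a w (S n) + a (S (S n)) * w ^ (S (S n)))%C.
    change (psum a z (S (S n))) with (psum a z (S n) + a (S (S n)) * z ^ (S (S n)))%C.
    change (psum (deriv_coef a) z (S n)) with (psum (deriv_coef a) z n + deriv_coef a (S n) * z ^ (S n))%C.
    unfold deriv_coef at 2. unfold powrem. ring.
Qed.

(** The remainder of the whole series is the series of the remainders of the
    powers, hence O(|w - z|^2) uniformly in the partial sums. *)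
Lemma expands_cder a R0 F z : expands a R0 F -> Cmod z < R0 -> cder F z (pseries_value (deriv_coef a) z).
Proof.
  intros H Hz. pose proof (Cmod_ge_0 z) as Hz0.
  set (r := (Cmod z + R0) / 2). assert (Hr : Cmod z < r < R0) by (unfold r; lra).
  destruct (expands_coef_bound a R0 F ((r + R0) / 2) H ltac:(lra)) as [M HM].
  destruct (coef_bound_index_weight a ((r + R0) / 2) ((3 * r + R0) / 4) M ltac:(lra) HM) as [M1 HM1].
  destruct (coef_bound_index_weight _ ((3 * r + R0) / 4) ((7 * r + R0) / 8) M1 ltac:(lra) HM1) as [M2 HM2].
  set (r2 := (7 * r + R0) / 8) in *. assert (Hr2 : r < r2) by (unfold r2; lra).
  pose proof (coef_bound_nonneg _ _ _ HM2) as HM20.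
  set (q := r / r2).
  assert (Hq : 0 <= q < 1).
  { apply ratio_lt_1; lra. }
  set (K := M2 / (1 - q) / r ^ 2).
  assert (Hr22 : 0 < r ^ 2) by (apply pow_lt; lra).
  assert (HK : 0 <= K).
  { unfold K. apply Rdiv_le_0_compat; [apply Rdiv_le_0_compat; lra|auto]. }
  assert (Main : forall w, Cmod w <= r ->
    Cmod (F w - F z - pseries_value (deriv_coef a) z * (w - z))%C <= K * Cmod (w - z)%C ^ 2).
  { intros w Hw. set (d := Cmod (w - z)%C).
    assert (Hd : 0 <= d ^ 2) by apply pow2_ge_0.
    assert (GB : coef_bound (fun k => a k * powrem w z k)%C (/ q) (M2 / r ^ 2 * d ^ 2)).
    { intros k. rewrite Cmod_mult. pose proof (powrem_bound w z r k ltac:(lra) Hw ltac:(lra)) as B.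
      fold d in B. specialize (HM2 k). cbv beta in HM2. rewrite !Cmod_mult, Cmod_R, Rabs_pos_eq in HM2 by apply pos_INR.
      apply Rmult_le_reg_r with (r ^ 2); auto.
      replace (M2 / r ^ 2 * d ^ 2 * r ^ 2) with (M2 * d ^ 2) by (field; lra).
      assert (Hq' : 0 <= (/ q) ^ k).
      { apply pow_le, Rlt_le, Rinv_0_lt_compat. unfold q. apply Rdiv_lt_0_compat; lra. }
      apply Rle_trans with (Cmod (a k) * (/ q) ^ k * (INR k * INR k * r ^ k * d ^ 2)).
      - replace (Cmod (a k) * Cmod (powrem w z k) * (/ q) ^ k * r ^ 2) with
          (Cmod (a k) * (/ q) ^ k * (Cmod (powrem w z k) * r ^ 2)) by ring.
        apply Rmult_le_compat_l; auto. apply Rmult_le_pos; [apply Cmod_ge_0|auto].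
      - replace (Cmod (a k) * (/ q) ^ k * (INR k * INR k * r ^ k * d ^ 2)) with
         (INR k * (INR k * Cmod (a k)) * ((/ q) ^ k * r ^ k) * d ^ 2) by ring.
        replace ((/ q) ^ k * r ^ k) with (r2 ^ k).
        2:{ rewrite <- Rpow_mult_distr. f_equal. unfold q. field. lra. }
        apply Rmult_le_compat_r; auto. }
    apply le_of_le_plus_eps. intros eps He.
    pose proof (H z Hz) as Lz. pose proof (H w ltac:(lra)) as Lw.
    pose proof (expands_deriv_coef a R0 F H z Hz) as Ld.
    rewrite pseries_eps in Lz, Lw, Ld.
    destruct (Lz (eps / 3) ltac:(lra)) as [N1 K1]. destruct (Lw (eps / 3) ltac:(lra)) as [N2 K2].
    assert (He3 : 0 < eps / (3 * (d + 1))).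
    { apply Rdiv_lt_0_compat; [lra|]. assert (0 <= d) by apply Cmod_ge_0. lra. }
    destruct (Ld _ He3) as [N3 K3].
    set (n := (N1 + N2 + N3)%nat).
    specialize (K1 (S n) ltac:(lia)). specialize (K2 (S n) ltac:(lia)). specialize (K3 n ltac:(lia)).
    pose proof (psum_remainder a w z n) as E.
    assert (Bd : Cmod (psum (fun k => a k * powrem w z k)%C 1 (S n)) <= K * d ^ 2).
    { pose proof (psum_tail_geometric _ _ _ (RtoC 1) q O (S n) GB) as T.
      replace (psum (fun k => a k * powrem w z k)%C 1 0) with (RtoC 0) in T by (simpl; ring).
      replace (psum (fun k => a k * powrem w z k)%C 1 (S n) - 0)%C with (psum (fun k => a k * powrem w z k)%C 1 (S n)) in T by ring.
      assert (q0 : 0 < q) by (unfold q; apply Rdiv_lt_0_compat; lra).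
      eapply Rle_trans; [apply T|].
      - apply Rlt_le, Rinv_0_lt_compat; auto.
      - auto.
      - rewrite Cmod_1, Rinv_r; lra.
      - lia.
      - rewrite pow_1. replace (M2 / r ^ 2 * d ^ 2 / (1 - q) * q) with (K * d ^ 2 * q).
        2:{ unfold K; field; lra. }
        assert (0 <= K * d ^ 2) by (apply Rmult_le_pos; auto). nra. }
    replace (F w - F z - pseries_value (deriv_coef a) z * (w - z))%C with
      (psum (fun k => a k * powrem w z k)%C 1 (S n) +
       (- (psum a w (S n) - F w) + ((psum a z (S n) - F z) + (psum (deriv_coef a) z n - pseries_value (deriv_coef a) z) * (w - z))))%C
      by (rewrite <- E; ring).
    assert (d0 : 0 <= d) by apply Cmod_ge_0.
    eapply Rle_trans; [apply Cmod_triangle|].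
    apply Rplus_le_compat; [auto|].
    eapply Rle_trans; [apply Cmod_triangle|]. rewrite Cmod_opp.
    eapply Rle_trans; [apply Rplus_le_compat_l; apply Cmod_triangle|]. rewrite Cmod_mult. fold d.
    assert (Cmod (psum (deriv_coef a) z n - pseries_value (deriv_coef a) z)%C * d <= eps / 3).
    { apply Rle_trans with (eps / (3 * (d + 1)) * (d + 1)); [|right; field; lra].
      apply Rmult_le_compat; try lra. apply Cmod_ge_0. }
    lra. }
  apply cder_eps. intros eps He.
  assert (Hd : 0 < eps / (K + 1)) by (apply Rdiv_lt_0_compat; lra).
  generalize (filter_and _ _ (locally_Cmod_lt z r (proj1 Hr)) (locally_Cmod z _ Hd)).
  apply filter_imp. intros w [A B]. eapply Rle_trans; [apply Main; lra|].
  set (d := Cmod (w - z)%C) in *. assert (0 <= d) by apply Cmod_ge_0.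
  assert (K * d <= eps).
  { apply Rle_trans with ((K + 1) * (eps / (K + 1))); [|right; field; lra].
    apply Rmult_le_compat; lra. }
  simpl. nra.
Qed.

(** The continuity of the derivative is what allows differentiation under the
    integral sign; it is automatic for power series, and [taylor] shows that
    nothing else arises. *)
Definition holo (R0 : R) (F : C -> C) : Prop :=
  exists F' : C -> C, forall z, Cmod z < R0 -> cder F z (F' z) /\ continuous F' z.

Lemma expands_holo a R0 F : expands a R0 F -> holo R0 F.
Proof.
  intros H. exists (pseries_value (deriv_coef a)). intros z Hz. split; [now apply (expands_cder a R0)|].
  apply cder_cont with (l := pseries_value (deriv_coef (deriv_coef a)) z).
  apply (expands_cder _ R0); auto. apply (expands_deriv_coef a R0 F H).
Qed.

Lemma expands_cont a R0 F z : expands a R0 F -> Cmod z < R0 -> continuous F z.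
Proof. intros H Hz. exact (cder_cont _ _ _ (expands_cder _ _ _ _ H Hz)). Qed.

(** * Means over a period and over the unit circle *)

Definition rmean (h : R -> R) : R := RInt h 0 (2 * PI) / (2 * PI).

Definition cmean (f : R -> C) : C := (rmean (fun t => Re (f t)), rmean (fun t => Im (f t))).

Definition rcont (h : R -> R) : Prop := forall t, continuous h t.
Definition ccont (f : R -> C) : Prop := forall t : R, continuous f t.

Lemma continuous_const_mult (k : R) (h : R -> R) (t : R) : continuous h t -> continuous (fun s => k * h s) t.
Proof. intros H. apply (continuous_mult (K := R_AbsRing)); [apply continuous_const|exact H]. Qed.

Lemma twopi_pos : 0 < 2 * PI.
Proof. pose proof PI_RGT_0; lra. Qed.

Lemma rcont_ex (h : R -> R) (a b : R) : rcont h -> ex_RInt h a b.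
Proof. intros H. apply (ex_RInt_continuous (V := R_CompleteNormedModule)). intros; apply H. Qed.

Lemma ccont_Re f : ccont f -> rcont (fun t => Re (f t)).
Proof. intros H t. apply cont_Re, H. Qed.

Lemma ccont_Im f : ccont f -> rcont (fun t => Im (f t)).
Proof. intros H t. apply cont_Im, H. Qed.

Lemma rmean_plus h k : rcont h -> rcont k -> rmean (fun t => h t + k t) = rmean h + rmean k.
Proof.
  intros Hh Hk. unfold rmean.
  pose proof (RInt_plus (V := R_CompleteNormedModule) h k 0 (2 * PI) (rcont_ex _ _ _ Hh) (rcont_ex _ _ _ Hk)) as E.
  change (RInt (fun t => h t + k t) 0 (2 * PI) = RInt h 0 (2 * PI) + RInt k 0 (2 * PI)) in E.
  rewrite E. field. pose proof twopi_pos; lra.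
Qed.

Lemma rmean_scal c h : rcont h -> rmean (fun t => c * h t) = c * rmean h.
Proof.
  intros Hh. unfold rmean.
  pose proof (RInt_scal (V := R_CompleteNormedModule) h 0 (2 * PI) c (rcont_ex _ _ _ Hh)) as E.
  change (RInt (fun t => c * h t) 0 (2 * PI) = c * RInt h 0 (2 * PI)) in E.
  rewrite E. field. pose proof twopi_pos; lra.
Qed.

Lemma rmean_const c : rmean (fun _ => c) = c.
Proof.
  unfold rmean. rewrite RInt_const. change (scal (2 * PI - 0) c) with ((2 * PI - 0) * c).
  field. pose proof PI_RGT_0; lra.
Qed.

Lemma rmean_ext h k : (forall t, h t = k t) -> rmean h = rmean k.
Proof. intros E. unfold rmean. f_equal. apply RInt_ext. intros; apply E. Qed.

Lemma rmean_le h k : rcont h -> rcont k -> (forall t, h t <= k t) -> rmean h <= rmean k.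
Proof.
  intros Hh Hk E. pose proof twopi_pos. unfold rmean, Rdiv. apply Rmult_le_compat_r.
  - apply Rlt_le, Rinv_0_lt_compat; lra.
  - apply RInt_le; auto using rcont_ex; lra.
Qed.

Lemma cmean_ext f g : (forall t, f t = g t) -> cmean f = cmean g.
Proof. intros E. apply C_ext_ReIm; apply rmean_ext; intros t; now rewrite E. Qed.

Lemma cmean_plus f g : ccont f -> ccont g -> cmean (fun t => f t + g t)%C = (cmean f + cmean g)%C.
Proof.
  intros Hf Hg. apply C_ext_ReIm.
  - apply (rmean_plus _ _ (ccont_Re _ Hf) (ccont_Re _ Hg)).
  - apply (rmean_plus _ _ (ccont_Im _ Hf) (ccont_Im _ Hg)).
Qed.

Lemma cmean_scal c f : ccont f -> cmean (fun t => c * f t)%C = (c * cmean f)%C.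
Proof.
  intros Hf. pose proof (ccont_Re _ Hf) as H1. pose proof (ccont_Im _ Hf) as H2.
  assert (S : forall (k : R) h, rcont h -> rcont (fun t => k * h t)).
  { intros k h Hh t. apply continuous_const_mult, Hh. }
  apply C_ext_ReIm.
  - change (rmean (fun t => Re c * Re (f t) - Im c * Im (f t)) =
            Re c * rmean (fun t => Re (f t)) - Im c * rmean (fun t => Im (f t))).
    rewrite <- (rmean_scal (Re c)) by auto.
    replace (Im c * rmean (fun t => Im (f t))) with (- (- Im c * rmean (fun t => Im (f t)))) by ring.
    rewrite <- (rmean_scal (- Im c)) by auto. unfold Rminus. rewrite Ropp_involutive.
    rewrite <- rmean_plus by auto. apply rmean_ext. intros; ring.
  - change (rmean (fun t => Re c * Im (f t) + Im c * Re (f t)) =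
            Re c * rmean (fun t => Im (f t)) + Im c * rmean (fun t => Re (f t))).
    rewrite <- !rmean_scal by auto. apply rmean_plus; auto.
Qed.

Lemma cmean_const c : cmean (fun _ => c) = c.
Proof. apply C_ext_ReIm; [exact (rmean_const (Re c)) | exact (rmean_const (Im c))]. Qed.

(** The factor 2 comes from estimating real and imaginary parts separately; only
    convergence to 0 is ever deduced from this bound. *)
Lemma cmean_bound f B : ccont f -> (forall t, Cmod (f t) <= B) -> Cmod (cmean f) <= 2 * B.
Proof.
  intros Hf HB. eapply Rle_trans; [apply Cmod_le_ReIm|].
  assert (A : forall h, rcont h -> (forall t, Rabs (h t) <= B) -> Rabs (rmean h) <= B).
  { intros h Hh Hb. apply Rabs_le. split.
    - rewrite <- (rmean_const (- B)). apply rmean_le; auto; [intros t; apply continuous_const|].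
      intros t. specialize (Hb t). apply Rabs_le_between in Hb. lra.
    - rewrite <- (rmean_const B). apply rmean_le; auto; [intros t; apply continuous_const|].
      intros t. specialize (Hb t). apply Rabs_le_between in Hb. lra. }
  pose proof (A _ (ccont_Re _ Hf) (fun t => Rle_trans _ _ _ (re_le_Cmod (f t)) (HB t))).
  pose proof (A _ (ccont_Im _ Hf) (fun t => Rle_trans _ _ _ (im_le_Cmod (f t)) (HB t))).
  change (Rabs (rmean (fun t => Re (f t))) + Rabs (rmean (fun t => Im (f t))) <= 2 * B). lra.
Qed.

Definition cis (t : R) : C := (cos t, sin t).

Lemma cis_cont : ccont cis.
Proof.
  intros t. apply cont_ReIm.
  - apply continuity_pt_filterlim, continuity_cos.
  - apply continuity_pt_filterlim, continuity_sin.
Qed.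

Lemma Cmod_cis t : Cmod (cis t) = 1.
Proof.
  unfold Cmod, cis; simpl. rewrite !Rmult_1_r. pose proof (sin2_cos2 t) as H. unfold Rsqr in H.
  replace (cos t * cos t + sin t * sin t) with 1 by lra. apply sqrt_1.
Qed.

Lemma cis_plus s t : cis (s + t) = (cis s * cis t)%C.
Proof. apply C_ext_ReIm; unfold cis, Re, Im; simpl; [rewrite cos_plus|rewrite sin_plus]; ring. Qed.

Lemma cis_0 : cis 0 = RtoC 1.
Proof. apply C_ext_ReIm; unfold cis, Re, Im; simpl; [apply cos_0|apply sin_0]. Qed.

Lemma cis_2PI : cis (2 * PI) = RtoC 1.
Proof. apply C_ext_ReIm; unfold cis, Re, Im; simpl; [apply cos_2PI|apply sin_2PI]. Qed.

Lemma cis_opp_mul t : (cis t * cis (- t))%C = RtoC 1.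
Proof. rewrite <- cis_plus. replace (t + - t) with 0 by ring. apply cis_0. Qed.

Lemma cis_opp_conj t : cis (- t) = Cconj (cis t).
Proof. apply C_ext_ReIm; unfold cis, Re, Im; simpl; [apply cos_neg|apply sin_neg]. Qed.

Lemma cis_pow t k : (cis t ^ k)%C = cis (INR k * t).
Proof.
  induction k; simpl Cpow.
  - simpl. rewrite Rmult_0_l. symmetry; apply cis_0.
  - rewrite IHk, <- cis_plus, S_INR. f_equal. ring.
Qed.

Lemma rder_cis t : rder cis t (Ci * cis t)%C.
Proof.
  apply rder_ReIm; unfold cis, Re, Im; simpl.
  - replace (0 * cos t - 1 * sin t) with (- sin t) by ring. apply is_derive_Reals, derivable_pt_lim_cos.
  - replace (0 * sin t + 1 * cos t) with (cos t) by ring. apply is_derive_Reals, derivable_pt_lim_sin.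
Qed.

Lemma cont_opp_arg (f : R -> C) : ccont f -> ccont (fun t => f (- t)).
Proof.
  intros H t. apply (continuous_comp (fun t : R => - t) f); [|apply H].
  apply (continuous_opp (V := R_NormedModule)). apply continuous_id.
Qed.

Lemma cmean_cis_pow k : k <> O -> cmean (fun t => cis t ^ k)%C = RtoC 0.
Proof.
  intros Hk. pose proof twopi_pos.
  assert (Hn : INR k <> 0) by (apply not_0_INR; auto).
  assert (per : forall f : R -> R, (f = cos \/ f = sin) -> f (INR k * (2 * PI)) = f 0).
  { intros f [-> | ->].
    - replace (INR k * (2 * PI)) with (0 + 2 * INR k * PI) by ring. apply cos_period.
    - replace (INR k * (2 * PI)) with (0 + 2 * INR k * PI) by ring. apply sin_period. }
  assert (cc : forall f, continuity f -> rcont (fun t => f (INR k * t))).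
  { intros f Hf t. apply (continuous_comp (fun t => INR k * t) f).
    - apply continuous_const_mult, continuous_id.
    - apply continuity_pt_filterlim, Hf. }
  apply C_ext_ReIm.
  - change (rmean (fun t => Re (cis t ^ k)%C) = 0).
    rewrite (rmean_ext _ (fun t => cos (INR k * t))) by (intros t; rewrite cis_pow; reflexivity).
    unfold rmean.
    rewrite (is_RInt_unique _ _ _ (sin (INR k * (2 * PI)) / INR k - sin (INR k * 0) / INR k)).
    + rewrite per by auto. rewrite Rmult_0_r. field. split; [auto|pose proof PI_RGT_0; lra].
    + apply (is_RInt_derive (V := R_CompleteNormedModule) (fun t => sin (INR k * t) / INR k)).
      * intros t _. auto_derive; auto. field; auto.
      * intros t _. apply cc, continuity_cos.
  - change (rmean (fun t => Im (cis t ^ k)%C) = 0).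
    rewrite (rmean_ext _ (fun t => sin (INR k * t))) by (intros t; rewrite cis_pow; reflexivity).
    unfold rmean.
    rewrite (is_RInt_unique _ _ _ ((- cos (INR k * (2 * PI)) / INR k) - (- cos (INR k * 0) / INR k))).
    + rewrite per by auto. rewrite Rmult_0_r. field. split; [auto|pose proof PI_RGT_0; lra].
    + apply (is_RInt_derive (V := R_CompleteNormedModule) (fun t => - cos (INR k * t) / INR k)).
      * intros t _. auto_derive; auto. field; auto.
      * intros t _. apply cc, continuity_sin.
Qed.

Lemma Cconj_pow (x : C) k : (Cconj x ^ k)%C = Cconj (x ^ k)%C.
Proof.
  induction k; simpl.
  - apply C_ext_ReIm; unfold Re, Im; simpl; ring.
  - rewrite IHk. apply C_ext_ReIm; unfold Re, Im; simpl; ring.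
Qed.

Lemma cmean_conj f : ccont f -> cmean (fun t => Cconj (f t)) = Cconj (cmean f).
Proof.
  intros Hf. apply C_ext_ReIm; [reflexivity|].
  change (rmean (fun t => - Im (f t)) = - rmean (fun t => Im (f t))).
  rewrite (rmean_ext _ (fun t => (-1) * Im (f t))) by (intros; ring).
  rewrite rmean_scal by (now apply ccont_Im). ring.
Qed.

Lemma ccont_pow f k : ccont f -> ccont (fun t => f t ^ k)%C.
Proof. intros H t. apply cont_pow, H. Qed.

Lemma ccont_mul f g : ccont f -> ccont g -> ccont (fun t => f t * g t)%C.
Proof. intros H1 H2 t. apply cont_mul; auto. Qed.

Lemma ccont_add f g : ccont f -> ccont g -> ccont (fun t => f t + g t)%C.
Proof. intros H1 H2 t. apply cont_add; auto. Qed.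

Lemma ccont_sub f g : ccont f -> ccont g -> ccont (fun t => f t - g t)%C.
Proof. intros H1 H2 t. apply cont_sub; auto. Qed.

Lemma ccont_const c : ccont (fun _ => c).
Proof. intros t. apply cont_const. Qed.

Lemma cmean_cis_opp_pow k : k <> O -> cmean (fun t => cis (- t) ^ k)%C = RtoC 0.
Proof.
  intros Hk. rewrite (cmean_ext _ (fun t => Cconj (cis t ^ k)%C)).
  - rewrite cmean_conj by (apply ccont_pow, cis_cont). rewrite cmean_cis_pow by auto.
    apply C_ext_ReIm; unfold Re, Im; simpl; ring.
  - intros t. now rewrite cis_opp_conj, Cconj_pow.
Qed.

(** * Averaging power series over circles *)

Lemma ccont_psum a e n : ccont e -> ccont (fun t => psum a (e t) n).
Proof.
  intros He. induction n; simpl; [apply ccont_const|].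
  apply ccont_add; auto. apply ccont_mul; [apply ccont_const|].
  apply (ccont_pow e (S n) He).
Qed.

Lemma cmean_psum phi a e n : ccont phi -> ccont e ->
  cmean (fun t => phi t * psum a (e t) n)%C =
  psum (fun k => a k * cmean (fun t => phi t * e t ^ k))%C (RtoC 1) n.
Proof.
  intros Hp He.
  induction n.
  - change (cmean (fun t => phi t * a O)%C = (a O * cmean (fun t => phi t * e t ^ 0))%C).
    rewrite <- cmean_scal by (apply ccont_mul; auto; apply (ccont_pow e 0 He)).
    apply cmean_ext. intros t. simpl. ring.
  - change (cmean (fun t => phi t * (psum a (e t) n + a (S n) * e t ^ S n))%C =
      (psum (fun k => a k * cmean (fun t => phi t * e t ^ k))%C 1 n +
        a (S n) * cmean (fun t => phi t * e t ^ S n) * 1 ^ S n)%C).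
    rewrite <- IHn, Cpow_1_l, Cmult_1_r, <- cmean_scal, <- cmean_plus.
    + apply cmean_ext. intros t. ring.
    + apply ccont_mul; auto. now apply ccont_psum.
    + apply ccont_mul; [apply ccont_const|]. apply ccont_mul; auto. now apply ccont_pow.
    + apply ccont_mul; auto. now apply ccont_pow.
Qed.

Lemma geom_small (A q : R) : 0 <= q < 1 -> forall eps, 0 < eps ->
  exists N, forall n, (N <= n)%nat -> A * q ^ n < eps.
Proof.
  intros Hq eps He.
  destruct (pow_lt_1_zero q ltac:(rewrite Rabs_pos_eq; lra) (eps / (Rabs A + 1))) as [N HN].
  { apply Rdiv_lt_0_compat; auto. pose proof (Rabs_pos A); lra. }
  exists N. intros n Hn. specialize (HN n ltac:(lia)). pose proof (pow_le q n (proj1 Hq)).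
  rewrite Rabs_pos_eq in HN by auto. pose proof (Rle_abs A). pose proof (Rabs_pos A).
  apply Rle_lt_trans with (Rabs A * q ^ n); [apply Rmult_le_compat_r; auto|].
  apply Rle_lt_trans with (Rabs A * (eps / (Rabs A + 1))); [apply Rmult_le_compat_l; lra|].
  apply Rmult_lt_reg_r with (Rabs A + 1); [lra|]. unfold Rdiv.
  rewrite Rmult_assoc, Rmult_assoc, Rinv_l by lra. nra.
Qed.

Lemma ccont_expands_circle a R0 F u e : expands a R0 F -> Cmod u < R0 -> ccont e ->
  (forall t, Cmod (e t) = 1) -> ccont (fun t => F (u * e t)%C).
Proof.
  intros H Hu He E t. apply (continuous_comp (fun t : R => (u * e t)%C) F).
  - apply cont_mul; [apply cont_const|apply He].
  - apply (expands_cont a R0); auto. rewrite Cmod_mult, E; lra.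
Qed.

(** Mean and sum may be exchanged because the tail of the series is uniformly
    geometric on the circle. *)
Lemma cmean_expands phi a R0 G u e B : ccont phi -> ccont e -> (forall t, Cmod (e t) = 1) ->
  (forall t, Cmod (phi t) <= B) -> expands a R0 G -> Cmod u < R0 ->
  cpseries (fun k => a k * cmean (fun t => phi t * e t ^ k))%C u (cmean (fun t => phi t * G (u * e t))%C).
Proof.
  intros Hp He E HB HG Hu. pose proof (Cmod_ge_0 u) as Hu0.
  set (r := (Cmod u + R0) / 2). assert (Hr : Cmod u < r < R0) by (unfold r; lra).
  destruct (expands_coef_bound a R0 G r HG ltac:(lra)) as [M HM].
  set (q := Cmod u / r).
  assert (Hq : 0 <= q < 1).
  { apply ratio_lt_1; lra. }
  apply pseries_eps. intros eps Heps.
  destruct (geom_small (2 * (B * (M / (1 - q) * q))) q Hq eps Heps) as [N HN].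
  exists N. intros n Hn. specialize (HN n Hn).
  assert (Em : psum (fun k => a k * cmean (fun t => phi t * e t ^ k))%C u n =
     cmean (fun t => phi t * psum a (u * e t) n)%C).
  { transitivity (cmean (fun t => phi t * psum (fun k => a k * u ^ k) (e t) n)%C).
    - rewrite cmean_psum by auto. clear. induction n; simpl; [ring|]. rewrite IHn.
      rewrite Cpow_1_l. ring.
    - apply cmean_ext. intros t. f_equal. clear. induction n; simpl; [ring|]. rewrite IHn.
      rewrite Cpow_mult_l. ring. }
  rewrite Em.
  assert (HG1 : ccont (fun t => G (u * e t)%C)) by (eapply ccont_expands_circle; eauto).
  assert (Cue : ccont (fun t => u * e t)%C) by (apply ccont_mul; auto; apply ccont_const).
  replace (cmean (fun t => phi t * psum a (u * e t) n) - cmean (fun t => phi t * G (u * e t)))%C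
   with (cmean (fun t => phi t * (psum a (u * e t) n - G (u * e t)))%C).
  2:{ replace (cmean (fun t => phi t * psum a (u * e t) n) - cmean (fun t => phi t * G (u * e t)))%C
      with (cmean (fun t => phi t * psum a (u * e t) n) + RtoC (-1) * cmean (fun t => phi t * G (u * e t)))%C
      by (apply C_ext_ReIm; unfold Re, Im; simpl; ring).
      rewrite <- cmean_scal by (apply ccont_mul; auto).
      rewrite <- cmean_plus.
      - apply cmean_ext. intros t. apply C_ext_ReIm; unfold Re, Im; simpl; ring.
      - apply ccont_mul; auto. now apply ccont_psum.
      - apply ccont_mul; [apply ccont_const|]. apply ccont_mul; auto. }
  eapply Rle_lt_trans; [|apply HN].
  replace (2 * (B * (M / (1 - q) * q)) * q ^ n) with (2 * (B * (M / (1 - q) * q ^ S n))) by (simpl; ring).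
  apply cmean_bound.
  - apply ccont_mul; auto. apply ccont_sub; auto. now apply ccont_psum.
  - intros t. rewrite Cmod_mult, Cmod_sub_sym.
    apply Rmult_le_compat; try apply Cmod_ge_0; auto.
    apply (pseries_tail a r M (u * e t)%C q n); auto; try lra.
    + rewrite Cmod_mult, E. unfold q. right. field. lra.
    + apply HG. rewrite Cmod_mult, E. lra.
Qed.

(** Reduces suprema over the line to the compact interval of one period. *)
Lemma cis_reduce (t : R) : exists s, 0 <= s <= 2 * PI /\ cis s = cis t.
Proof.
  pose proof twopi_pos as Hp. set (x := t / (2 * PI)).
  destruct (base_Int_part x) as [H1 H2].
  exists (t - IZR (Int_part x) * (2 * PI)). split.
  - assert (t = x * (2 * PI)) by (unfold x; field; pose proof PI_RGT_0; lra). rewrite H at 1 2. split; nra.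
  - assert (Per : forall n : nat, cis (INR n * (2 * PI)) = RtoC 1).
    { intros n. rewrite <- cis_pow, cis_2PI. induction n; simpl; [reflexivity|]. rewrite IHn. ring. }
    destruct (Z_le_gt_dec 0 (Int_part x)) as [L|L].
    + rewrite <- (Z2Nat.id _ L), <- INR_IZR_INZ. set (n := Z.to_nat _).
      transitivity (cis (t - INR n * (2 * PI)) * cis (INR n * (2 * PI)))%C.
      * rewrite Per. ring.
      * rewrite <- cis_plus. f_equal. ring.
    + replace (IZR (Int_part x)) with (- INR (Z.to_nat (- Int_part x))).
      2:{ rewrite INR_IZR_INZ, Z2Nat.id by lia. rewrite opp_IZR. ring. }
      set (n := Z.to_nat _).
      replace (t - - INR n * (2 * PI)) with (t + INR n * (2 * PI)) by ring.
      rewrite cis_plus, Per. ring.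
Qed.

Lemma circle_max_attained (F : C -> C) (u : C) : ccont (fun t => F (u * cis t)%C) ->
  exists s, forall t, Cmod (F (u * cis t)%C) <= Cmod (F (u * cis s)%C).
Proof.
  intros H. destruct (continuity_ab_maj (fun t => Cmod (F (u * cis t)%C)) 0 (2 * PI)) as [s [Hs _]].
  - pose proof twopi_pos; lra.
  - intros t _. apply continuity_pt_filterlim. apply (cont_Cmod (U := R_UniformSpace)). apply H.
  - exists s. intros t. destruct (cis_reduce t) as [t' [Ht' E]]. rewrite <- E. now apply Hs.
Qed.

(** * Contracting a circle *)

Section Homotopy.
Variables (rho r : R) (F F' : C -> C) (z : C) (K : R -> C).
Hypothesis Hr : 0 < r < rho.
Hypothesis Hz : Cmod z < r.
Hypothesis HF : forall z, Cmod z < rho -> cder F z (F' z) /\ continuous F' z.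
Hypothesis CK : ccont K.
Hypothesis HK : forall t, (K t * (RtoC r * cis t - z))%C = (RtoC r * cis t)%C.

Let seg (u t : R) : C := (z + RtoC u * (RtoC r * cis t - z))%C.
Let f (u t : R) : R := Re (F (seg u t) * K t)%C.
Let df (u t : R) : R := Re (F' (seg u t) * (RtoC r * cis t))%C.

Lemma seg_bound u t : 0 <= u <= 1 -> Cmod (seg u t) <= r.
Proof.
  intros Hu. unfold seg.
  replace (z + RtoC u * (RtoC r * cis t - z))%C with (RtoC (1 - u) * z + RtoC u * (RtoC r * cis t))%C
    by (rewrite RtoC_minus; ring).
  eapply Rle_trans; [apply Cmod_triangle|]. rewrite !Cmod_mult, Cmod_cis, !Cmod_R, !Rabs_pos_eq by lra.
  nra.
Qed.

Lemma seg_bound_near x : 0 <= x <= 1 -> locally x (fun u => forall t, Cmod (seg u t) < rho).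
Proof.
  intros Hx. assert (Hd : 0 < (rho - r) / (2 * r)) by (apply Rdiv_lt_0_compat; lra).
  exists (mkposreal _ Hd). intros u Hu t. change (Rabs (u - x) < (rho - r) / (2 * r)) in Hu.
  replace (seg u t) with (seg x t + RtoC (u - x) * (RtoC r * cis t - z))%C
    by (unfold seg; rewrite RtoC_minus; ring).
  eapply Rle_lt_trans; [apply Cmod_triangle|]. rewrite Cmod_mult, Cmod_R.
  pose proof (seg_bound x t Hx).
  assert (B : Cmod (RtoC r * cis t - z)%C <= 2 * r).
  { eapply Rle_trans; [apply Cmod_triangle|]. rewrite Cmod_opp, Cmod_mult, Cmod_cis, Cmod_R, Rabs_pos_eq by lra. lra. }
  assert (Rabs (u - x) * Cmod (RtoC r * cis t - z)%C <= Rabs (u - x) * (2 * r)).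
  { apply Rmult_le_compat_l; [apply Rabs_pos|auto]. }
  assert (Rabs (u - x) * (2 * r) < rho - r).
  { apply Rlt_le_trans with ((rho - r) / (2 * r) * (2 * r)); [|right; field; lra].
    apply Rmult_lt_compat_r; lra. }
  lra.
Qed.

Lemma homotopy_deriv u t : Cmod (seg u t) < rho -> is_derive (fun u => f u t) u (df u t).
Proof.
  intros H. unfold f, df.
  assert (D : rder (fun u => F (seg u t) * K t)%C u
     (F' (seg u t) * (RtoC r * cis t - z) * K t + F (seg u t) * RtoC 0)%C).
  { apply (rder_mul (fun u => F (seg u t)) (fun _ => K t)); [ |apply cara_deriv_const].
    apply (rder_comp F (fun u => seg u t)); [now apply HF|].
    apply rder_affine. }
  apply rder_Re in D. replace (F' (seg u t) * (RtoC r * cis t))%C with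
    (F' (seg u t) * (RtoC r * cis t - z) * K t + F (seg u t) * RtoC 0)%C; [exact D|].
  transitivity (F' (seg u t) * (K t * (RtoC r * cis t - z)))%C; [ring|]. now rewrite HK.
Qed.

Lemma seg_cont2 (p : R * R) : continuous (fun p : R * R => seg (fst p) (snd p)) p.
Proof.
  unfold seg. apply cont_add; [apply cont_const|]. apply cont_mul.
  - apply cont_RtoC, (continuous_fst (U := R_UniformSpace) (V := R_UniformSpace)).
  - apply cont_sub; [|apply cont_const]. apply cont_mul; [apply cont_const|].
    apply (continuous_comp (fun p : R * R => snd p) cis); [|apply cis_cont].
    apply (continuous_snd (U := R_UniformSpace) (V := R_UniformSpace)).
Qed.

Lemma seg_cont u : ccont (seg u).
Proof.
  intros t. unfold seg. apply cont_add; [apply cont_const|]. apply cont_mul; [apply cont_const|].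
  apply cont_sub; [|apply cont_const]. apply cont_mul; [apply cont_const|apply cis_cont].
Qed.

Lemma homotopy_cont u : (forall t, Cmod (seg u t) < rho) -> rcont (f u).
Proof.
  intros H. apply (ccont_Re (fun t => F (seg u t) * K t)%C). apply ccont_mul; auto.
  intros t. apply (continuous_comp (seg u) F); [apply seg_cont|].
  apply (cder_cont _ _ (F' (seg u t))). now apply HF.
Qed.

Lemma homotopy_deriv_cont u : (forall t, Cmod (seg u t) < rho) -> rcont (df u).
Proof.
  intros H. apply (ccont_Re (fun t => F' (seg u t) * (RtoC r * cis t))%C). apply ccont_mul.
  - intros t. apply (continuous_comp (seg u) F'); [apply seg_cont|]. now apply HF.
  - apply ccont_mul; [apply ccont_const|apply cis_cont].
Qed.

(** Up to the factor i u, the integrand is the derivative of the closed curve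
    t -> F (seg u t), so that its integral over a period vanishes. *)
Lemma homotopy_deriv_integral u : 0 < u <= 1 -> RInt (df u) 0 (2 * PI) = 0.
Proof.
  intros Hu. assert (H : forall t, Cmod (seg u t) < rho).
  { intros t. pose proof (seg_bound u t ltac:(lra)). lra. }
  rewrite (is_RInt_unique _ _ _ (Im (F (seg u (2 * PI))) / u - Im (F (seg u 0)) / u)).
  - unfold seg. rewrite cis_0, cis_2PI. apply Rminus_diag.
  - apply (is_RInt_derive (V := R_CompleteNormedModule) (fun t => Im (F (seg u t)) / u)).
    2:{ intros t _. now apply homotopy_deriv_cont. }
    intros t _.
    assert (D : rder (fun t => F (seg u t)) t (F' (seg u t) * (RtoC 0 + RtoC u * (RtoC r * (Ci * cis t) - RtoC 0)))%C).
    { apply (rder_comp F (fun t => seg u t)); [now apply HF|].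
      unfold seg. apply (cara_deriv_add (U := R_UniformSpace) RtoC (fun _ => z) (fun t => (RtoC u * (RtoC r * cis t - z))%C)); [apply cara_deriv_const|].
      apply (rder_cmul (RtoC u) (fun t => (RtoC r * cis t - z)%C)); [].
      apply (rder_sub (fun t => (RtoC r * cis t)%C) (fun _ => z)); [ |apply cara_deriv_const].
      apply (rder_cmul (RtoC r) cis); []. apply rder_cis. }
    apply rder_Im in D.
    assert (D2 := is_derive_scal _ _ (/ u) _ D).
    apply (is_derive_ext (fun t => / u * Im (F (seg u t)))).
    + intros s. apply Rmult_comm.
    + replace (df u t) with (/ u * Im (F' (seg u t) * (RtoC 0 + RtoC u * (RtoC r * (Ci * cis t) - RtoC 0)))%C);
        [exact D2|].
      unfold df, Re, Im; simpl. field. lra.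
Qed.

(** Contracting the circle to the point [z] does not change the integral. *)
Lemma homotopy_Re : RInt (f 1) 0 (2 * PI) = RInt (f 0) 0 (2 * PI).
Proof.
  assert (D : forall x, 0 <= x <= 1 -> is_derive (fun u => RInt (f u) 0 (2 * PI)) x (RInt (df x) 0 (2 * PI))).
  { intros x Hx. pose proof (seg_bound_near x Hx) as L.
    pose proof (locally_singleton _ _ L) as L0. cbv beta in L0.
    rewrite <- (RInt_ext (fun t => Derive (fun u => f u t) x)).
    2:{ intros t _. apply is_derive_unique. now apply homotopy_deriv. }
    apply is_derive_RInt_param.
    - revert L. apply filter_imp. intros u Hu t _. exists (df u t). now apply homotopy_deriv.
    - intros t _. apply (continuity_2d_pt_ext_loc df).
      + destruct L as [d Hd]. exists d. intros u v Hu _. symmetry. apply is_derive_unique, homotopy_deriv. now apply Hd.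
      + apply continuity_2d_pt_filterlim.
        apply (cont_Re (U := prod_UniformSpace R_UniformSpace R_UniformSpace)
           (fun p : R * R => F' (seg (fst p) (snd p)) * (RtoC r * cis (snd p)))%C (x, t)).
        apply cont_mul.
        * apply (continuous_comp (fun p : R * R => seg (fst p) (snd p)) F'); [apply seg_cont2|].
          now apply HF.
        * apply cont_mul; [apply cont_const|].
          apply (continuous_comp (fun p : R * R => snd p) cis); [|apply cis_cont].
          apply (continuous_snd (U := R_UniformSpace) (V := R_UniformSpace)).
    - revert L. apply filter_imp. intros u Hu. apply rcont_ex. now apply homotopy_cont. }
  destruct (MVT_gen (fun u => RInt (f u) 0 (2 * PI)) 0 1 (fun _ => 0)) as [c [_ Hc]].
  - rewrite Rmin_left, Rmax_right by lra. intros x Hx.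
    pose proof (D x ltac:(lra)) as Dx. rewrite (homotopy_deriv_integral x) in Dx by lra. exact Dx.
  - rewrite Rmin_left, Rmax_right by lra. intros x Hx.
    apply continuity_pt_filterlim. apply (ex_derive_continuous (fun u => RInt (f u) 0 (2 * PI))).
    eexists. now apply D.
  - lra.
Qed.

(** Only real parts are treated, since differentiation under the integral sign
    concerns real integrals; the imaginary part follows by applying this to
    -i F. *)
Lemma homotopy_Re_mean :
  Re (cmean (fun t => F (RtoC r * cis t) * K t)%C) = Re (F z * cmean K)%C.
Proof.
  change (rmean (fun t => Re (F (RtoC r * cis t) * K t)%C) = Re (F z * cmean K)%C).
  rewrite <- cmean_scal by auto.
  change (rmean (fun t => Re (F (RtoC r * cis t) * K t)%C) = rmean (fun t => Re (F z * K t)%C)).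
  pose proof homotopy_Re as H. unfold rmean. f_equal.
  transitivity (RInt (f 1) 0 (2 * PI)); [|transitivity (RInt (f 0) 0 (2 * PI)); [exact H|]].
  - apply RInt_ext. intros t _. unfold f. do 3 f_equal. unfold seg. ring.
  - apply RInt_ext. intros t _. unfold f. do 3 f_equal. unfold seg. ring.
Qed.

End Homotopy.

(** * Cauchy's formula and Taylor's theorem *)

Definition geom_coef : nat -> C := fun _ => RtoC 1.

Lemma psum_geom z n : (psum geom_coef z n * (1 - z) = 1 - z ^ S n)%C.
Proof.
  induction n; [simpl; unfold geom_coef; ring|].
  change (psum geom_coef z (S n)) with (psum geom_coef z n + RtoC 1 * z ^ S n)%C.
  rewrite Cmult_plus_distr_r, IHn. simpl. ring.
Qed.

Lemma one_minus_neq z : Cmod z < 1 -> (1 - z)%C <> RtoC 0.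
Proof.
  intros H E. assert (z = RtoC 1) as -> by (replace z with (1 - (1 - z))%C by ring; rewrite E; ring).
  rewrite Cmod_1 in H; lra.
Qed.

Lemma expands_geom : expands geom_coef 1 (fun z => / (1 - z))%C.
Proof.
  intros z Hz. pose proof (one_minus_neq z Hz) as N. pose proof (Cmod_ge_0 z).
  pose proof (proj1 (Cmod_gt_0 _) N) as Np.
  apply pseries_eps. intros eps He.
  destruct (geom_small (Cmod z / Cmod (1 - z)%C) (Cmod z) ltac:(lra) eps He) as [N0 H0].
  exists N0. intros n Hn. specialize (H0 n Hn).
  replace (psum geom_coef z n - / (1 - z))%C with (- (z ^ S n) / (1 - z))%C.
  - rewrite Cmod_div by auto. rewrite Cmod_opp, Cmod_pow. simpl.
    unfold Rdiv in *. eapply Rle_lt_trans; [|exact H0]. right; ring.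
  - pose proof (psum_geom z n) as G.
    replace (psum geom_coef z n) with ((psum geom_coef z n * (1 - z)) / (1 - z))%C by (field; auto).
    rewrite G. field; auto.
Qed.

Lemma holo_cmul c R0 F : holo R0 F -> holo R0 (fun z => c * F z)%C.
Proof.
  intros [F' H]. exists (fun z => c * F' z)%C. intros z Hz. destruct (H z Hz) as [H1 H2]. split.
  - apply cder_cmul; [exact H1].
  - apply cont_mul; [apply cont_const|exact H2].
Qed.

Lemma holo_cont R0 F z : holo R0 F -> Cmod z < R0 -> continuous F z.
Proof. intros [F' H] Hz. apply (cder_cont _ _ (F' z)). now apply H. Qed.

Lemma ccont_circle R0 F u e : holo R0 F -> Cmod u < R0 -> ccont e ->
  (forall t, Cmod (e t) = 1) -> ccont (fun t => F (u * e t)%C).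
Proof.
  intros H Hu He E t. apply (continuous_comp (fun t : R => (u * e t)%C) F).
  - apply cont_mul; [apply cont_const|apply He].
  - apply (holo_cont R0); auto. rewrite Cmod_mult, E; lra.
Qed.

Lemma cauchy_kernel_eq r z t : 0 < r -> Cmod z < r ->
  (/ (1 - z / RtoC r * cis (- t)) * (RtoC r * cis t - z) = RtoC r * cis t)%C.
Proof.
  intros Hr Hz.
  assert (Rn : RtoC r <> RtoC 0) by (apply Cneq_of_Re; simpl; lra).
  assert (N : (1 - z / RtoC r * cis (- t))%C <> RtoC 0).
  { apply one_minus_neq. rewrite Cmod_mult, Cmod_cis, Rmult_1_r. now apply Cmod_div_real_lt_1. }
  assert (E : (RtoC r * cis t - z = (1 - z / RtoC r * cis (- t)) * (RtoC r * cis t))%C).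
  { transitivity (RtoC r * cis t - z * (cis t * cis (- t)))%C; [rewrite cis_opp_mul; ring|].
    field. auto. }
  rewrite E. field. split; [auto|].
  intros E2. apply N. replace (1 - z / RtoC r * cis (-t))%C with ((RtoC r - z * cis (- t)) / RtoC r)%C by (field; auto).
  rewrite E2. field. auto.
Qed.

(** Expand the kernel as a geometric series: only its constant term survives
    averaging. *)
Lemma cauchy_kernel r z : 0 < r -> Cmod z < r ->
  ccont (fun t => / (1 - z / RtoC r * cis (- t)))%C /\
  cmean (fun t => / (1 - z / RtoC r * cis (- t)))%C = RtoC 1.
Proof.
  intros Hr Hz. assert (Rn : RtoC r <> RtoC 0) by (apply Cneq_of_Re; simpl; lra).
  assert (Hu : Cmod (z / RtoC r)%C < 1).
  { now apply Cmod_div_real_lt_1. }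
  pose proof (cont_opp_arg _ cis_cont) as Ce.
  assert (He : forall t, Cmod (cis (- t)) = 1) by (intros; apply Cmod_cis).
  split.
  - apply (ccont_expands_circle geom_coef 1 (fun z => / (1 - z))%C (z / RtoC r)%C (fun t => cis (- t)) expands_geom Hu Ce He).
  - pose proof (cmean_expands (fun _ => RtoC 1) geom_coef 1 _ (z / RtoC r)%C _ 1 (ccont_const _) Ce He
       (fun _ => Req_le _ _ Cmod_1) expands_geom Hu) as S.
    rewrite (cmean_ext _ (fun t => / (1 - z / RtoC r * cis (- t)))%C) in S by (intros; ring).
    apply (pseries_unique _ _ _ _ S).
    apply pseries_eps. intros eps Heps. exists O. intros n _.
    replace (psum _ _ n) with (RtoC 1).
    + replace (1 - 1)%C with (RtoC 0) by ring. rewrite Cmod_0; lra.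
    + clear - n. induction n.
      * simpl. unfold geom_coef. rewrite (cmean_ext _ (fun _ => RtoC 1)) by (intros; ring).
        rewrite cmean_const. ring.
      * simpl psum. rewrite <- IHn. rewrite (cmean_ext _ (fun t => cis (- t) ^ S n)%C) by (intros; simpl; ring).
        rewrite cmean_cis_opp_pow by discriminate. ring.
Qed.

Lemma cauchy_formula rho r F z : holo rho F -> 0 < r < rho -> Cmod z < r ->
  cmean (fun t => F (RtoC r * cis t) * / (1 - z / RtoC r * cis (- t)))%C = F z.
Proof.
  intros HF Hr Hz. destruct (cauchy_kernel r z ltac:(lra) Hz) as [CK MK].
  assert (HK := fun t => cauchy_kernel_eq r z t ltac:(lra) Hz).
  assert (A : forall G, holo rho G ->
    Re (cmean (fun t => G (RtoC r * cis t) * / (1 - z / RtoC r * cis (- t)))%C) = Re (G z)).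
  { intros G [G' HG].
    rewrite (homotopy_Re_mean rho r G G' z (fun t => / (1 - z / RtoC r * cis (- t)))%C); auto.
    rewrite MK. f_equal. ring. }
  apply C_ext_ReIm; [now apply A|].
  pose proof (A _ (holo_cmul (- Ci)%C _ _ HF)) as B.
  (* the real part of -i F is the imaginary part of F *)
  rewrite (cmean_ext _ (fun t => - Ci * (F (RtoC r * cis t) * / (1 - z / RtoC r * cis (- t))))%C) in B
    by (intros; ring).
  rewrite cmean_scal in B.
  - revert B. unfold Re, Im; simpl. intros; lra.
  - apply ccont_mul; auto. apply (ccont_circle rho F (RtoC r) cis HF); [|apply cis_cont|apply Cmod_cis].
    rewrite Cmod_R, Rabs_pos_eq; lra.
Qed.

Lemma pseries_rescale a b z u (l : C) : (forall k, a k * z ^ k = b k * u ^ k)%C -> cpseries a z l -> cpseries b u l.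
Proof.
  rewrite !pseries_eps. intros E H eps He. destruct (H eps He) as [N HN]. exists N. intros n Hn.
  replace (psum b u n) with (psum a z n); [now apply HN|].
  clear - E. induction n; simpl psum.
  - specialize (E O). simpl in E. rewrite !Cmult_1_r in E. exact E.
  - rewrite IHn. f_equal. apply E.
Qed.

(** Expand the kernel of Cauchy's formula in a geometric series and average termwise. *)
Lemma taylor_smaller_disc rho r F : holo rho F -> 0 < r < rho -> exists a, expands a r F.
Proof.
  intros HF Hr. assert (Rn : RtoC r <> RtoC 0) by (apply Cneq_of_Re; simpl; lra).
  assert (CF : ccont (fun t => F (RtoC r * cis t)%C)).
  { apply (ccont_circle rho); auto; [|apply cis_cont|apply Cmod_cis]. rewrite Cmod_R, Rabs_pos_eq; lra. }
  destruct (circle_max_attained F (RtoC r) CF) as [s HB].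
  pose proof (cont_opp_arg _ cis_cont) as Ce.
  assert (He : forall t, Cmod (cis (- t)) = 1) by (intros; apply Cmod_cis).
  exists (fun k => cmean (fun t => F (RtoC r * cis t) * cis (- t) ^ k)%C / RtoC r ^ k)%C.
  intros z Hz.
  assert (Hu : Cmod (z / RtoC r)%C < 1).
  { apply Cmod_div_real_lt_1; lra. }
  pose proof (cmean_expands _ geom_coef 1 _ (z / RtoC r)%C _ _ CF Ce He HB expands_geom Hu) as S. cbv beta in S.
  rewrite (cauchy_formula rho r F z HF Hr Hz) in S.
  apply (pseries_rescale _ _ _ _ _) with (2 := S). intros k. unfold geom_coef.
  assert (RtoC r ^ k <> RtoC 0)%C by (apply Cpow_nz; auto).
  unfold Cdiv. rewrite Cpow_mult_l, Cpow_inv by auto. field. auto.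
Qed.

(** The expansions obtained on smaller discs agree near 0, hence have the same
    coefficients. *)
Lemma taylor rho F : 0 < rho -> holo rho F -> exists a, expands a rho F.
Proof.
  intros Hrho HF. destruct (taylor_smaller_disc rho (rho / 2) F HF ltac:(lra)) as [a Ha].
  exists a. intros z Hz. pose proof (Cmod_ge_0 z).
  set (r := (Rmax (Cmod z) (rho / 2) + rho) / 2).
  assert (Hr : Cmod z < r < rho /\ rho / 2 < r).
  { unfold r. pose proof (Rmax_l (Cmod z) (rho / 2)). pose proof (Rmax_r (Cmod z) (rho / 2)).
    assert (Rmax (Cmod z) (rho / 2) < rho) by (apply Rmax_lub_lt; lra). lra. }
  destruct (taylor_smaller_disc rho r F HF ltac:(lra)) as [b Hb].
  apply (pseries_ext b); [|apply Hb; lra].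
  apply (pseries_coeff_unique b a F (rho / 2)); [lra| |];
    intros x Hx; [apply Hb|apply Ha]; rewrite Cmod_R, Rabs_pos_eq; lra.
Qed.

(** * Convolution as a circle mean, Harnack and maximum principle *)

Lemma pseries_single (c : nat -> C) (j : nat) (z : C) :
  (forall k, k <> j -> c k = RtoC 0) -> cpseries c z (c j * z ^ j)%C.
Proof.
  intros H. apply pseries_eps. intros eps He. exists j. intros n Hn.
  replace (psum c z n) with (c j * z ^ j)%C.
  - replace (c j * z ^ j - c j * z ^ j)%C with (RtoC 0) by ring. rewrite Cmod_0; lra.
  - assert (Z : forall m, (m < j)%nat -> psum c z m = RtoC 0).
    { induction m; intros Hm; simpl psum; rewrite H by lia; [reflexivity|]. rewrite IHm by lia. ring. }
    induction Hn.
    + destruct j; simpl psum; [simpl; ring|]. rewrite Z by lia. simpl; ring.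
    + simpl psum. rewrite <- IHHn, (H (S m)) by lia. ring.
Qed.

Lemma cis_opp_pow_mul t k : (cis t ^ k * cis (- t) ^ k)%C = RtoC 1.
Proof.
  rewrite <- Cpow_mult_l, cis_opp_mul. induction k; simpl; [reflexivity|]. rewrite IHk. ring.
Qed.

Lemma cmean_orth k j : k <> j -> cmean (fun t => cis (- t) ^ k * cis t ^ j)%C = RtoC 0.
Proof.
  intros H. destruct (Nat.lt_ge_cases k j) as [L|L].
  - rewrite (cmean_ext _ (fun t => cis t ^ (j - k))%C); [apply cmean_cis_pow; lia|].
    intros t. replace j with (k + (j - k))%nat at 1 by lia.
    rewrite Cpow_add_r. transitivity ((cis t ^ k * cis (- t) ^ k) * cis t ^ (j - k))%C; [ring|].
    rewrite cis_opp_pow_mul. ring.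
  - rewrite (cmean_ext _ (fun t => cis (- t) ^ (k - j))%C); [apply cmean_cis_opp_pow; lia|].
    intros t. replace k with (j + (k - j))%nat at 1 by lia.
    rewrite Cpow_add_r. transitivity ((cis t ^ j * cis (- t) ^ j) * cis (- t) ^ (k - j))%C; [ring|].
    rewrite cis_opp_pow_mul. ring.
Qed.

Lemma cis_opp_cont : ccont (fun t => cis (- t)).
Proof. apply cont_opp_arg, cis_cont. Qed.

Lemma Cmod_cis_opp_pow t k : Cmod (cis (- t) ^ k)%C <= 1.
Proof. rewrite Cmod_pow, Cmod_cis, pow1. lra. Qed.

Lemma Cmod_cis_pow t k : Cmod (cis t ^ k)%C <= 1.
Proof. rewrite Cmod_pow, Cmod_cis, pow1. lra. Qed.

(** Orthogonality of the powers of [cis], applied termwise. *)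
Lemma fourier_nonneg a R0 F u k : expands a R0 F -> Cmod u < R0 ->
  cmean (fun t => F (u * cis t) * cis (- t) ^ k)%C = (a k * u ^ k)%C.
Proof.
  intros H Hu.
  pose proof (cmean_expands (fun t => cis (- t) ^ k)%C a R0 F u cis 1 (ccont_pow _ k cis_opp_cont) cis_cont
     Cmod_cis (fun t => Cmod_cis_opp_pow t k) H Hu) as S.
  assert (T := pseries_single (fun j => a j * cmean (fun t => cis (- t) ^ k * cis t ^ j))%C k u).
  cbv beta in T. rewrite (cmean_ext (fun t => cis (- t) ^ k * cis t ^ k)%C (fun _ => RtoC 1)) in T
    by (intros; rewrite Cmult_comm; apply cis_opp_pow_mul).
  rewrite cmean_const, Cmult_1_r in T.
  rewrite <- (pseries_unique _ _ _ _ S (T ltac:(intros j Hj; rewrite cmean_orth by auto; ring))).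
  apply cmean_ext. intros; ring.
Qed.

Lemma fourier_neg a R0 F u k : expands a R0 F -> Cmod u < R0 -> k <> O ->
  cmean (fun t => F (u * cis t) * cis t ^ k)%C = RtoC 0.
Proof.
  intros H Hu Hk.
  pose proof (cmean_expands (fun t => cis t ^ k)%C a R0 F u cis 1 (ccont_pow _ k cis_cont) cis_cont
     Cmod_cis (fun t => Cmod_cis_pow t k) H Hu) as S.
  assert (E : forall j, cmean (fun t => cis t ^ k * cis t ^ j)%C = RtoC 0).
  { intros j. rewrite (cmean_ext _ (fun t => cis t ^ (k + j))%C); [apply cmean_cis_pow; lia|].
    intros. now rewrite Cpow_add_r. }
  assert (T := pseries_single (fun j => a j * cmean (fun t => cis t ^ k * cis t ^ j))%C k u
    ltac:(intros j _; cbv beta; rewrite E; ring)).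
  cbv beta in T. rewrite E in T.
  rewrite (cmean_ext _ (fun t => cis t ^ k * F (u * cis t))%C) by (intros; ring).
  rewrite (pseries_unique _ _ _ _ S T). ring.
Qed.

Lemma mean_value a R0 F u : expands a R0 F -> Cmod u < R0 -> cmean (fun t => F (u * cis t)%C) = a O.
Proof.
  intros H Hu. pose proof (fourier_nonneg a R0 F u O H Hu) as E. simpl in E.
  rewrite Cmult_1_r in E. rewrite <- E. apply cmean_ext. intros; ring.
Qed.

Lemma Cconj_plus x y : Cconj (x + y)%C = (Cconj x + Cconj y)%C.
Proof. apply C_ext_ReIm; unfold Re, Im; simpl; ring. Qed.

Lemma Cconj_mult x y : Cconj (x * y)%C = (Cconj x * Cconj y)%C.
Proof. apply C_ext_ReIm; unfold Re, Im; simpl; ring. Qed.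

Lemma Cconj_inv2 x : Cconj (Cconj x) = x.
Proof. apply C_ext_ReIm; unfold Re, Im; simpl; ring. Qed.

(** Turns conjugates of values on a circle into values of a power series on the
    reflected circle. *)
Lemma expands_conj a R0 F : expands a R0 F -> expands (fun k => Cconj (a k)) R0 (fun z => Cconj (F (Cconj z))).
Proof.
  intros H z Hz. assert (Hc : Cmod (Cconj z) < R0) by (now rewrite Cmod_conj).
  specialize (H _ Hc). rewrite pseries_eps in *. intros eps He. destruct (H eps He) as [N HN].
  exists N. intros n Hn. specialize (HN n Hn).
  assert (E : psum (fun k => Cconj (a k)) z n = Cconj (psum a (Cconj z) n)).
  { clear. induction n; [reflexivity|]. 
    change (psum (fun k => Cconj (a k)) z n + Cconj (a (S n)) * z ^ S n =
      Cconj (psum a (Cconj z) n + a (S n) * Cconj z ^ S n))%C.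
    now rewrite IHn, Cconj_plus, Cconj_mult, Cconj_pow, Cconj_inv2. }
  rewrite E.
  replace (Cconj (psum a (Cconj z) n) - Cconj (F (Cconj z)))%C with (Cconj (psum a (Cconj z) n - F (Cconj z))%C).
  - now rewrite Cmod_conj.
  - apply C_ext_ReIm; unfold Re, Im; simpl; ring.
Qed.

(** Since 2 Re G = G + conj G, averaging P against G at the conjugate point pairs
    equal indices, giving the convolution; averaging against conj G leaves only
    the constant terms, which the summand -1 cancels. *)
Lemma conv_formula p P Rp g G Rg u v :
  expands p Rp P -> expands g Rg G -> g O = RtoC 1 -> Cmod u < Rp -> 0 <= v < Rg ->
  cpseries (fun k => p k * g k)%C (u * RtoC v)%C
    (cmean (fun t => P (u * cis t) * RtoC (2 * Re (G (RtoC v * cis (- t))%C) - 1))%C).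
Proof.
  intros HP HG G0 Hu Hv.
  assert (Hv' : Cmod (RtoC v) < Rg) by (rewrite Cmod_R, Rabs_pos_eq; lra).
  pose proof (ccont_expands_circle p Rp P u cis HP Hu cis_cont Cmod_cis) as CP.
  destruct (circle_max_attained P u CP) as [s HB].
  pose proof (ccont_expands_circle g Rg G (RtoC v) (fun t => cis (- t)) HG Hv' cis_opp_cont (fun t => Cmod_cis _)) as CG.
  pose proof (cmean_expands _ g Rg G (RtoC v) _ _ CP cis_opp_cont (fun t => Cmod_cis _) HB HG Hv') as S1.
  pose proof (cmean_expands _ _ Rg _ (RtoC v) _ _ CP cis_cont Cmod_cis HB (expands_conj _ _ _ HG) Hv') as S2.
  cbv beta in S1, S2.
  assert (E2 : cmean (fun t => P (u * cis t) * Cconj (G (Cconj (RtoC v * cis t))))%C = p O).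
  { pose proof (pseries_single (fun k => Cconj (g k) * cmean (fun t => P (u * cis t) * cis t ^ k))%C O (RtoC v)) as T.
    specialize (T ltac:(intros k Hk; cbv beta; rewrite (fourier_neg p Rp P u k HP Hu Hk); ring)).
    rewrite (pseries_unique _ _ _ _ S2 T). simpl. rewrite G0, <- (mean_value p Rp P u HP Hu).
    rewrite (cmean_ext _ (fun t => P (u * cis t)%C)) by (intros; ring).
    apply C_ext_ReIm; unfold Re, Im; simpl; ring. }
  assert (E1 : cmean (fun t => P (u * cis t) * RtoC (2 * Re (G (RtoC v * cis (- t))%C) - 1))%C =
     cmean (fun t => P (u * cis t) * G (RtoC v * cis (- t)))%C).
  { assert (CG2 : ccont (fun t => Cconj (G (Cconj (RtoC v * cis t))))%C).
    { apply (ccont_expands_circle _ Rg _ (RtoC v) cis (expands_conj _ _ _ HG) Hv' cis_cont Cmod_cis). }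
    rewrite (cmean_ext _ (fun t => P (u * cis t) * G (RtoC v * cis (- t)) +
        (P (u * cis t) * Cconj (G (Cconj (RtoC v * cis t))) + RtoC (-1) * P (u * cis t))))%C.
    - rewrite cmean_plus, cmean_plus, cmean_scal, E2, (mean_value p Rp P u HP Hu); auto.
      + apply C_ext_ReIm; unfold Re, Im; simpl; ring.
      + apply ccont_mul; auto.
      + apply ccont_mul; auto. apply ccont_const.
      + apply ccont_mul; auto.
      + apply ccont_add; [|apply ccont_mul; auto; apply ccont_const]. apply ccont_mul; auto.
    - intros t. replace (Cconj (RtoC v * cis t))%C with (RtoC v * cis (- t))%C.
      + apply C_ext_ReIm; unfold Re, Im; simpl; ring.
      + rewrite cis_opp_conj. apply C_ext_ReIm; unfold Re, Im; simpl; ring. }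
  rewrite E1. apply (pseries_rescale _ _ _ _ _) with (2 := S1).
  intros k. rewrite (fourier_nonneg p Rp P u k HP Hu), Cpow_mult_l. ring.
Qed.

(** This is the Poisson kernel, with its minimum over the circle. *)
Lemma geom_kernel_bound v t : 0 <= v < 1 ->
  (1 - v) / (1 + v) <= 2 * Re (/ (1 - RtoC v * cis (- t)))%C - 1.
Proof.
  intros Hv. unfold cis, Re; simpl. rewrite cos_neg, sin_neg.
  set (c := cos t). set (s := sin t). assert (E : s * s = 1 - c * c).
  { pose proof (sin2_cos2 t) as H. unfold Rsqr in H. fold c s in H. lra. }
  pose proof (COS_bound t) as Hc. fold c in Hc.
  set (D := 1 - 2 * v * c + v * v).
  match goal with |- _ <= 2 * (?a / ?b) - 1 => replace b with D; [replace a with (1 - v * c) by ring|] end.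
  2:{ unfold D. replace (v * v) with (v * v * (c * c + s * s)) by (rewrite E; ring). ring. }
  assert (HD : (1 - v) * (1 - v) <= D) by (unfold D; nra).
  assert (HD0 : 0 < D) by nra.
  assert (HD2 : D <= (1 + v) * (1 + v)) by (unfold D; nra).
  replace (2 * ((1 - v * c) / D) - 1) with ((1 - v * v) / D) by (unfold D in *; field; lra).
  apply Rmult_le_reg_r with (D * (1 + v)); [nra|].
  replace ((1 - v) / (1 + v) * (D * (1 + v))) with ((1 - v) * D) by (field; lra).
  replace ((1 - v * v) / D * (D * (1 + v))) with ((1 - v) * ((1 + v) * (1 + v))) by (field; lra).
  apply Rmult_le_compat_l; lra.
Qed.

Lemma Re_mul_RtoC (z : C) (x : R) : Re (z * RtoC x)%C = Re z * x.
Proof. unfold Re; simpl; ring. Qed.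

(** Places a point inside the circle of radius [r] as [v] times a point on the
    circle, the form in which [conv_formula] evaluates. *)
Lemma polar_split z r : 0 < r -> Cmod z < r -> exists u v, Cmod u = r /\ v = Cmod z / r /\ 0 <= v < 1 /\ (u * RtoC v)%C = z.
Proof.
  intros Hr Hz. pose proof (Cmod_ge_0 z) as H0.
  assert (Hv : 0 <= Cmod z / r < 1).
  { apply ratio_lt_1; lra. }
  destruct (Req_EM_T (Cmod z) 0) as [E|E].
  - exists (RtoC r), (Cmod z / r). repeat split; try lra.
    + rewrite Cmod_R, Rabs_pos_eq; lra.
    + rewrite E. apply Cmod_eq_0 in E. rewrite E. unfold Rdiv. rewrite Rmult_0_l. ring.
  - exists (RtoC r * (z / RtoC (Cmod z)))%C, (Cmod z / r).
    assert (N : RtoC (Cmod z) <> RtoC 0) by (apply Cneq_of_Re; simpl; auto).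
    repeat split; try lra.
    + rewrite Cmod_mult, Cmod_div, !Cmod_R, !Rabs_pos_eq by (auto; lra). field. auto.
    + assert (RtoC r <> RtoC 0) by (apply Cneq_of_Re; simpl; lra).
      rewrite RtoC_div by lra. field; auto.
Qed.

Lemma expands_sub_const a R0 F (c : C) : expands a R0 F ->
  expands (fun k => match k with O => a O - c | S _ => a k end)%C R0 (fun z => F z - c)%C.
Proof.
  intros H z Hz. specialize (H z Hz). rewrite pseries_eps in *. intros eps He.
  destruct (H eps He) as [N HN]. exists N. intros n Hn. specialize (HN n Hn).
  assert (E : psum (fun k => match k with O => a O - c | S _ => a k end)%C z n = (psum a z n - c)%C).
  { clear. induction n; [reflexivity|]. simpl psum. rewrite IHn. ring. }
  rewrite E. replace (psum a z n - c - (F z - c))%C with (psum a z n - F z)%C by ring. exact HN.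
Qed.

(** The convolution formula with the geometric series writes P - beta as an
    average of nonnegative values against the Poisson kernel, whose lower bound
    gives the estimate. *)
Lemma harnack_expands a R0 P r beta z : expands a R0 P -> 0 < r < R0 -> Cmod z < r ->
  (forall w, Cmod w = r -> beta <= Re (P w)) ->
  beta + (1 - Cmod z / r) / (1 + Cmod z / r) * (Re (a O) - beta) <= Re (P z) /\ beta <= Re (a O).
Proof.
  intros HP Hr Hz HB.
  destruct (polar_split z r ltac:(lra) Hz) as [u [v [Hu [Ev [Hv E]]]]]. rewrite <- Ev.
  assert (HuR : Cmod u < R0) by lra.
  pose proof (expands_sub_const _ _ _ (RtoC beta) HP) as HP1.
  set (kap := (1 - v) / (1 + v)).
  set (p1 := fun k => match k with O => (a O - RtoC beta)%C | S _ => a k end) in *.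
  assert (HB1 : forall t, 0 <= Re (P (u * cis t) - RtoC beta)%C).
  { intros t. specialize (HB (u * cis t)%C). rewrite Cmod_mult, Cmod_cis in HB.
    specialize (HB ltac:(lra)). unfold Re in *; simpl in *; lra. }
  pose proof (conv_formula _ _ _ _ _ _ u v HP1 expands_geom eq_refl HuR Hv) as S.
  rewrite E in S. cbv beta in S.
  assert (S' : cpseries p1 z (P z - RtoC beta)%C) by (apply HP1; lra).
  apply (pseries_ext _ p1) in S; [|intros k; unfold geom_coef; ring].
  pose proof (pseries_unique _ _ _ _ S S') as EQ.
  pose proof (ccont_expands_circle _ _ _ u cis HP1 HuR cis_cont Cmod_cis) as C1.
  pose proof (mean_value _ _ _ u HP1 HuR) as MV. cbv beta in MV, C1.
  assert (CW : ccont (fun t => RtoC (2 * Re (/ (1 - RtoC v * cis (- t)))%C - 1))).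
  { intros t. apply (cont_RtoC (U := R_UniformSpace)).
    apply (continuous_minus (V := R_NormedModule)); [|apply continuous_const].
    apply continuous_const_mult.
    apply (ccont_Re (fun t => / (1 - RtoC v * cis (- t)))%C).
    apply (ccont_expands_circle _ _ _ (RtoC v) (fun t => cis (- t)) expands_geom).
    - rewrite Cmod_R, Rabs_pos_eq; lra.
    - apply cis_opp_cont.
    - intros; apply Cmod_cis. }
  assert (M0 : Re (a O) - beta = rmean (fun t => Re (P (u * cis t) - RtoC beta)%C)).
  { apply (f_equal Re) in MV. symmetry. exact MV. }
  split.
  - assert (L : kap * (Re (a O) - beta) <= Re (P z) - beta).
    { replace (Re (P z) - beta) with (Re (P z - RtoC beta)%C) by (unfold Re; simpl; ring).
      rewrite <- EQ, M0, <- rmean_scal by (apply ccont_Re; exact C1).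
      apply rmean_le.
      - intros t. apply continuous_const_mult.
        apply (ccont_Re _ C1).
      - apply (ccont_Re (fun t => (P (u * cis t) - RtoC beta) * RtoC (2 * Re (/ (1 - RtoC v * cis (- t))) - 1))%C).
        apply ccont_mul; auto.
      - intros t. rewrite Re_mul_RtoC, Rmult_comm. apply Rmult_le_compat_l; auto.
        apply geom_kernel_bound; auto. }
    lra.
  - assert (0 <= Re (a O) - beta); [|lra].
    rewrite M0, <- (rmean_const 0). apply rmean_le; auto; [intros t; apply continuous_const|].
    apply (ccont_Re _ C1).
Qed.

Lemma expands_value_0 a R0 F : 0 < R0 -> expands a R0 F -> F (RtoC 0) = a O.
Proof.
  intros H HF. apply (pseries_unique a (RtoC 0)); [apply HF; rewrite Cmod_0; lra|apply pseries_at0].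
Qed.

Lemma holo_weaken R1 R2 F : R2 <= R1 -> holo R1 F -> holo R2 F.
Proof. intros H [F' HF]. exists F'. intros z Hz. apply HF. lra. Qed.

Lemma max_principle_Re R0 F r beta z : holo R0 F -> 0 < r < R0 -> Cmod z < r ->
  (forall w, Cmod w = r -> beta <= Re (F w)) -> beta <= Re (F z).
Proof.
  intros HF Hr Hz HB. destruct (taylor R0 F ltac:(lra) HF) as [a Ha].
  destruct (harnack_expands a R0 F r beta z Ha Hr Hz HB) as [H1 H2].
  pose proof (Cmod_ge_0 z).
  assert (0 <= (1 - Cmod z / r) / (1 + Cmod z / r)).
  { assert (0 <= Cmod z / r < 1).
    { apply ratio_lt_1; lra. }
    apply Rdiv_le_0_compat; lra. }
  nra.
Qed.

(** Harnack's inequality leaves a positive fraction of the value at the centre.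
    The origin is excluded from the weak hypothesis because the quotients to
    which this is applied are first estimated away from 0. *)
Lemma strict_positivity F beta z : holo 1 F -> Cmod z < 1 ->
  (forall w, Cmod w < 1 -> w <> RtoC 0 -> beta <= Re (F w)) -> beta < Re (F (RtoC 0)) -> beta < Re (F z).
Proof.
  intros HF Hz HB H0. destruct (taylor 1 F ltac:(lra) HF) as [a Ha]. pose proof (Cmod_ge_0 z).
  set (r := (1 + Cmod z) / 2). assert (Hr : Cmod z < r < 1) by (unfold r; lra).
  destruct (harnack_expands a 1 F r beta z Ha ltac:(lra) ltac:(lra)) as [H1 _].
  { intros w Hw. apply HB; [lra|]. intros ->. rewrite Cmod_0 in Hw. lra. }
  rewrite (expands_value_0 a 1 F ltac:(lra) Ha) in H0.
  assert (0 < (1 - Cmod z / r) / (1 + Cmod z / r)).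
  { assert (0 <= Cmod z / r < 1).
    { apply ratio_lt_1; lra. }
    apply Rdiv_lt_0_compat; lra. }
  nra.
Qed.

Lemma Cconj_mul_self z : (Cconj z * z)%C = RtoC (Cmod z ^ 2).
Proof. rewrite Cmod2_conj. ring. Qed.

(** Rotate the value at [z] to the negative real axis and use the maximum
    principle for the real part. *)
Lemma max_modulus R0 F r B z : holo R0 F -> 0 < r < R0 -> Cmod z < r ->
  (forall w, Cmod w = r -> Cmod (F w) <= B) -> Cmod (F z) <= B.
Proof.
  intros HF Hr Hz HB. set (m := Cmod (F z)). assert (Hm0 : 0 <= m) by apply Cmod_ge_0.
  pose proof (max_principle_Re R0 (fun w => (- Cconj (F z)) * F w)%C r (- (m * B)) z (holo_cmul _ _ _ HF) Hr Hz) as H.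
  assert (HA : - (m * B) <= Re (- Cconj (F z) * F z)%C).
  { apply H. intros w Hw. pose proof (re_le_Cmod (- Cconj (F z) * F w)%C) as T.
    rewrite Cmod_mult, Cmod_opp, Cmod_conj in T. fold m in T.
    apply Rabs_le_between in T.
    pose proof (Rmult_le_compat_l m _ _ Hm0 (HB w Hw)). lra. }
  replace (- Cconj (F z) * F z)%C with (- (Cconj (F z) * F z))%C in HA by ring.
  rewrite Cconj_mul_self in HA. fold m in HA. unfold Re in HA. simpl in HA.
  destruct (Req_EM_T m 0) as [E|E].
  - rewrite E. apply Rle_trans with (Cmod (F (RtoC r))); [apply Cmod_ge_0|]. apply HB.
    rewrite Cmod_R, Rabs_pos_eq; lra.
  - apply Rmult_le_reg_l with m; lra.
Qed.

(** The convolution is an average against a nonnegative kernel of mean 1, which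
    gives the weak inequality; the strict one follows from Harnack since it holds
    at the centre. *)
Lemma conv_half_plane p P g G beta :
  expands p 1 P -> expands g 1 G -> g O = RtoC 1 ->
  (forall z, Cmod z < 1 -> 1 / 2 <= Re (G z)) ->
  (forall z, Cmod z < 1 -> beta <= Re (P z)) -> beta < Re (p O) ->
  expands (fun k => p k * g k)%C 1 (pseries_value (fun k => p k * g k)%C) /\
  forall z, Cmod z < 1 -> beta < Re (pseries_value (fun k => p k * g k)%C z).
Proof.
  intros HP HG G0 HReG HReP H0.
  assert (Main : forall z, Cmod z < 1 -> exists l, cpseries (fun k => p k * g k)%C z l /\ beta <= Re l).
  { intros z Hz. pose proof (Cmod_ge_0 z).
    (* z = u v with both factors inside the disc *)
    set (v := (1 + Cmod z) / 2). assert (Hv : Cmod z < v < 1) by (unfold v; lra).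
    assert (Nv : RtoC v <> RtoC 0) by (apply Cneq_of_Re; simpl; lra).
    set (u := (z / RtoC v)%C).
    assert (Hu : Cmod u < 1).
    { apply Cmod_div_real_lt_1; lra. }
    pose proof (conv_formula _ _ _ _ _ _ u v HP HG G0 Hu ltac:(lra)) as S.
    replace (u * RtoC v)%C with z in S by (unfold u; field; auto).
    eexists; split; [exact S|].
    set (W := fun t => 2 * Re (G (RtoC v * cis (- t))%C) - 1).
    assert (Hv' : Cmod (RtoC v) < 1) by (rewrite Cmod_R, Rabs_pos_eq; lra).
    pose proof (ccont_expands_circle g 1 G (RtoC v) (fun t => cis (- t)) HG Hv' cis_opp_cont (fun t => Cmod_cis _)) as CG.
    pose proof (ccont_expands_circle p 1 P u cis HP Hu cis_cont Cmod_cis) as CP.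
    assert (CW : rcont W).
    { intros t. unfold W. apply (continuous_minus (V := R_NormedModule)); [|apply continuous_const].
      apply continuous_const_mult. apply (ccont_Re _ CG). }
    assert (MG : rmean (fun t => Re (G (RtoC v * cis (- t))%C)) = 1).
    { pose proof (mean_value _ _ _ (RtoC v) (expands_conj _ _ _ HG) Hv') as M. cbv beta in M.
      apply (f_equal Re) in M. rewrite G0 in M. rewrite (rmean_ext _ (fun t => Re (Cconj (G (Cconj (RtoC v * cis t))))%C)); [exact M|].
      intros t. replace (Cconj (RtoC v * cis t))%C with (RtoC v * cis (- t))%C; [reflexivity|].
      rewrite cis_opp_conj. apply C_ext_ReIm; unfold Re, Im; simpl; ring. }
    assert (MW : rmean W = 1).
    { unfold W. transitivity (2 * rmean (fun t => Re (G (RtoC v * cis (- t))%C)) + rmean (fun _ => -1)).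
      - rewrite <- rmean_scal by apply (ccont_Re _ CG). rewrite <- rmean_plus.
        + apply rmean_ext. intros; ring.
        + intros t. apply continuous_const_mult. apply (ccont_Re _ CG).
        + intros t; apply continuous_const.
      - rewrite MG, rmean_const. ring. }
    replace beta with (beta * rmean W) by (rewrite MW; ring).
    rewrite <- rmean_scal by auto. apply rmean_le.
    - intros t. apply continuous_const_mult, CW.
    - apply (ccont_Re (fun t => P (u * cis t) * RtoC (W t))%C). apply ccont_mul; auto.
      intros t. apply cont_RtoC. apply CW.
    - intros t. rewrite Re_mul_RtoC. apply Rmult_le_compat_r.
      + assert (1 / 2 <= Re (G (RtoC v * cis (- t))%C)); [|unfold W in *; lra].
        apply HReG. rewrite Cmod_mult, Cmod_cis; lra.
      + apply HReP. rewrite Cmod_mult, Cmod_cis; lra. }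
  assert (HPS : expands (fun k => p k * g k)%C 1 (pseries_value (fun k => p k * g k)%C)).
  { intros z Hz. destruct (Main z Hz) as [l [Hl _]]. now rewrite (pseries_value_correct _ _ _ Hl). }
  split; [exact HPS|].
  intros z Hz. apply strict_positivity; auto.
  - apply (expands_holo _ _ _ HPS).
  - intros w Hw _. destruct (Main w Hw) as [l [Hl Hb]]. now rewrite (pseries_value_correct _ _ _ Hl).
  - rewrite (expands_value_0 _ 1 _ ltac:(lra) HPS), G0, Cmult_1_r. exact H0.
Qed.

(** * Complex exponential, logarithm and powers *)

Definition Cexp (z : C) : C := (RtoC (exp (Re z)) * cis (Im z))%C.
(** Principal branch; its exponential multiples are the principal powers, see
    [Cpower_Cexp]. *)
Definition Clog (z : C) : C := (ln (Cmod z), Carg z).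

Lemma Cexp_plus x y : Cexp (x + y)%C = (Cexp x * Cexp y)%C.
Proof.
  unfold Cexp. change (Re (x + y)%C) with (Re x + Re y). change (Im (x + y)%C) with (Im x + Im y).
  rewrite exp_plus, cis_plus, RtoC_mult. ring.
Qed.

Lemma Cmod_Cexp z : Cmod (Cexp z) = exp (Re z).
Proof.
  unfold Cexp. rewrite Cmod_mult, Cmod_cis, Cmod_R, Rabs_pos_eq, Rmult_1_r; [reflexivity|].
  apply Rlt_le, exp_pos.
Qed.

Lemma Cexp_neq0 z : Cexp z <> RtoC 0.
Proof. apply Cmod_gt_0. rewrite Cmod_Cexp. apply exp_pos. Qed.

Lemma Cexp_0 : Cexp (RtoC 0) = RtoC 1.
Proof. unfold Cexp, Re, Im; simpl. rewrite exp_0, cis_0. ring. Qed.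

Lemma Cexp_pow z k : (Cexp z ^ k)%C = Cexp (RtoC (INR k) * z)%C.
Proof.
  induction k; simpl Cpow.
  - replace (RtoC (INR 0) * z)%C with (RtoC 0) by (simpl; ring). symmetry; apply Cexp_0.
  - rewrite IHk, <- Cexp_plus. f_equal. rewrite S_INR, RtoC_plus. ring.
Qed.

Lemma Cpower_Cexp z s : Cpower z s = Cexp (RtoC s * Clog z)%C.
Proof.
  unfold Cpower, Cexp, Clog, Rpower, cis. apply C_ext_ReIm; unfold Re, Im; simpl.
  - replace (s * ln (Cmod z) - 0 * Carg z) with (s * ln (Cmod z)) by ring.
    replace (s * Carg z + 0 * ln (Cmod z)) with (s * Carg z) by ring. ring.
  - replace (s * ln (Cmod z) - 0 * Carg z) with (s * ln (Cmod z)) by ring.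
    replace (s * Carg z + 0 * ln (Cmod z)) with (s * Carg z) by ring. ring.
Qed.

Lemma Cpower_neq0 z s : Cpower z s <> RtoC 0.
Proof. rewrite Cpower_Cexp. apply Cexp_neq0. Qed.

Lemma cder_Cexp_0 : cder Cexp (RtoC 0) (RtoC 1).
Proof.
  destruct (caratheodory_of_is_derive exp 0 1) as [p [Cp [Ep Hp]]].
  { pose proof (derivable_pt_lim_exp 0) as H. rewrite exp_0 in H. now apply is_derive_Reals. }
  destruct (rder_cis 0) as [q [Cq [Eq Hq]]].
  apply cder_eps. intros eps He.
  assert (CI : forall f : R -> R, continuous f 0 -> continuous (fun h : C => f (Im h)) (RtoC 0)).
  { intros f Hf. apply (continuous_comp Im f); [apply (continuous_snd (U:=R_UniformSpace) (V:=R_UniformSpace))|exact Hf]. }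
  assert (CIm : continuous Im (RtoC 0)) by apply (continuous_snd (U:=R_UniformSpace) (V:=R_UniformSpace)).
  assert (CRe : continuous Re (RtoC 0)) by apply (continuous_fst (U:=R_UniformSpace) (V:=R_UniformSpace)).
  assert (C1 : continuous (fun h : C => RtoC (p (Re h)) * cis (Im h) - 1)%C (RtoC 0)).
  { apply cont_sub; [|apply cont_const]. apply cont_mul.
    - apply cont_RtoC. apply (continuous_comp Re p); auto.
    - apply (continuous_comp Im cis); auto. apply cis_cont. }
  assert (C2 : continuous (fun h : C => q (Im h) - Ci)%C (RtoC 0)).
  { apply cont_sub; [|apply cont_const]. apply (continuous_comp Im q); auto. }
  assert (L1 : locally (RtoC 0) (fun h : C => Cmod (RtoC (p (Re h)) * cis (Im h) - 1)%C < eps / 2)).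
  { apply (cont_Cmod_lt _ _ _ C1). change (Re 0) with 0. change (Im 0) with 0. rewrite Ep, cis_0.
    replace (1 * 1 - 1)%C with (RtoC 0) by ring. rewrite Cmod_0; lra. }
  assert (L2 : locally (RtoC 0) (fun h : C => Cmod (q (Im h) - Ci)%C < eps / 2)).
  { apply (cont_Cmod_lt _ _ _ C2). change (Im 0) with 0. rewrite Eq, cis_0.
    replace (Ci * 1 - Ci)%C with (RtoC 0) by ring. rewrite Cmod_0; lra. }
  assert (L3 : locally (RtoC 0) (fun h : C => (cis (Im h) - cis 0 = q (Im h) * (RtoC (Im h) - RtoC 0))%C)).
  { apply (CIm _ Hq). }
  generalize (filter_and _ _ L1 (filter_and _ _ L2 L3)). apply filter_imp.
  refine (fun (h : C) => _). intros [A [B D]]. rewrite Cexp_0. unfold Cexp. specialize (Hp (Re h)). rewrite exp_0 in Hp.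
  rewrite cis_0 in D.
  replace (RtoC (exp (Re h)) * cis (Im h) - 1 - 1 * (h - 0))%C with
   ((RtoC (p (Re h)) * cis (Im h) - 1) * RtoC (Re h) + (q (Im h) - Ci) * RtoC (Im h))%C.
  - replace (h - 0)%C with h by ring. eapply Rle_trans; [apply Cmod_triangle|].
    rewrite !Cmod_mult, !Cmod_R.
    pose proof (re_le_Cmod h). pose proof (im_le_Cmod h).
    apply Rle_trans with (eps / 2 * Cmod h + eps / 2 * Cmod h); [|lra].
    apply Rplus_le_compat; apply Rmult_le_compat; auto using Cmod_ge_0, Rabs_pos; lra.
  - replace (exp (Re h)) with (1 + p (Re h) * Re h) by lra.
    replace (RtoC (1 + p (Re h) * Re h) * cis (Im h) - 1 - 1 * (h - 0))%C with
      (RtoC (p (Re h)) * RtoC (Re h) * cis (Im h) + (cis (Im h) - 1) - h)%C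
      by (rewrite RtoC_plus, RtoC_mult; ring).
    rewrite D. assert (Eh : h = (RtoC (Re h) + Ci * RtoC (Im h))%C) by (apply C_ext_ReIm; unfold Re, Im; simpl; ring).
    revert Eh. generalize (Re h) (Im h). intros x y ->. ring.
Qed.

Lemma cder_Cexp z : cder Cexp z (Cexp z).
Proof.
  assert (D : cder (fun w => Cexp z * Cexp (w - z))%C z (Cexp z * (RtoC 1 * (RtoC 1 - RtoC 0)))%C).
  { apply (cder_cmul (Cexp z) (fun w => Cexp (w - z)%C)); [].
    apply (cder_comp Cexp (fun w => (w - z)%C)); [ |].
    - replace (z - z)%C with (RtoC 0) by ring. apply cder_Cexp_0.
    - apply (cder_sub (fun w => w) (fun _ => z)); [ |].
      + apply cder_id.
      + apply cara_deriv_const. }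
  replace (Cexp z * (1 * (1 - 0)))%C with (Cexp z) in D by ring.
  revert D. apply (cara_deriv_ext_loc (U := C_UniformSpace)). apply filter_forall. intros w.
  rewrite <- Cexp_plus. f_equal. ring.
Qed.

Lemma Carg_cis rho t : 0 < rho -> - PI < t <= PI -> Carg (RtoC rho * cis t)%C = t.
Proof.
  intros Hr Ht. unfold Carg.
  replace (Cmod (RtoC rho * cis t)%C) with rho by (rewrite Cmod_mult, Cmod_cis, Cmod_R, Rabs_pos_eq; lra).
  replace (Re (RtoC rho * cis t)%C / rho) with (cos t) by (unfold cis, Re; simpl; field; lra).
  replace (Im (RtoC rho * cis t)%C) with (rho * sin t) by (unfold cis, Im; simpl; ring).
  destruct (Rle_dec 0 (rho * sin t)) as [H|H].
  - assert (0 <= t).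
    { destruct (Rle_or_lt 0 t); auto. exfalso.
      assert (sin t < 0). { apply sin_lt_0_var; lra. } nra. }
    apply acos_cos; lra.
  - assert (t < 0).
    { destruct (Rlt_or_le t 0); auto. exfalso. apply H.
      apply Rmult_le_pos; [lra|]. apply sin_ge_0; lra. }
    rewrite <- cos_neg, acos_cos; lra.
Qed.

Lemma Cmod_sqr z : Cmod z * Cmod z = Re z * Re z + Im z * Im z.
Proof. pose proof (Cmod2_alt z) as H. simpl in H. lra. Qed.

Lemma Carg_polar z : z <> RtoC 0 -> z = (RtoC (Cmod z) * cis (Carg z))%C /\ - PI < Carg z <= PI.
Proof.
  intros Hz. pose proof (proj1 (Cmod_gt_0 _) Hz) as Hm. set (m := Cmod z) in *.
  assert (Hsq := Cmod_sqr z). fold m in Hsq.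
  set (x := Re z / m). set (y := Im z / m).
  assert (Hxy : x * x + y * y = 1) by (replace 1 with (m * m / (m * m)) by (field; lra); rewrite Hsq at 1; unfold x, y; field; lra).
  assert (Hx : -1 <= x <= 1) by nra.
  pose proof (acos_bound x) as Hb. pose proof PI_RGT_0 as Hpi.
  assert (Hy : sin (acos x) = Rabs y).
  { rewrite sin_acos by auto. replace (1 - x²) with (y²) by (unfold Rsqr; lra). apply sqrt_Rsqr_abs. }
  unfold Carg. fold m x. destruct (Rle_dec 0 (Im z)) as [H|H].
  - assert (0 <= y) by (unfold y; apply Rdiv_le_0_compat; lra).
    rewrite Rabs_pos_eq in Hy by auto. split; [|lra].
    apply C_ext_ReIm; unfold cis, Re, Im; simpl; rewrite ?Hy, ?cos_acos by auto.
    + change (fst z) with (Re z). unfold x. field; lra.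
    + change (snd z) with (Im z). unfold y. field; lra.
  - assert (y < 0).
    { unfold y. apply Rmult_lt_reg_r with m; auto. unfold Rdiv. rewrite Rmult_assoc, Rinv_l; lra. }
    rewrite Rabs_left in Hy by auto. split.
    + apply C_ext_ReIm; unfold cis, Re, Im; simpl; rewrite ?cos_neg, ?sin_neg, ?Hy, ?cos_acos by auto.
      * change (fst z) with (Re z). unfold x. field; lra.
      * change (snd z) with (Im z). unfold y. field; lra.
    + assert (acos x <> PI). { intros E. rewrite E, sin_PI in Hy. lra. } lra.
Qed.

Lemma Cexp_Clog z : z <> RtoC 0 -> Cexp (Clog z) = z.
Proof.
  intros Hz. destruct (Carg_polar z Hz) as [E _]. rewrite E at 2.
  unfold Cexp, Clog, Re, Im; simpl. rewrite exp_ln; [reflexivity|]. now apply Cmod_gt_0.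
Qed.

Lemma Clog_Cexp x : - PI < Im x <= PI -> Clog (Cexp x) = x.
Proof.
  intros H. unfold Clog. rewrite Cmod_Cexp, ln_exp. unfold Cexp.
  rewrite Carg_cis by (auto; apply exp_pos). destruct x; reflexivity.
Qed.

Definition slit (z : C) : Prop := ~ (Im z = 0 /\ Re z <= 0).

Lemma slit_neq0 z : slit z -> z <> RtoC 0.
Proof. intros H ->. apply H. unfold Re, Im; simpl; lra. Qed.

Lemma slit_Carg z : slit z -> - PI < Carg z < PI.
Proof.
  intros H. destruct (Carg_polar z (slit_neq0 z H)) as [E B].
  destruct (Req_EM_T (Carg z) PI) as [E2|]; [|lra]. exfalso. apply H. rewrite E, E2.
  unfold cis, Re, Im; simpl. rewrite cos_PI, sin_PI. pose proof (Cmod_ge_0 z). split; [ring|lra].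
Qed.

Lemma Re_pos_slit z : 0 < Re z -> slit z.
Proof. intros H [_ H2]. lra. Qed.

Lemma Carg_Re_pos z : 0 < Re z -> - (PI / 2) < Carg z < PI / 2 /\ Carg z = atan (Im z / Re z).
Proof.
  intros H. pose proof (Re_pos_slit z H) as Hs. pose proof (slit_neq0 z Hs) as Hz.
  destruct (Carg_polar z Hz) as [E B]. set (t := Carg z) in *.
  pose proof (proj1 (Cmod_gt_0 _) Hz) as Hm.
  assert (ER : Re z = Cmod z * cos t) by (rewrite E at 1; unfold cis, Re; simpl; ring).
  assert (EI : Im z = Cmod z * sin t) by (rewrite E at 1; unfold cis, Im; simpl; ring).
  assert (Hc : 0 < cos t) by nra.
  assert (Ht : - (PI / 2) < t < PI / 2).
  { split.
    - destruct (Rlt_or_le (- (PI / 2)) t); auto. exfalso.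
      assert (cos t <= 0). { rewrite <- cos_neg. apply cos_le_0; lra. } lra.
    - destruct (Rlt_or_le t (PI / 2)); auto. exfalso.
      assert (cos t <= 0). { apply cos_le_0; lra. } lra. }
  split; [exact Ht|].
  rewrite ER, EI. replace (Cmod z * sin t / (Cmod z * cos t)) with (tan t) by (unfold tan; field; lra).
  symmetry. apply atan_tan. lra.
Qed.

(** In Caratheodory's form the inverse has the reciprocal quotient function, so
    only continuity of the inverse is needed.  Used for the logarithm and for
    inverses of univalent maps. *)
Lemma cder_inverse (g psi : C -> C) (w0 l : C) :
  continuous psi w0 -> cder g (psi w0) l -> l <> RtoC 0 ->
  locally w0 (fun w => g (psi w) = w) -> cder psi w0 (/ l)%C.
Proof.
  intros Cpsi [p [Cp [Ep Hp]]] Hl Hg.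
  assert (Cq : continuous (fun w => p (psi w)) w0) by now apply continuous_comp.
  assert (Hq0 : p (psi w0) <> RtoC 0) by (now rewrite Ep).
  exists (fun w => / p (psi w))%C. split; [now apply cont_inv|]. split; [now rewrite Ep|].
  pose proof (Cpsi _ Hp) as Hp'. unfold filtermap in Hp'.
  pose proof (locally_singleton _ _ Hg) as Hg0. cbv beta in Hg0.
  generalize (filter_and _ _ Hg (filter_and _ _ Hp' (cont_neq0 _ _ Cq Hq0))). apply filter_imp.
  intros w [A [B D]]. rewrite A, Hg0 in B. rewrite B. field. exact D.
Qed.

Lemma cont_ln_Cmod z : z <> RtoC 0 -> continuous (fun w => ln (Cmod w)) z.
Proof.
  intros Hz. apply (continuous_comp Cmod ln).
  - apply (cont_Cmod (U := C_UniformSpace) (fun w => w)). apply cont_id.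
  - apply continuity_pt_filterlim. apply derivable_continuous_pt. exists (/ Cmod z).
    apply derivable_pt_lim_ln. now apply Cmod_gt_0.
Qed.

Lemma cont_Carg_1 : continuous Carg (RtoC 1).
Proof.
  assert (L : locally (RtoC 1) (fun w : C => 0 < Re w)).
  { apply (cont_Re_gt (U := C_UniformSpace) (fun w => w)); [apply cont_id|unfold Re; simpl; lra]. }
  apply (continuous_ext_loc _ (fun w : C => atan (Im w / Re w))).
  - revert L. apply filter_imp. intros w Hw. symmetry. now apply Carg_Re_pos.
  - apply (continuous_comp (fun w : C => Im w / Re w) atan).
    + apply (continuous_mult (K := R_AbsRing)).
      * apply (continuous_snd (U:=R_UniformSpace) (V:=R_UniformSpace)).
      * apply (continuous_comp Re Rinv); [apply (continuous_fst (U:=R_UniformSpace) (V:=R_UniformSpace))|].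
        apply continuous_Rinv. unfold Re; simpl; lra.
    + apply continuity_pt_filterlim. apply derivable_continuous_pt.
      eexists. apply derivable_pt_lim_atan.
Qed.

Lemma Clog_1 : Clog (RtoC 1) = RtoC 0.
Proof. rewrite <- Cexp_0. apply Clog_Cexp. unfold Im; simpl. pose proof PI_RGT_0; lra. Qed.

Lemma cder_Clog_1 : cder Clog (RtoC 1) (RtoC 1).
Proof.
  replace (RtoC 1) with (/ RtoC 1)%C at 2 by (field; apply Cneq_of_Re; simpl; lra).
  apply (cder_inverse Cexp).
  - apply cont_ReIm; [apply cont_ln_Cmod|apply cont_Carg_1]. apply Cneq_of_Re; simpl; lra.
  - rewrite Clog_1. apply cder_Cexp_0.
  - apply Cneq_of_Re; simpl; lra.
  - generalize (cont_neq0 (U := C_UniformSpace) (fun w => w) (RtoC 1) (cont_id _) ltac:(apply Cneq_of_Re; simpl; lra)).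
    apply filter_imp. intros w Hw. now apply Cexp_Clog.
Qed.

(** Off the cut the argument stays away from -PI and PI, so a small change of
    argument does not wrap around.  This reduces differentiability of the
    logarithm everywhere to the point 1. *)
Lemma Clog_quotient_near z0 : slit z0 -> locally z0 (fun w => (Clog w = Clog z0 + Clog (w / z0))%C).
Proof.
  intros Hs. pose proof (slit_neq0 z0 Hs) as Hz0. pose proof (slit_Carg z0 Hs) as HA.
  assert (Cq : continuous (fun w => w / z0)%C z0).
  { apply cont_div; [apply cont_id|apply cont_const|auto]. }
  assert (E1 : (z0 / z0)%C = RtoC 1) by (field; auto).
  assert (CA : continuous (fun w : C => Carg (w / z0)%C) z0).
  { apply (continuous_comp (fun w => w / z0)%C Carg); auto. cbv beta. rewrite E1. apply cont_Carg_1. }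
  assert (A1 : Carg (z0 / z0)%C = 0).
  { rewrite E1. pose proof (f_equal Im Clog_1) as H. exact H. }
  set (d := Rmin (PI - Carg z0) (Carg z0 + PI)).
  assert (Hd : 0 < d) by (apply Rmin_pos; lra).
  assert (L : locally z0 (fun w : C => Rabs (Carg (w / z0)%C) < d)).
  { assert (B : locally (Carg (z0 / z0)%C) (fun y => Rabs y < d)).
    { rewrite A1. exists (mkposreal d Hd). intros y Hy. change (Rabs (y - 0) < d) in Hy. now rewrite Rminus_0_r in Hy. }
    exact (CA _ B). }
  generalize (filter_and _ _ L (cont_neq0 (U := C_UniformSpace) (fun w => w) z0 (cont_id _) Hz0)).
  apply filter_imp. refine (fun (w : C) => _). intros [B Hw].
  assert (Hq : (w / z0)%C <> RtoC 0).
  { intros E. apply Hw. replace w with (w / z0 * z0)%C by (field; auto). rewrite E. ring. }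
  rewrite <- (Clog_Cexp (Clog z0 + Clog (w / z0))%C).
  - rewrite Cexp_plus, !Cexp_Clog by auto. f_equal. field; auto.
  - change (Im (Clog z0 + Clog (w / z0))%C) with (Carg z0 + Carg (w / z0)%C).
    apply Rabs_lt_between in B. pose proof (Rmin_l (PI - Carg z0) (Carg z0 + PI)).
    pose proof (Rmin_r (PI - Carg z0) (Carg z0 + PI)). fold d in H, H0. lra.
Qed.

Lemma cder_Clog z0 : slit z0 -> cder Clog z0 (/ z0)%C.
Proof.
  intros Hs. pose proof (slit_neq0 z0 Hs) as Hz0.
  assert (D : cder (fun w => Clog z0 + Clog (/ z0 * w))%C z0 (RtoC 0 + RtoC 1 * (/ z0 * RtoC 1))%C).
  { apply (cara_deriv_add (U := C_UniformSpace) (fun w => w) (fun _ => Clog z0) (fun w => Clog (/ z0 * w)%C)); [apply cara_deriv_const|].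
    apply (cder_comp Clog (fun w => (/ z0 * w)%C)); [ |].
    - replace (/ z0 * z0)%C with (RtoC 1) by (field; auto). apply cder_Clog_1.
    - apply (cder_cmul (/ z0)%C (fun w => w)); [].
      apply cder_id. }
  replace (0 + 1 * (/ z0 * 1))%C with (/ z0)%C in D by ring.
  revert D. apply (cara_deriv_ext_loc (U := C_UniformSpace)).
  generalize (Clog_quotient_near z0 Hs). apply filter_imp. intros w ->. do 2 f_equal. unfold Cdiv. ring.
Qed.

Lemma cder_Cpower s z : slit z -> cder (fun w => Cpower w s) z (RtoC s * Cpower z s / z)%C.
Proof.
  intros Hs. pose proof (slit_neq0 z Hs) as Hz.
  assert (D : cder (fun w => Cexp (RtoC s * Clog w))%C z (Cexp (RtoC s * Clog z) * (RtoC s * / z))%C).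
  { apply (cder_comp Cexp (fun w => (RtoC s * Clog w)%C)); [apply cder_Cexp|].
    apply (cder_cmul (RtoC s) Clog); []. now apply cder_Clog. }
  rewrite Cpower_Cexp. replace (RtoC s * Cexp (RtoC s * Clog z) / z)%C with (Cexp (RtoC s * Clog z) * (RtoC s * / z))%C
    by (field; auto).
  revert D. apply (cara_deriv_ext_loc (U := C_UniformSpace)). apply filter_forall. intros w. now rewrite Cpower_Cexp.
Qed.

Lemma cont_Cpower s z : slit z -> continuous (fun w => Cpower w s) z.
Proof. intros H. exact (cder_cont _ _ _ (cder_Cpower s z H)). Qed.

Lemma holo_Cpower R0 A s : holo R0 A -> (forall z, Cmod z < R0 -> 0 < Re (A z)) ->
  holo R0 (fun z => Cpower (A z) s).
Proof.
  intros [A' HA] HR. exists (fun z => RtoC s * Cpower (A z) s / A z * A' z)%C.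
  intros z Hz. destruct (HA z Hz) as [D Cc]. pose proof (Re_pos_slit _ (HR z Hz)) as Hs.
  pose proof (cder_cont _ _ _ D) as CA. split.
  - apply (cder_comp (fun w => Cpower w s) A); [ |exact D].
    now apply cder_Cpower.
  - apply cont_mul; auto. apply cont_div; [|auto|now apply slit_neq0].
    apply cont_mul; [apply cont_const|]. apply (continuous_comp A (fun w => Cpower w s)); auto.
    now apply cont_Cpower.
Qed.

Lemma Cpower_1_l s : Cpower (RtoC 1) s = RtoC 1.
Proof. rewrite Cpower_Cexp, Clog_1, Cmult_0_r. apply Cexp_0. Qed.

Lemma Cpower_root z k : z <> RtoC 0 -> k <> O -> (Cpower z (/ INR k) ^ k)%C = z.
Proof.
  intros Hz Hk. rewrite Cpower_Cexp, Cexp_pow, Cmult_assoc, <- RtoC_mult, Rinv_r, Cmult_1_l.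
  - now apply Cexp_Clog.
  - now apply not_0_INR.
Qed.

(** The bound keeps the argument of the inner power in the principal range. *)
Lemma Cpower_Cpower_inv z s : z <> RtoC 0 -> s <> 0 -> - PI < / s * Carg z <= PI ->
  Cpower (Cpower z (/ s)) s = z.
Proof.
  intros Hz Hs H. rewrite (Cpower_Cexp (Cpower z (/ s))), (Cpower_Cexp z), Clog_Cexp.
  - rewrite Cmult_assoc, <- RtoC_mult, Rinv_r, Cmult_1_l by auto. now apply Cexp_Clog.
  - unfold Clog, Im; simpl. rewrite Rmult_0_l, Rplus_0_r. exact H.
Qed.

(** The function x -> ln (cos (s x)) - s ln (cos x) vanishes at 0 and has the
    derivative s (tan x - tan (s x)) >= 0. *)
Lemma cos_power_le s t : 0 < s <= 1 -> 0 <= t < PI / 2 -> Rpower (cos t) s <= cos (s * t).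
Proof.
  intros Hs Ht.
  assert (Cp : forall x, 0 <= x <= t -> 0 < cos x /\ 0 < cos (s * x)).
  { intros x Hx. split; apply cos_gt_0; nra. }
  set (h := fun x => ln (cos (s * x)) - s * ln (cos x)).
  assert (D : forall x, 0 <= x <= t -> is_derive h x (s * (tan x - tan (s * x)))).
  { intros x Hx. destruct (Cp x Hx). unfold h. auto_derive; [auto|]. unfold tan. field. lra. }
  destruct (Req_EM_T t 0) as [->|Hn].
  { rewrite Rmult_0_r, cos_0. unfold Rpower. rewrite ln_1, Rmult_0_r, exp_0. lra. }
  destruct (MVT_gen h 0 t (fun x => s * (tan x - tan (s * x)))) as [c [Hc E]].
  - rewrite Rmin_left, Rmax_right by lra. intros; apply D; lra.
  - rewrite Rmin_left, Rmax_right by lra. intros x Hx. apply continuity_pt_filterlim.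
    apply (ex_derive_continuous h). eexists; now apply D.
  - rewrite Rmin_left, Rmax_right in Hc by lra.
    assert (Ht2 : tan (s * c) <= tan c).
    { destruct (Rle_lt_or_eq_dec (s * c) c) as [L|L]; [nra| |rewrite L; lra].
      left. apply tan_increasing; nra. }
    unfold h in E. rewrite Rmult_0_r, cos_0, ln_1, Rmult_0_r, Rminus_0_r, Rminus_0_r, Rminus_0_r in E.
    assert (0 <= s * (tan c - tan (s * c)) * t) by (apply Rmult_le_pos; [apply Rmult_le_pos|]; lra).
    destruct (Cp t ltac:(lra)) as [P1 P2].
    rewrite <- (exp_ln (cos (s * t))) by auto. unfold Rpower.
    assert (G : s * ln (cos t) <= ln (cos (s * t))) by lra.
    destruct G as [G|G]; [left; now apply exp_increasing | right; now rewrite G].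
Qed.

(** With A = m e^{it}: m^s cos (s t) >= (m cos t)^s > (1/2)^s >= 1/2. *)
Lemma Cpower_Re_half A s : 0 < s <= 1 -> 1 / 2 < Re A -> 1 / 2 < Re (Cpower A s).
Proof.
  intros Hs HA. destruct (Carg_Re_pos A ltac:(lra)) as [Hb _].
  pose proof (slit_neq0 A (Re_pos_slit A ltac:(lra))) as HN.
  destruct (Carg_polar A HN) as [E _]. pose proof (proj1 (Cmod_gt_0 _) HN) as Hm.
  set (t := Carg A) in *. set (m := Cmod A) in *.
  assert (ER : Re A = m * cos t) by (rewrite E; unfold cis, Re; simpl; ring).
  unfold Cpower, Re; simpl. fold t m.
  assert (Hc : 0 < cos t) by (apply cos_gt_0; lra).
  assert (K : Rpower (cos t) s <= cos (s * t)).
  { destruct (Rle_or_lt 0 t).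
    - apply cos_power_le; lra.
    - rewrite <- (cos_neg t), <- (cos_neg (s * t)). replace (- (s * t)) with (s * - t) by ring.
      apply cos_power_le; lra. }
  apply Rlt_le_trans with (Rpower m s * Rpower (cos t) s).
  - rewrite Rpower_mult_distr by auto. rewrite <- ER.
    apply Rle_lt_trans with (Rpower (1 / 2) s).
    + rewrite <- (Rpower_1 (1 / 2)) at 1 by lra. unfold Rpower.
      assert (ln (1 / 2) < 0) by (rewrite <- ln_1; apply ln_increasing; lra).
      assert (G : 1 * ln (1 / 2) <= s * ln (1 / 2)) by nra.
      destruct G as [G|G]; [left; now apply exp_increasing | right; now rewrite G].
    + unfold Rpower. apply exp_increasing. apply Rmult_lt_compat_l; [lra|]. apply ln_increasing; lra.
  - apply Rmult_le_compat_l; auto. unfold Rpower. apply Rlt_le, exp_pos.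
Qed.

(** * Operations on holomorphic functions *)

Lemma holo_const R0 c : holo R0 (fun _ => c).
Proof. exists (fun _ => RtoC 0). intros z _. split; [apply cara_deriv_const|apply cont_const]. Qed.

Lemma holo_id R0 : holo R0 (fun z => z).
Proof.
  exists (fun _ => RtoC 1). intros z _. split; [|apply cont_const].
  apply cder_id.
Qed.

Lemma holo_add R0 F G : holo R0 F -> holo R0 G -> holo R0 (fun z => F z + G z)%C.
Proof.
  intros [F' HF] [G' HG]. exists (fun z => F' z + G' z)%C. intros z Hz.
  destruct (HF z Hz), (HG z Hz). split; [now apply cara_deriv_add|now apply cont_add].
Qed.

Lemma holo_mul R0 F G : holo R0 F -> holo R0 G -> holo R0 (fun z => F z * G z)%C.
Proof.
  intros [F' HF] [G' HG]. exists (fun z => F' z * G z + F z * G' z)%C. intros z Hz.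
  destruct (HF z Hz) as [D1 C1], (HG z Hz) as [D2 C2]. split.
  - apply cder_mul; auto.
  - pose proof (cder_cont _ _ _ D1). pose proof (cder_cont _ _ _ D2).
    apply cont_add; apply cont_mul; auto.
Qed.

Lemma holo_sub R0 F G : holo R0 F -> holo R0 G -> holo R0 (fun z => F z - G z)%C.
Proof.
  intros [F' HF] [G' HG]. exists (fun z => F' z - G' z)%C. intros z Hz.
  destruct (HF z Hz), (HG z Hz). split; [|now apply cont_sub].
  apply cder_sub; auto.
Qed.

Lemma holo_inv R0 F : holo R0 F -> (forall z, Cmod z < R0 -> F z <> RtoC 0) -> holo R0 (fun z => / F z)%C.
Proof.
  intros [F' HF] HN. exists (fun z => - F' z / (F z * F z))%C. intros z Hz.
  destruct (HF z Hz) as [D1 C1]. pose proof (cder_cont _ _ _ D1). split.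
  - apply cara_deriv_inv; auto. apply cont_id.
  - apply cont_div; [now apply cont_opp|now apply cont_mul|apply Cmult_neq_0; auto].
Qed.

Lemma holo_div R0 F G : holo R0 F -> holo R0 G -> (forall z, Cmod z < R0 -> G z <> RtoC 0) ->
  holo R0 (fun z => F z / G z)%C.
Proof. intros. apply holo_mul; auto. now apply holo_inv. Qed.

Lemma cder_translate F c u l : cder F (c + u)%C l -> cder (fun w => F (c + w)%C) u l.
Proof.
  intros H. replace l with (l * (RtoC 0 + RtoC 1))%C by ring.
  apply (cder_comp F (fun w => (c + w)%C)); [exact H|].
  apply cara_deriv_add; [apply cara_deriv_const|]. apply cder_id.
Qed.

Lemma holo_translate R0 F c : holo R0 F -> holo (R0 - Cmod c) (fun u => F (c + u)%C).
Proof.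
  intros [F' HF]. exists (fun u => F' (c + u)%C). intros u Hu.
  assert (H : Cmod (c + u)%C < R0) by (eapply Rle_lt_trans; [apply Cmod_triangle|lra]).
  destruct (HF _ H) as [D Cc]. split; [now apply cder_translate|].
  apply (continuous_comp (fun u => c + u)%C F'); auto. apply cont_add; [apply cont_const|apply cont_id].
Qed.

(** * Local surjectivity and univalent functions *)

(** If [w] near [T 0] were omitted, 1/(T - w) would be holomorphic, small on a
    circle where T - T 0 grows linearly, and large at its centre, against the
    maximum principle. *)
Lemma local_surjectivity rho T l : 0 < rho -> holo rho T -> cder T (RtoC 0) l -> l <> RtoC 0 ->
  forall eps, 0 < eps <= rho ->
  exists d, 0 < d /\ forall w, Cmod (w - T (RtoC 0))%C < d -> exists u, Cmod u < eps /\ T u = w.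
Proof.
  intros Hrho HT [p [Cp [Ep Hp]]] Hl eps Heps. pose proof (proj1 (Cmod_gt_0 _) Hl) as Hlp.
  set (m := Cmod l / 2). assert (Hm : 0 < m) by (unfold m; lra).
  assert (Lp : locally (RtoC 0) (fun w : C => Cmod (p w - p (RtoC 0))%C < m)) by exact (proj1 (cont_eps _ _) Cp m Hm).
  destruct (locally_Cmod_ex _ _ (filter_and _ _ Hp Lp)) as [d0 [Hd0 Hd0']].
  set (r1 := Rmin d0 eps). assert (Hr1 : 0 < r1) by (apply Rmin_pos; lra).
  assert (Hr1d : r1 <= d0) by apply Rmin_l. assert (Hr1e : r1 <= eps) by apply Rmin_r.
  assert (Grow : forall u, Cmod u < r1 -> m * Cmod u <= Cmod (T u - T (RtoC 0))%C).
  { intros u Hu. destruct (Hd0' u) as [A B].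
    - replace (u - 0)%C with u by ring. lra.
    - rewrite A. replace (u - 0)%C with u by ring. rewrite Cmod_mult.
      apply Rmult_le_compat_r; [apply Cmod_ge_0|]. rewrite Ep in B.
      pose proof (Cmod_tri_rev l (p u - l)%C) as T0. replace (l + (p u - l))%C with (p u) in T0 by ring.
      unfold m in *. lra. }
  (* at radius r1 / 2 the modulus of T - w is at least 3 m r1 / 8, at the centre below m r1 / 8 *)
  exists (m * r1 / 8). split; [nra|]. intros w Hw.
  apply NNPP. intros Hno.
  assert (HN : forall u, Cmod u < r1 -> (T u - w)%C <> RtoC 0).
  { intros u Hu E. apply Hno. exists u. split; [lra|]. replace (T u) with (T u - w + w)%C by ring. rewrite E. ring. }
  assert (HF : holo r1 (fun u => / (T u - w))%C).
  { apply holo_inv; auto. apply holo_sub; [|apply holo_const]. apply (holo_weaken rho); auto; lra. }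
  assert (P0 : 0 < m * r1) by nra.
  pose proof (max_modulus r1 _ (r1 / 2) (8 / (3 * (m * r1))) (RtoC 0) HF ltac:(lra) ltac:(rewrite Cmod_0; lra)) as MM.
  cbv beta in MM.
  assert (N0 : (T (RtoC 0) - w)%C <> RtoC 0) by (apply HN; rewrite Cmod_0; lra).
  rewrite Cmod_inv, Cmod_sub_sym in MM by auto.
  assert (K : / Cmod (w - T (RtoC 0))%C <= 8 / (3 * (m * r1))).
  { apply MM. intros u Hu. rewrite Cmod_inv by (apply HN; lra).
    pose proof (Grow u ltac:(lra)) as G. rewrite Hu in G.
    pose proof (Cmod_tri_rev (T u - T (RtoC 0))%C (- (w - T (RtoC 0)))%C) as T0.
    rewrite Cmod_opp in T0. replace (T u - T 0 + - (w - T 0))%C with (T u - w)%C in T0 by ring.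
    replace (8 / (3 * (m * r1))) with (/ (3 * (m * r1) / 8)) by (field; lra).
    apply Rinv_le_contravar; lra. }
  assert (Hp2 : 0 < Cmod (w - T (RtoC 0))%C) by (rewrite Cmod_sub_sym; now apply Cmod_gt_0).
  assert (8 / (m * r1) < / Cmod (w - T (RtoC 0))%C).
  { replace (8 / (m * r1)) with (/ (m * r1 / 8)) by (field; lra). apply Rinv_lt_contravar; [nra|auto]. }
  assert (8 / (3 * (m * r1)) < 8 / (m * r1)).
  { unfold Rdiv. apply Rmult_lt_compat_l; [lra|]. apply Rinv_lt_contravar; nra. }
  lra.
Qed.

(** Splits off a zero of order at least [k] at the origin. *)
Lemma expands_factor a R0 F k : expands a R0 F -> (forall j, (j < k)%nat -> a j = RtoC 0) ->
  exists H, expands (fun j => a (k + j)%nat) R0 H /\ forall z, Cmod z < R0 -> F z = (z ^ k * H z)%C.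
Proof.
  intros HF. induction k; intros Hz.
  - exists F. split; [exact HF|]. intros z _. simpl. ring.
  - destruct IHk as [H [HH E]]; [intros; apply Hz; lia|].
    pose proof (expands_shift _ _ _ HH) as HS.
    exists (pseries_value (fun j => a (k + S j)%nat)). split.
    + intros z Hz'. apply (pseries_ext (fun j => a (k + S j)%nat)); [|now apply HS].
      intros j. f_equal. lia.
    + intros z Hz'. rewrite E by auto.
      pose proof (pseries_unshift (fun j => a (k + j)%nat) z _ (HS z Hz')) as U.
      rewrite (pseries_unique _ _ _ _ (HH z Hz') U), Nat.add_0_r, Hz by lia. simpl. ring.
Qed.

Lemma least_nat (P : nat -> Prop) : (exists n, P n) -> exists n, P n /\ forall j, (j < n)%nat -> ~ P j.
Proof.
  intros [n Hn]. revert Hn. induction n as [n IH] using lt_wf_ind. intros Hn.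
  destruct (classic (exists j, (j < n)%nat /\ P j)) as [[j [Hj HPj]]|H].
  - now apply (IH j).
  - exists n. split; auto. intros j Hj HPj. apply H. eauto.
Qed.

Lemma pseries_zero z : cpseries (fun _ => RtoC 0) z (RtoC 0).
Proof.
  pose proof (pseries_single (fun _ => RtoC 0) O z (fun _ _ => eq_refl)) as H. simpl in H.
  now rewrite Cmult_0_l in H.
Qed.

Lemma root_of_unity_neq1 k : (2 <= k)%nat -> cis (2 * PI / INR k) <> RtoC 1.
Proof.
  intros Hk E. apply (f_equal Re) in E. unfold cis, Re in E; simpl in E.
  assert (Hn : 2 <= INR k) by (apply (le_INR 2); auto). pose proof PI_RGT_0.
  assert (0 < 2 * PI / INR k) by (apply Rdiv_lt_0_compat; lra).
  assert (2 * PI / INR k <= PI).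
  { apply Rmult_le_reg_r with (INR k); [lra|]. unfold Rdiv. rewrite Rmult_assoc, Rinv_l by lra. nra. }
  pose proof (cos_decreasing_1 0 (2 * PI / INR k)) as D. rewrite cos_0 in D. lra.
Qed.

Lemma root_of_unity_pow k : k <> O -> (cis (2 * PI / INR k) ^ k)%C = RtoC 1.
Proof.
  intros Hk. rewrite cis_pow. replace (INR k * (2 * PI / INR k)) with (2 * PI); [apply cis_2PI|].
  field. now apply not_0_INR.
Qed.

(** At a zero of the derivative g - g(c) would be a k-th power, k >= 2, of a
    locally surjective function T; a small value and its product with a k-th
    root of unity are both attained by T, and g takes the same value at the two
    points. *)
Lemma univalent_deriv_neq0 g c l : holo 1 g -> univalent g -> Cmod c < 1 -> cder g c l -> l <> RtoC 0.
Proof.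
  intros Hg Hu Hc Hl E0. subst l. pose proof (Cmod_ge_0 c) as Hc0.
  set (rho := 1 - Cmod c). assert (Hrho : 0 < rho) by (unfold rho; lra).
  set (G := fun u => (g (c + u) - g c)%C).
  assert (HG : holo rho G).
  { unfold G. apply holo_sub; [|apply holo_const]. now apply holo_translate. }
  destruct (taylor rho G Hrho HG) as [a Ha].
  assert (In : forall u, Cmod u < rho -> in_disc (c + u)%C).
  { intros u Hu'. unfold in_disc. eapply Rle_lt_trans; [apply Cmod_triangle|unfold rho in Hu'; lra]. }
  assert (Inj : forall u v, Cmod u < rho -> Cmod v < rho -> G u = G v -> u = v).
  { intros u v Hu' Hv E. assert (E1 : g (c + u)%C = g (c + v)%C).
    { unfold G in E. replace (g (c + u)%C) with (g (c + u) - g c + g c)%C by ring. rewrite E. ring. }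
    apply Hu in E1; auto. replace u with (c + u - c)%C by ring. rewrite E1. ring. }
  assert (Z0 : Cmod (RtoC 0) < rho) by (rewrite Cmod_0; auto).
  assert (a0 : a O = RtoC 0).
  { rewrite <- (expands_value_0 a rho G Hrho Ha). unfold G. rewrite Cplus_0_r. ring. }
  assert (a1 : a 1%nat = RtoC 0).
  { pose proof (expands_cder a rho G (RtoC 0) Ha Z0) as D1.
    assert (D2 : cder G (RtoC 0) (RtoC 0 - RtoC 0)%C).
    { apply cder_sub; [ |apply cara_deriv_const].
      apply (cder_translate g c (RtoC 0)). now rewrite Cplus_0_r. }
    pose proof (cder_unique _ _ _ _ D1 D2) as E. rewrite (pseries_value_correct _ _ _ (pseries_at0 _)) in E.
    unfold deriv_coef in E. simpl in E. rewrite Cmult_1_l in E. rewrite E. ring. }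
  destruct (classic (exists k, a k <> RtoC 0)) as [Hex|Hall].
  2:{ assert (ZZ : forall u, Cmod u < rho -> G u = RtoC 0).
      { intros u Hu'. apply (pseries_unique a u); [now apply Ha|].
        apply (pseries_ext (fun _ => RtoC 0)); [|apply pseries_zero].
        intros k. apply NNPP. intros N. apply Hall. exists k. auto. }
      assert (Hh : Cmod (RtoC (rho / 2)) < rho) by (rewrite Cmod_R, Rabs_pos_eq; lra).
      assert (E : RtoC (rho / 2) = RtoC 0) by (apply Inj; auto; rewrite !ZZ; auto).
      apply (f_equal Re) in E. unfold Re in E; simpl in E. lra. }
  destruct (least_nat _ Hex) as [k [Hk Hmin]].
  assert (Hk2 : (2 <= k)%nat).
  { destruct k as [|[|k]]; [contradiction|contradiction|lia]. }
  destruct (expands_factor a rho G k Ha) as [H [HH EG]].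
  { intros j Hj. apply NNPP. intros N. now apply (Hmin j Hj). }
  assert (H0 : H (RtoC 0) = a k).
  { rewrite (expands_value_0 _ rho H Hrho HH). now rewrite Nat.add_0_r. }
  set (B := fun u => (/ a k * H u)%C).
  assert (HB : holo rho B) by (apply holo_cmul; apply (expands_holo _ _ _ HH)).
  assert (B0 : B (RtoC 0) = RtoC 1) by (unfold B; rewrite H0; field; auto).
  destruct (locally_Cmod_ex _ _ (cont_Re_gt B (RtoC 0) 0 (holo_cont _ _ _ HB Z0) ltac:(rewrite B0; unfold Re; simpl; lra)))
    as [d [Hd Hd']].
  set (r1 := Rmin d rho). assert (Hr1 : 0 < r1) by (apply Rmin_pos; auto).
  assert (r1 <= d /\ r1 <= rho) as [Hr1d Hr1r] by (split; [apply Rmin_l|apply Rmin_r]).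
  assert (HRB : forall u, Cmod u < r1 -> 0 < Re (B u)).
  { intros u Hu'. apply Hd'. replace (u - 0)%C with u by ring. lra. }
  (* the k-th root of (g (c + u) - g c) / a k *)
  set (T := fun u => (u * Cpower (B u) (/ INR k))%C).
  assert (HT : holo r1 T).
  { apply holo_mul; [apply holo_id|]. apply holo_Cpower; auto. apply (holo_weaken rho); auto. }
  assert (DT : cder T (RtoC 0) (RtoC 1)).
  { exists (fun u => Cpower (B u) (/ INR k)). split; [|split].
    - apply (holo_cont r1 (fun u => Cpower (B u) (/ INR k))); [|rewrite Cmod_0; auto].
      apply holo_Cpower; auto. apply (holo_weaken rho); auto.
    - rewrite B0. apply Cpower_1_l.
    - apply filter_forall. refine (fun (u : C) => _). unfold T. ring. }
  assert (T0 : T (RtoC 0) = RtoC 0) by (unfold T; ring).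
  assert (N1 : RtoC 1 <> RtoC 0) by (apply Cneq_of_Re; simpl; lra).
  destruct (local_surjectivity r1 T (RtoC 1) Hr1 HT DT N1 r1 ltac:(lra)) as [e [He HS]].
  assert (Hpow : forall u, Cmod u < r1 -> G u = (a k * T u ^ k)%C).
  { intros u Hu'. rewrite EG by lra. unfold T. rewrite Cpow_mult_l, Cpower_root.
    - unfold B. field. auto.
    - apply Cneq_of_Re. pose proof (HRB u Hu'). lra.
    - lia. }
  rewrite T0 in HS.
  assert (Me : Cmod (RtoC (e / 2)) = e / 2) by (rewrite Cmod_R, Rabs_pos_eq; lra).
  (* two values with the same k-th power, both within the surjectivity radius *)
  destruct (HS (RtoC (e / 2))) as [u1 [Hu1 E1]].
  { replace (RtoC (e / 2) - 0)%C with (RtoC (e / 2)) by ring. lra. }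
  destruct (HS (RtoC (e / 2) * cis (2 * PI / INR k))%C) as [u2 [Hu2 E2]].
  { replace (RtoC (e / 2) * cis (2 * PI / INR k) - 0)%C with (RtoC (e / 2) * cis (2 * PI / INR k))%C by ring.
    rewrite Cmod_mult, Cmod_cis. lra. }
  assert (E12 : u1 = u2).
  { apply Inj; try lra. rewrite !Hpow by auto. rewrite E1, E2, Cpow_mult_l, root_of_unity_pow by lia. ring. }
  rewrite E12, E2 in E1. apply (root_of_unity_neq1 k Hk2).
  assert (Ne : RtoC (e / 2) <> RtoC 0) by (apply Cmod_gt_0; lra).
  replace (cis (2 * PI / INR k)) with (RtoC (e / 2) * cis (2 * PI / INR k) / RtoC (e / 2))%C by (field; auto).
  rewrite E1. field. auto.
Qed.

(** Local surjectivity makes the set-theoretic inverse continuous, and then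
    [cder_inverse] applies.  Only the behaviour of [psi] on the image of g is
    specified. *)
Lemma univalent_inverse g g' : holo 1 g -> univalent g ->
  (forall z, Cmod z < 1 -> cder g z (g' z)) ->
  exists psi : C -> C, forall z, Cmod z < 1 -> psi (g z) = z /\ cder psi (g z) (/ g' z)%C.
Proof.
  intros Hg Hu Hd.
  set (psi := fun w : C => epsilon (inhabits (RtoC 0)) (fun u => Cmod u < 1 /\ g u = w)).
  assert (Hpsi : forall z, Cmod z < 1 -> psi (g z) = z).
  { intros z Hz. assert (S : Cmod (psi (g z)) < 1 /\ g (psi (g z)) = g z).
    { unfold psi. apply epsilon_spec. exists z; auto. }
    destruct S as [S1 S2]. apply Hu; auto. }
  exists psi. intros z Hz. split; auto. pose proof (Cmod_ge_0 z).
  pose proof (univalent_deriv_neq0 g z _ Hg Hu Hz (Hd z Hz)) as HN.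
  assert (LS : forall eps, 0 < eps <= 1 - Cmod z -> exists d, 0 < d /\
    forall w, Cmod (w - g z)%C < d -> exists u, Cmod u < eps /\ g (z + u)%C = w).
  { intros eps He.
    assert (D0 : cder (fun u => g (z + u)%C) (RtoC 0) (g' z)).
    { apply cder_translate. rewrite Cplus_0_r. auto. }
    pose proof (local_surjectivity (1 - Cmod z) (fun u => g (z + u)%C) (g' z) ltac:(lra)
       (holo_translate _ _ _ Hg) D0 HN eps He) as L. cbv beta in L. rewrite Cplus_0_r in L. exact L. }
  assert (In : forall u, Cmod u < 1 - Cmod z -> Cmod (z + u)%C < 1).
  { intros u Hu'. eapply Rle_lt_trans; [apply Cmod_triangle|lra]. }
  apply (cder_inverse g psi).
  - apply cont_eps. intros eps He. rewrite Hpsi by auto.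
    set (e := Rmin eps (1 - Cmod z)).
    assert (He' : 0 < e <= 1 - Cmod z) by (split; [apply Rmin_pos; lra|apply Rmin_r]).
    assert (e <= eps) by apply Rmin_l.
    destruct (LS e He') as [d [Hd0 Hd1]].
    generalize (locally_Cmod (g z) d Hd0). apply filter_imp. intros w Hw.
    destruct (Hd1 w Hw) as [u [Hu1 Hu2]]. rewrite <- Hu2, Hpsi by (apply In; lra).
    replace (z + u - z)%C with u by ring. lra.
  - rewrite Hpsi by auto. auto.
  - exact HN.
  - destruct (LS (1 - Cmod z) ltac:(lra)) as [d [Hd0 Hd1]].
    generalize (locally_Cmod (g z) d Hd0). apply filter_imp. intros w Hw.
    destruct (Hd1 w Hw) as [u [Hu1 Hu2]]. rewrite <- Hu2, Hpsi by (apply In; lra). reflexivity.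
Qed.

(** * Schwarz lemma and subordination *)

(** Lets the radius tend to 1. *)
Lemma le_of_factor (x y : R) (s : R) : s < 1 -> (forall r, s < r < 1 -> x * r <= y) -> x <= y.
Proof.
  intros Hs H. apply le_of_le_plus_eps. intros eps He.
  set (r := Rmax ((s + 1) / 2) (1 - eps / (2 * (Rabs x + 1)))).
  pose proof (Rabs_pos x). pose proof (Rle_abs x).
  assert (He2 : 0 < eps / (2 * (Rabs x + 1))) by (apply Rdiv_lt_0_compat; lra).
  assert (Hr : s < r < 1).
  { split; [apply Rlt_le_trans with ((s + 1) / 2); [lra|apply Rmax_l]|]. apply Rmax_lub_lt; lra. }
  assert (Hr2 : 1 - r <= eps / (2 * (Rabs x + 1))).
  { pose proof (Rmax_r ((s + 1) / 2) (1 - eps / (2 * (Rabs x + 1)))). fold r in H2. lra. }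
  specialize (H r Hr).
  assert (x * (1 - r) <= eps).
  { apply Rle_trans with ((Rabs x + 1) * (eps / (2 * (Rabs x + 1)))).
    - apply Rle_trans with ((Rabs x + 1) * (1 - r)); [apply Rmult_le_compat_r; lra|].
      apply Rmult_le_compat_l; lra.
    - replace ((Rabs x + 1) * (eps / (2 * (Rabs x + 1)))) with (eps / 2) by (field; lra). lra. }
  lra.
Qed.

(** Maximum principle for h(z)/z on circles of radius tending to 1. *)
Lemma schwarz h z : holo 1 h -> h (RtoC 0) = RtoC 0 -> (forall u, Cmod u < 1 -> Cmod (h u) < 1) ->
  Cmod z < 1 -> Cmod (h z) <= Cmod z.
Proof.
  intros Hh H0 HB Hz. destruct (taylor 1 h ltac:(lra) Hh) as [a Ha].
  destruct (expands_factor a 1 h 1 Ha) as [v [Hv Ev]].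
  { intros j Hj. replace j with O by lia. rewrite <- (expands_value_0 a 1 h ltac:(lra) Ha). exact H0. }
  rewrite Ev by auto. simpl. rewrite Cmult_1_r, Cmod_mult.
  assert (Cmod (v z) <= 1).
  { apply (le_of_factor _ _ (Cmod z) Hz). intros r Hr. pose proof (Cmod_ge_0 z).
    assert (Cmod (v z) <= / r).
    { apply (max_modulus 1 v r); try lra; [apply (expands_holo _ _ _ Hv)|].
      intros w Hw. pose proof (HB w ltac:(lra)) as B. rewrite Ev in B by lra.
      simpl in B. rewrite Cmult_1_r, Cmod_mult, Hw in B.
      apply Rmult_le_reg_l with r; [lra|]. rewrite Rinv_r by lra. lra. }
    apply Rle_trans with (/ r * r); [apply Rmult_le_compat_r; lra|]. rewrite Rinv_l; lra. }
  pose proof (Cmod_ge_0 z). nra.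
Qed.

(** Lindeloef's principle: the lift of P through the univalent g is a self-map of
    the disc fixing 0. *)
Lemma subordination g g' psi P :
  (forall z, Cmod z < 1 -> cder g z (g' z) /\ continuous g' z) -> univalent g ->
  (forall z, Cmod z < 1 -> psi (g z) = z /\ cder psi (g z) (/ g' z)%C) ->
  holo 1 P -> P (RtoC 0) = g (RtoC 0) ->
  (forall z, Cmod z < 1 -> exists u, Cmod u < 1 /\ g u = P z) ->
  forall z, Cmod z < 1 -> Cmod (psi (P z)) <= Cmod z.
Proof.
  intros Hg Hu Hpsi [P' HP] P0 Hsub z Hz.
  assert (Hholo : holo 1 g) by (exists g'; exact Hg).
  assert (Hin : forall z, Cmod z < 1 -> Cmod (psi (P z)) < 1 /\ cder psi (P z) (/ g' (psi (P z)))%C).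
  { intros w Hw. destruct (Hsub w Hw) as [u [Hu1 Hu2]]. destruct (Hpsi u Hu1) as [E D].
    rewrite <- Hu2, E. auto. }
  assert (HN : forall w, Cmod w < 1 -> g' w <> RtoC 0).
  { intros w Hw. apply (univalent_deriv_neq0 g w); auto. now apply Hg. }
  apply (schwarz (fun z => psi (P z))); auto.
  - exists (fun z => / g' (psi (P z)) * P' z)%C. intros w Hw. destruct (HP w Hw) as [DP CP].
    destruct (Hin w Hw) as [I1 I2].
    assert (D : cder (fun z => psi (P z)) w (/ g' (psi (P w)) * P' w)%C).
    { apply (cder_comp psi P); auto. }
    split; [exact D|]. apply cont_mul; auto. apply cont_inv; [|now apply HN].
    apply (continuous_comp (fun z => psi (P z)) g'); [apply (cder_cont _ _ _ D)|]. now apply Hg.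
  - rewrite P0. apply Hpsi. rewrite Cmod_0; lra.
  - intros u Hu'. now apply Hin.
Qed.

(** * First-order consequences of convexity *)

Lemma deriv_nonpos_right (f : R -> R) l : is_derive f 0 l -> (forall t, 0 <= t <= 1 -> f t <= f 0) -> l <= 0.
Proof.
  intros D H. destruct (caratheodory_of_is_derive f 0 l D) as [p [Cp [Ep Hp]]].
  destruct (Rle_or_lt l 0) as [L|L]; auto. exfalso.
  assert (B : locally 0 (fun s => Rabs (p s - p 0) < l)).
  { apply (Cp (fun y => Rabs (y - p 0) < l)). exists (mkposreal l L). intros y Hy. exact Hy. }
  destruct B as [d Hd].
  set (t := Rmin (d / 2) 1). assert (Ht : 0 < t <= 1).
  { split; [apply Rmin_pos; [pose proof (cond_pos d)|]; lra|apply Rmin_r]. }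
  assert (Ht2 : t <= d / 2) by apply Rmin_l.
  assert (Bt : Rabs (p t - p 0) < l).
  { apply Hd. change (Rabs (t - 0) < d). rewrite Rminus_0_r, Rabs_pos_eq by lra. pose proof (cond_pos d). lra. }
  rewrite Ep in Bt. apply Rabs_lt_between in Bt.
  pose proof (H t ltac:(lra)). pose proof (Hp t). nra.
Qed.

Lemma rder_Re_mul (c : C) f t l : rder f t l -> is_derive (fun s => Re (c * f s)%C) t (Re (c * l)%C).
Proof.
  intros D. apply (rder_Re (fun s => (c * f s)%C)).
  apply rder_cmul; [exact D].
Qed.

Lemma Re_conj_mul_le (a b : C) r : Cmod a <= r -> Cmod b <= r -> Re (Cconj a * b)%C <= r * r.
Proof.
  intros Ha Hb. eapply Rle_trans; [apply Re_le_Cmod|]. rewrite Cmod_mult, Cmod_conj.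
  apply Rmult_le_compat; auto using Cmod_ge_0.
Qed.

Section Convex.
Variables (g : C -> C) (a : nat -> C).
Hypothesis a0 : a O = RtoC 0.
Hypothesis a1 : a 1%nat = RtoC 1.
Hypothesis Hg : expands a 1 g.
Hypothesis Hu : univalent g.
Hypothesis Hc : convex_image g.

Definition dmap : C -> C := pseries_value (deriv_coef a).

Lemma dmap_der z : Cmod z < 1 -> cder g z (dmap z) /\ continuous dmap z.
Proof.
  intros Hz. split; [now apply (expands_cder a 1)|]. apply (expands_cont (deriv_coef a) 1); auto. now apply (expands_deriv_coef a 1 g).
Qed.

Lemma map_holo : holo 1 g.
Proof. exists dmap. exact dmap_der. Qed.

Lemma dmap_neq0 z : Cmod z < 1 -> dmap z <> RtoC 0.
Proof. intros Hz. apply (univalent_deriv_neq0 g z); auto using map_holo. now apply dmap_der. Qed.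

Lemma map_0 : g (RtoC 0) = RtoC 0.
Proof. rewrite (expands_value_0 a 1 g); auto; lra. Qed.

(** The points h_t with g(h_t) = (1-t) g(z) + t g(xz) satisfy |h_t| <= |z| by
    subordination and start at z; the velocity at t = 0 therefore does not point
    out of the disc of radius |z|.  The factor conj z in place of 1/z avoids a
    singularity at 0. *)
Lemma convex_tangent z x : Cmod z < 1 -> Cmod x <= 1 ->
  0 <= Re (Cconj z * (g z - g (x * z)) / dmap z)%C.
Proof.
  intros Hz Hx.
  assert (Bx : forall w, Cmod w < 1 -> Cmod (x * w)%C < 1).
  { intros w Hw. rewrite Cmod_mult. pose proof (Cmod_ge_0 w). pose proof (Cmod_ge_0 x). nra. }
  destruct (univalent_inverse g dmap map_holo Hu (fun z Hz => proj1 (dmap_der z Hz))) as [psi Hpsi].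
  set (d := (g (x * z) - g z)%C).
  assert (Hxh : holo 1 (fun w => g (x * w)%C)).
  { exists (fun w => dmap (x * w) * x)%C. intros w Hw. destruct (dmap_der _ (Bx w Hw)) as [D1 D2]. split.
    - replace (dmap (x * w) * x)%C with (dmap (x * w) * (x * RtoC 1))%C by ring.
      apply (cder_comp g (fun w => (x * w)%C)); [exact D1|].
      apply cder_cmul; [apply cder_id].
    - apply cont_mul; [|apply cont_const]. apply (continuous_comp (fun w => x * w)%C dmap); auto.
      apply cont_mul; [apply cont_const|apply cont_id]. }
  assert (Bound : forall t, 0 <= t <= 1 -> Cmod (psi (g z + RtoC t * d)%C) <= Cmod z).
  { intros t Ht. replace (g z + RtoC t * d)%C with (RtoC (1 - t) * g z + RtoC t * g (x * z))%C
      by (unfold d; rewrite RtoC_minus; ring).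
    apply (subordination g dmap psi (fun w => RtoC (1 - t) * g w + RtoC t * g (x * w))%C); auto using dmap_der.
    - apply holo_add; apply holo_cmul; [apply map_holo|exact Hxh].
    - rewrite Cmult_0_r, map_0. ring.
    - intros w Hw. destruct (Hc w (x * w)%C t Hw (Bx w Hw) Ht) as [u [Hu1 Hu2]]. eauto. }
  destruct (Hpsi z Hz) as [P1 P2].
  assert (D : rder (fun t => psi (g z + RtoC t * d)%C) 0 (/ dmap z * d)%C).
  { apply (rder_comp psi (fun t => (g z + RtoC t * d)%C)); [ |].
    - replace (g z + RtoC 0 * d)%C with (g z) by ring. exact P2.
    - apply rder_affine. }
  pose proof (deriv_nonpos_right _ _ (rder_Re_mul (Cconj z) _ _ _ D)) as N. cbv beta in N.
  replace (g z + RtoC 0 * d)%C with (g z) in N by ring. rewrite P1 in N.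
  assert (M : Re (Cconj z * (/ dmap z * d))%C <= 0).
  { apply N. intros t Ht. replace (Re (Cconj z * z)%C) with (Cmod z * Cmod z).
    - apply Re_conj_mul_le; auto; lra.
    - rewrite Cconj_mul_self. unfold Re; simpl. ring. }
  replace (Cconj z * (g z - g (x * z)) / dmap z)%C with (- (Cconj z * (/ dmap z * d)))%C
    by (unfold d, Cdiv; ring).
  change (0 <= - Re (Cconj z * (/ dmap z * d))%C). lra.
Qed.

(** The nonnegative weight 1 + cos (t - s) has only the frequencies 0, 1 and -1,
    and averaging g(z cis t) against them leaves the linear term of g. *)
Lemma convex_first_coefficient z s : Cmod z < 1 ->
  0 <= Re (Cconj z * (g z - cis s * z / 2) / dmap z)%C.
Proof.
  intros Hz.
  set (Wt := fun t => (1 + RtoC (/ 2) * (cis (- s) * cis t + cis s * cis (- t)))%C).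
  assert (EW : forall t, Wt t = RtoC (1 + cos (t - s))).
  { intros t. unfold Wt. rewrite <- !cis_plus. replace (- s + t) with (t - s) by ring.
    replace (s + - t) with (- (t - s)) by ring. rewrite cis_opp_conj.
    apply C_ext_ReIm; unfold cis, Re, Im; simpl; field. }
  assert (CW : ccont Wt).
  { unfold Wt. apply ccont_add; [apply ccont_const|]. apply ccont_mul; [apply ccont_const|].
    apply ccont_add; apply ccont_mul; try apply ccont_const; [apply cis_cont|apply cis_opp_cont]. }
  pose proof (ccont_expands_circle a 1 g z cis Hg Hz cis_cont Cmod_cis) as CG.
  assert (E : cmean (fun t => Cconj z * (g z - g (z * cis t)) / dmap z * Wt t)%C =
     (Cconj z * (g z - cis s * z / 2) / dmap z)%C).
  { assert (I1 : cmean cis = RtoC 0).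
    { rewrite (cmean_ext _ (fun t => cis t ^ 1)%C) by (intros; simpl; ring). apply cmean_cis_pow; auto. }
    assert (I2 : cmean (fun t => cis (- t)) = RtoC 0).
    { rewrite (cmean_ext _ (fun t => cis (- t) ^ 1)%C) by (intros; simpl; ring). apply cmean_cis_opp_pow; auto. }
    assert (J0 : cmean (fun t => g (z * cis t)%C) = RtoC 0) by (rewrite (mean_value a 1 g z Hg Hz); auto).
    assert (J1 : cmean (fun t => g (z * cis t) * cis t)%C = RtoC 0).
    { rewrite (cmean_ext _ (fun t => g (z * cis t) * cis t ^ 1)%C) by (intros; simpl; ring).
      apply (fourier_neg a 1); auto. }
    assert (J2 : cmean (fun t => g (z * cis t) * cis (- t))%C = z).
    { rewrite (cmean_ext _ (fun t => g (z * cis t) * cis (- t) ^ 1)%C) by (intros; simpl; ring).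
      rewrite (fourier_nonneg a 1); auto. rewrite a1. simpl. ring. }
    set (c := (Cconj z / dmap z)%C).
    rewrite (cmean_ext _ (fun t => (c * g z) + ((c * g z * RtoC (/ 2) * cis (- s)) * cis t +
       ((c * g z * RtoC (/ 2) * cis s) * cis (- t) + (- c * g (z * cis t) +
        ((- c * RtoC (/ 2) * cis (- s)) * (g (z * cis t) * cis t) +
         (- c * RtoC (/ 2) * cis s) * (g (z * cis t) * cis (- t)))))))%C).
    2:{ intros t. unfold Wt, c, Cdiv. ring. }
    pose proof cis_cont as K1. pose proof cis_opp_cont as K2.
    pose proof ccont_const as K3.
    rewrite !cmean_plus, !cmean_scal, cmean_const, I1, I2, J0, J1, J2;
      
      repeat lazymatch goal with
      | |- ccont (fun _ => ?c) => apply (K3 c)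
      | |- ccont cis => exact K1
      | |- ccont (fun t => cis t) => exact K1
      | |- ccont (fun t => cis (- t)) => exact K2
      | |- ccont (fun t => g _) => exact CG
      | |- ccont (fun t => (@?p t + @?q t)%C) => apply (ccont_add p q)
      | |- ccont (fun t => (@?p t * @?q t)%C) => apply (ccont_mul p q)
      end.
    unfold c. replace (RtoC (/ 2)) with (/ RtoC 2)%C by (rewrite RtoC_inv; [reflexivity|lra]).
    field. now apply dmap_neq0. }
  rewrite <- E, <- (rmean_const 0). apply rmean_le.
  - intros t; apply continuous_const.
  - apply (ccont_Re (fun t => Cconj z * (g z - g (z * cis t)) / dmap z * Wt t)%C). apply ccont_mul; auto.
    unfold Cdiv. apply ccont_mul; [|apply ccont_const]. apply ccont_mul; [apply ccont_const|].
    apply ccont_sub; auto. apply ccont_const.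
  - intros t. rewrite EW, Re_mul_RtoC. apply Rmult_le_pos.
    + replace (z * cis t)%C with (cis t * z)%C by ring. apply convex_tangent; auto. rewrite Cmod_cis; lra.
    + pose proof (COS_bound (t - s)). lra.
Qed.

(** The quotient g(z)/z, as the series that is defined at 0 as well. *)
Definition slope : C -> C := pseries_value (fun k => a (S k)).

Lemma slope_expands : expands (fun k => a (S k)) 1 slope.
Proof. apply (expands_shift a 1 g Hg). Qed.

Lemma slope_eq z : Cmod z < 1 -> g z = (z * slope z)%C.
Proof.
  intros Hz. pose proof (pseries_unshift a z _ (slope_expands z Hz)) as U.
  rewrite (pseries_unique _ _ _ _ (Hg z Hz) U), a0. ring.
Qed.

Lemma slope_0 : slope (RtoC 0) = RtoC 1.
Proof. rewrite (expands_value_0 _ 1 _ ltac:(lra) slope_expands). exact a1. Qed.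

Lemma slope_neq0 z : Cmod z < 1 -> slope z <> RtoC 0.
Proof.
  intros Hz E. assert (z = RtoC 0).
  { apply Hu; [exact Hz|unfold in_disc; rewrite Cmod_0; lra|]. rewrite map_0, slope_eq, E by auto. ring. }
  subst z. rewrite slope_0 in E. apply (f_equal Re) in E. unfold Re in E; simpl in E. lra.
Qed.

Lemma dmap_0 : dmap (RtoC 0) = RtoC 1.
Proof.
  unfold dmap. rewrite (pseries_value_correct _ _ _ (pseries_at0 _)). unfold deriv_coef. simpl. rewrite a1. ring.
Qed.

(** The quotient is holomorphic in the disc with the value 1 - kappa/2 at 0,
    where kappa = cis s, so that the weak inequality improves to a strict
    one. *)
Lemma convex_strict z s : Cmod z < 1 -> 0 < Re ((slope z - cis s / 2) / dmap z)%C.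
Proof.
  intros Hz. apply (strict_positivity (fun z => (slope z - cis s / 2) / dmap z)%C); auto.
  - apply holo_div.
    + apply holo_sub; [apply (expands_holo _ _ _ slope_expands)|apply holo_const].
    + apply (expands_holo (deriv_coef a)). apply (expands_deriv_coef a 1 g Hg).
    + intros; now apply dmap_neq0.
  - intros w Hw Nw. pose proof (convex_first_coefficient w s Hw) as H.
    pose proof (proj1 (Cmod_gt_0 _) Nw) as Hp.
    replace (Cconj w * (g w - cis s * w / 2) / dmap w)%C with
      (RtoC (Cmod w ^ 2) * ((slope w - cis s / 2) / dmap w))%C in H.
    + rewrite Re_Cscal in H. assert (0 < Cmod w ^ 2) by nra.
      apply Rmult_le_reg_l with (Cmod w ^ 2); lra.
    + rewrite <- Cconj_mul_self, (slope_eq w Hw). field. now apply dmap_neq0.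
  - rewrite slope_0, dmap_0. replace ((1 - cis s / 2) / 1)%C with (1 - RtoC (/ 2) * cis s)%C.
    + unfold cis, Re; simpl. pose proof (COS_bound s). lra.
    + rewrite RtoC_inv by lra. field.
Qed.

End Convex.

(** * Jack's lemma and the Marx-Strohhaecker inequality *)

(** At a point where |v| is maximal on a closed disc, moving inwards along the
    radius cannot increase |v| and moving along the circle is stationary.  In
    terms of w = z v this is Jack's lemma: z w'/w is real and at least 1. *)
Lemma jack_lemma v v' z0 r : holo 1 v -> cder v z0 v' -> 0 < r < 1 -> Cmod z0 = r ->
  (forall z, Cmod z <= r -> Cmod (v z) <= Cmod (v z0)) ->
  0 <= Re (Cconj (v z0) * (v' * z0))%C /\ Im (Cconj (v z0) * (v' * z0))%C = 0.
Proof.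
  intros Hv Dv Hr Hz0 HM.
  assert (Gen : forall (gam : R -> C) (k : C), (forall t, 0 <= t <= 1 -> Cmod (gam t) <= r) ->
    gam 0 = z0 -> rder gam 0 k -> Re (Cconj (v z0) * (v' * k))%C <= 0).
  { intros gam k B G0 D.
    assert (D2 : rder (fun t => v (gam t)) 0 (v' * k)%C).
    { apply (rder_comp v gam); [ |exact D]. now rewrite G0. }
    apply (deriv_nonpos_right _ _ (rder_Re_mul (Cconj (v z0)) _ _ _ D2)).
    intros t Ht. rewrite G0.
    eapply Rle_trans; [apply (Re_conj_mul_le _ _ (Cmod (v z0))); [lra|]|].
    - apply HM. auto.
    - rewrite Cconj_mul_self. unfold Re; simpl. lra. }
  assert (T : forall s, s = 1 \/ s = -1 -> Re (Cconj (v z0) * (v' * (RtoC s * (Ci * z0))))%C <= 0).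
  { intros s Hs. apply (Gen (fun t => cis (s * t) * z0)%C).
    - intros t _. rewrite Cmod_mult, Cmod_cis. lra.
    - rewrite Rmult_0_r, cis_0. ring.
    - assert (D : rder (fun t => cis (s * t)) 0 (RtoC s * Ci)%C).
      { apply rder_ReIm.
        - change (is_derive (fun t => cos (s * t)) 0 (Re (RtoC s * Ci)%C)). auto_derive; auto.
          unfold Re; simpl. rewrite Rmult_0_r, sin_0. ring.
        - change (is_derive (fun t => sin (s * t)) 0 (Im (RtoC s * Ci)%C)). auto_derive; auto.
          unfold Im; simpl. rewrite Rmult_0_r, cos_0. ring. }
      replace (RtoC s * (Ci * z0))%C with (RtoC s * Ci * z0 + cis (s * 0) * RtoC 0)%C by ring.
      apply (rder_mul (fun t => cis (s * t)) (fun _ => z0));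
        [exact D|apply cara_deriv_const]. }
  split.
  - assert (H : Re (Cconj (v z0) * (v' * (- z0)))%C <= 0).
    { apply (Gen (fun t => RtoC (1 - t) * z0)%C).
      - intros t Ht. rewrite Cmod_mult, Cmod_R, Rabs_pos_eq by lra. nra.
      - rewrite Rminus_0_r. ring.
      - replace (- z0)%C with ((RtoC 0 - RtoC 1) * z0 + RtoC (1 - 0) * RtoC 0)%C by ring.
        apply (rder_mul (fun t => RtoC (1 - t)) (fun _ => z0));
          [ |apply cara_deriv_const].
        apply (cara_deriv_ext_loc (U := R_UniformSpace) RtoC (fun t : R => (RtoC 1 - RtoC t)%C)).
        + apply filter_forall. intros t. now rewrite RtoC_minus.
        + apply (rder_sub (fun _ => RtoC 1) RtoC);
            [apply cara_deriv_const|apply cara_deriv_iota]. }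
    replace (Cconj (v z0) * (v' * - z0))%C with (- (Cconj (v z0) * (v' * z0)))%C in H by ring.
    change (- Re (Cconj (v z0) * (v' * z0))%C <= 0) in H. lra.
  - pose proof (T 1 ltac:(auto)) as T1. pose proof (T (-1) ltac:(auto)) as T2.
    replace (Cconj (v z0) * (v' * (RtoC 1 * (Ci * z0))))%C with (Ci * (Cconj (v z0) * (v' * z0)))%C in T1 by ring.
    replace (Cconj (v z0) * (v' * (RtoC (-1) * (Ci * z0))))%C with (RtoC (-1) * (Ci * (Cconj (v z0) * (v' * z0))))%C in T2 by ring.
    rewrite Re_Cscal in T2.
    assert (E : forall x : C, Re (Ci * x)%C = - Im x) by (intros x; unfold Re, Im; simpl; ring).
    rewrite E in T1, T2. lra.
Qed.

Lemma expands_bounded a F s : expands a 1 F -> 0 <= s < 1 -> exists L, 0 <= L /\ forall z, Cmod z <= s -> Cmod (F z) <= L.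
Proof.
  intros HF Hs. destruct (expands_coef_bound a 1 F ((1 + s) / 2) HF ltac:(lra)) as [M HM].
  set (q := s / ((1 + s) / 2)).
  assert (Hq : 0 <= q < 1).
  { apply ratio_lt_1; lra. }
  pose proof (coef_bound_nonneg _ _ _ HM).
  exists (Cmod (a O) + M / (1 - q) * q). split.
  - assert (0 <= M / (1 - q)) by (apply Rdiv_le_0_compat; lra). pose proof (Cmod_ge_0 (a O)). nra.
  - intros z Hz. pose proof (pseries_head a _ M z q (F z) HM ltac:(lra) Hq) as T.
    replace (F z) with (a O + (F z - a O))%C by ring.
    eapply Rle_trans; [apply Cmod_triangle|]. apply Rplus_le_compat_l. apply T.
    + replace (q * ((1 + s) / 2)) with s; [exact Hz|]. unfold q; field. lra.
    + apply HF. lra.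
Qed.

Lemma lipschitz_segment F F' L z z' :
  (forall t, 0 <= t <= 1 -> cder F (z + RtoC t * (z' - z))%C (F' (z + RtoC t * (z' - z))%C) /\
     Cmod (F' (z + RtoC t * (z' - z))%C) <= L) ->
  Cmod (F z' - F z)%C <= L * Cmod (z' - z)%C.
Proof.
  intros H. set (d := (F z' - F z)%C). set (m := Cmod d). set (e := (z' - z)%C) in *.
  assert (Hm : 0 <= m) by apply Cmod_ge_0.
  assert (D : forall t, 0 <= t <= 1 -> is_derive (fun t => Re (Cconj d * F (z + RtoC t * e))%C) t
     (Re (Cconj d * (F' (z + RtoC t * e)%C * e)))%C).
  { intros t Ht. apply (rder_Re_mul (Cconj d) (fun t => F (z + RtoC t * e)%C)).
    apply (rder_comp F (fun t => (z + RtoC t * e)%C)); [now apply H|].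
    apply rder_affine. }
  destruct (MVT_gen _ 0 1 _ (fun x Hx => D x ltac:(rewrite Rmin_left, Rmax_right in Hx by lra; lra))) as [c [Hc E]].
  { rewrite Rmin_left, Rmax_right by lra. intros x Hx. apply continuity_pt_filterlim.
    apply (ex_derive_continuous (fun t => Re (Cconj d * F (z + RtoC t * e))%C)). eexists. now apply D. }
  rewrite Rmin_left, Rmax_right in Hc by lra.
  replace (z + RtoC 1 * e)%C with z' in E by (unfold e; ring).
  replace (z + RtoC 0 * e)%C with z in E by ring.
  assert (E2 : m * m = Re (Cconj d * (F' (z + RtoC c * e) * e))%C).
  { rewrite Rminus_0_r, Rmult_1_r in E. rewrite <- E.
    replace (m * m) with (Re (Cconj d * d)%C) by (rewrite Cconj_mul_self; unfold Re; simpl; fold m; ring).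
    unfold d, Re; simpl. ring. }
  assert (B : m * m <= m * (L * Cmod e)).
  { rewrite E2. eapply Rle_trans; [apply Re_le_Cmod|]. rewrite !Cmod_mult, Cmod_conj. fold m.
    apply Rmult_le_compat_l; auto.
    apply Rmult_le_compat_r; [apply Cmod_ge_0|]. now apply H. }
  destruct (Req_EM_T m 0) as [E0|N0].
  - rewrite E0. apply Rmult_le_pos; [|apply Cmod_ge_0].
    eapply Rle_trans; [apply Cmod_ge_0|apply (H 0); lra].
  - apply Rmult_le_reg_l with m; lra.
Qed.

Lemma polar_form z : exists t, z = (RtoC (Cmod z) * cis t)%C.
Proof.
  destruct (Req_EM_T (Cmod z) 0) as [E|E].
  - exists 0. rewrite E. apply Cmod_eq_0 in E. rewrite E. ring.
  - exists (Carg z). apply Carg_polar. apply Cmod_gt_0. pose proof (Cmod_ge_0 z). lra.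
Qed.

(** A function that vanishes at 0 and is not bounded by 1 reaches modulus 1 on a
    first circle.  The supremum of the good radii is itself good unless this
    happens, and then a Lipschitz bound near the compact circle makes a larger
    radius good. *)
Lemma radius_continuation (w : C -> C) : holo 1 w -> w (RtoC 0) = RtoC 0 ->
  (forall z0, 0 < Cmod z0 < 1 -> Cmod (w z0) = 1 -> (forall z, Cmod z <= Cmod z0 -> Cmod (w z) <= 1) -> False) ->
  forall z, Cmod z < 1 -> Cmod (w z) < 1.
Proof.
  intros Hw W0 Hno z1 Hz1. destruct (Rlt_or_le (Cmod (w z1)) 1) as [|Hbad]; auto. exfalso.
  set (R1 := Cmod z1) in *. assert (HR1 : 0 <= R1) by apply Cmod_ge_0.
  destruct (taylor 1 w ltac:(lra) Hw) as [a Ha].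
  set (E := fun s => 0 <= s <= R1 /\ forall z, Cmod z <= s -> Cmod (w z) < 1).
  assert (E0 : E 0).
  { split; [lra|]. intros z Hz. assert (z = RtoC 0) as -> by (apply Cmod_eq_0; pose proof (Cmod_ge_0 z); lra).
    rewrite W0, Cmod_0. lra. }
  destruct (completeness E) as [sg [Hub Hlub]].
  - exists R1. intros s [Hs _]. lra.
  - exists 0. exact E0.
  - assert (Hsg : 0 <= sg <= R1).
    { split; [now apply Hub|]. apply Hlub. intros s [Hs _]. lra. }
    assert (Below : forall z, Cmod z < sg -> Cmod (w z) < 1).
    { intros z Hz. apply NNPP. intros N.
      assert (sg <= Cmod z); [|lra]. apply Hlub. intros s [Hs1 Hs2].
      destruct (Rle_or_lt s (Cmod z)); auto. exfalso. apply N. apply Hs2. lra. }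
    assert (At : forall z, Cmod z <= sg -> Cmod (w z) <= 1).
    { intros z Hz. destruct (Rle_or_lt (Cmod (w z)) 1) as [|Hgt]; auto. exfalso.
      assert (C1 : continuous (fun t : R => Cmod (w (RtoC t * z)%C)) 1).
      { apply (cont_Cmod (U := R_UniformSpace)). apply (continuous_comp (fun t : R => (RtoC t * z)%C) w).
        - apply cont_mul; [apply cont_RtoC_id|apply cont_const].
        - rewrite Cmult_1_l. apply (holo_cont 1); auto. lra. }
      assert (L : locally 1 (fun t => 1 < Cmod (w (RtoC t * z)%C))).
      { apply (C1 (fun y => 1 < y)). rewrite Cmult_1_l. exists (mkposreal (Cmod (w z) - 1) ltac:(lra)).
        intros y Hy. change (Rabs (y - Cmod (w z)) < Cmod (w z) - 1) in Hy.
        apply Rabs_lt_between in Hy. lra. }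
      destruct L as [d Hd].
      destruct (Req_EM_T (Cmod z) 0) as [Ez|Ez].
      - apply Cmod_eq_0 in Ez. subst z. rewrite W0, Cmod_0 in Hgt. lra.
      - set (t := Rmax (1 / 2) (1 - d / 2)). pose proof (cond_pos d).
        assert (Ht : 1 / 2 <= t < 1) by (split; [apply Rmax_l|apply Rmax_lub_lt; lra]).
        assert (1 - d / 2 <= t) by apply Rmax_r.
        assert (Bt : 1 < Cmod (w (RtoC t * z)%C)).
        { apply Hd. change (Rabs (t - 1) < d). rewrite Rabs_left by lra. lra. }
        assert (Cmod (w (RtoC t * z)%C) < 1); [|lra].
        apply Below. rewrite Cmod_mult, Cmod_R, Rabs_pos_eq by lra. pose proof (Cmod_ge_0 z). nra. }
    assert (Strict : forall z, Cmod z <= sg -> Cmod (w z) < 1).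
    { intros z Hz. destruct (Rle_lt_or_eq_dec _ _ (At z Hz)) as [|E1]; auto. exfalso.
      destruct (Rle_lt_or_eq_dec _ _ Hz) as [Hlt|Heq].
      - pose proof (Below z Hlt). lra.
      - apply (Hno z); auto.
        + split; [|lra]. apply Cmod_gt_0. intros ->. rewrite W0, Cmod_0 in E1. lra.
        + intros z' Hz'. apply At. lra. }
    assert (HsR : sg < R1).
    { destruct (Rle_lt_or_eq_dec _ _ (proj2 Hsg)) as [|Heq]; auto. exfalso.
      assert (Cmod (w z1) < 1) by (apply Strict; fold R1; lra). lra. }
    destruct (circle_max_attained w (RtoC sg)) as [s HM2].
    { apply (ccont_circle 1 w (RtoC sg) cis Hw); [|apply cis_cont|apply Cmod_cis].
      rewrite Cmod_R, Rabs_pos_eq; lra. }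
    set (M := Cmod (w (RtoC sg * cis s)%C)) in *.
    assert (HM : M < 1) by (apply Strict; rewrite Cmod_mult, Cmod_cis, Cmod_R, Rabs_pos_eq; lra).
    destruct (expands_bounded _ _ R1 (expands_deriv_coef a 1 w Ha) ltac:(lra)) as [L [HL0 HL]].
    (* with this step the Lipschitz estimate loses at most half of 1 - M *)
    set (eta := Rmin (R1 - sg) ((1 - M) / (2 * (L + 1)))).
    assert (Heta : 0 < eta) by (apply Rmin_pos; [lra|apply Rdiv_lt_0_compat; lra]).
    assert (He1 : eta <= R1 - sg) by apply Rmin_l.
    assert (He2 : (L + 1) * eta <= (1 - M) / 2).
    { apply Rle_trans with ((L + 1) * ((1 - M) / (2 * (L + 1)))); [|right; field; lra].
      apply Rmult_le_compat_l; [lra|apply Rmin_r]. }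
    assert (EE : E (sg + eta)).
    { split; [lra|]. intros z Hz. destruct (Rle_or_lt (Cmod z) sg) as [Hle|Hgt]; [now apply Strict|].
      destruct (polar_form z) as [t Et]. set (p := (RtoC sg * cis t)%C).
      assert (Ediff : (z - p)%C = (RtoC (Cmod z - sg) * cis t)%C).
      { rewrite Et at 1. unfold p. rewrite RtoC_minus. ring. }
      assert (Lip : Cmod (w z - w p)%C <= L * Cmod (z - p)%C).
      { apply (lipschitz_segment w (pseries_value (deriv_coef a))). intros x Hx.
        assert (In : Cmod (p + RtoC x * (z - p))%C <= R1).
        { rewrite Ediff. unfold p. replace (RtoC sg * cis t + RtoC x * (RtoC (Cmod z - sg) * cis t))%C
            with (RtoC (sg + x * (Cmod z - sg)) * cis t)%C by (rewrite RtoC_plus, RtoC_mult; ring).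
          rewrite Cmod_mult, Cmod_cis, Cmod_R, Rabs_pos_eq by nra. nra. }
        split; [|now apply HL]. apply (expands_cder a 1); auto. lra. }
      rewrite Ediff, Cmod_mult, Cmod_cis, Cmod_R, Rabs_pos_eq in Lip by lra.
      pose proof (HM2 t) as HMt. fold p in HMt.
      replace (w z) with (w p + (w z - w p))%C by ring.
      eapply Rle_lt_trans; [apply Cmod_triangle|].
      assert (L * ((Cmod z - sg) * 1) <= (L + 1) * eta) by (apply Rmult_le_compat; lra). lra. }
    pose proof (Hub _ EE). lra.
Qed.

(** With a = 1 - w, b = 1 + (m-1) w and kappa chosen so that kappa a^2/b is a
    positive real, the hypothesis reads 2 Re (a conj b) > |a|^2 |b|.  As
    |w| = 1, |a|^2 = 2 Re a and 2 Re (a conj b) = (2 - m) |a|^2; so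
    |b| < 2 - m, whereas |b| >= 1 - (m-1). *)
Lemma marx_algebra (w : C) (m : R) : Cmod w = 1 -> (1 - w)%C <> RtoC 0 -> 1 <= m ->
  (1 + RtoC (m - 1) * w)%C <> RtoC 0 ->
  (forall s, 0 < Re ((/ (1 - w) - cis s / 2) / ((1 + RtoC (m - 1) * w) / ((1 - w) * (1 - w))))%C) -> False.
Proof.
  intros Hw Ha Hm Hb H. set (b := (1 + RtoC (m - 1) * w)%C) in *. set (a := (1 - w)%C) in *.
  pose proof (proj1 (Cmod_gt_0 _) Ha) as Pa. pose proof (proj1 (Cmod_gt_0 _) Hb) as Pb.
  set (q := (a * a / b)%C).
  assert (Nq : q <> RtoC 0).
  { unfold q. apply Cmult_neq_0; [apply Cmult_neq_0; auto|]. apply Cmod_gt_0. rewrite Cmod_inv by auto.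
    now apply Rinv_0_lt_compat. }
  pose proof (proj1 (Cmod_gt_0 _) Nq) as Pq.
  destruct (Carg_polar q Nq) as [Eq _].
  (* the unit kappa that aligns kappa q with the positive real axis *)
  specialize (H (- Carg q)).
  assert (E : ((/ a - cis (- Carg q) / 2) / (b / (a * a)))%C = (a / b - RtoC (Cmod q / 2))%C).
  { transitivity (a / b - cis (- Carg q) / 2 * q)%C.
    - unfold q. field. split; auto. 
    - f_equal. f_equal. rewrite Eq at 2.
      transitivity (RtoC (Cmod q) * (cis (Carg q) * cis (- Carg q)) / 2)%C; [unfold Cdiv; ring|].
      rewrite cis_opp_mul, RtoC_div by lra. field. }
  rewrite E in H.
  assert (Mq : Cmod q = Cmod a * Cmod a / Cmod b).
  { unfold q. rewrite Cmod_div, Cmod_mult by auto. reflexivity. }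
  assert (Eab : Re (a / b)%C = Re (a * Cconj b)%C / (Cmod b * Cmod b)).
  { replace (a / b)%C with (RtoC (/ (Cmod b * Cmod b)) * (a * Cconj b))%C.
    - rewrite Re_Cscal. field. lra.
    - assert (X : (Cconj b * b)%C = RtoC (Cmod b * Cmod b)) by (rewrite Cconj_mul_self; f_equal; ring).
      rewrite RtoC_inv by nra. rewrite <- X. field. split; auto.
      apply Cmod_gt_0. now rewrite Cmod_conj. }
  assert (HH : 0 < Re (a * Cconj b)%C / (Cmod b * Cmod b) - Cmod a * Cmod a / Cmod b / 2).
  { rewrite <- Eab, <- Mq. unfold Re in H |- *. simpl in H. exact H. }
  assert (Sw : Re w * Re w + Im w * Im w = 1) by (rewrite <- Cmod_sqr, Hw; ring).
  assert (Sa : Cmod a * Cmod a = 2 * (1 - Re w)).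
  { rewrite Cmod_sqr. unfold a, Re, Im in *; simpl. lra. }
  assert (Rab : Re (a * Cconj b)%C = (1 - Re w) * (2 - m)).
  { unfold a, b, Re, Im in *; simpl. nra. }
  rewrite Rab, Sa in HH.
  assert (Hpos : 0 < 1 - Re w) by nra.
  assert (K : Cmod b < 2 - m).
  { assert (HH2 : 0 < ((1 - Re w) * (2 - m) / (Cmod b * Cmod b) - 2 * (1 - Re w) / Cmod b / 2) * (Cmod b * Cmod b)).
    { apply Rmult_lt_0_compat; nra. }
    replace (((1 - Re w) * (2 - m) / (Cmod b * Cmod b) - 2 * (1 - Re w) / Cmod b / 2) * (Cmod b * Cmod b))
      with ((1 - Re w) * (2 - m - Cmod b)) in HH2 by (field; lra). nra. }
  pose proof (Cmod_tri_rev (RtoC 1) (RtoC (m - 1) * w)%C) as T. fold b in T.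
  rewrite Cmod_1, Cmod_mult, Cmod_R, Rabs_pos_eq, Hw in T by lra. lra.
Qed.

(** With w = z v = 1 - z/g(z), the assertion Re (g(z)/z) > 1/2 is |w| < 1.
    A first point with |w| = 1 is a maximum point of |v|, and there Jack's lemma
    turns [convex_strict] into the situation excluded by [marx_algebra]. *)
Lemma marx_strohhacker g : convex_map g -> exists A,
  holo 1 A /\ A (RtoC 0) = RtoC 1 /\ (forall z, Cmod z < 1 -> g z = (z * A z)%C) /\
  forall z, Cmod z < 1 -> 1 / 2 < Re (A z).
Proof.
  intros [[a [a0 [a1 Hg]]] [Hu Hc]].
  change (expands a 1 g) in Hg.
  set (A := slope a).
  assert (PA : expands (fun k => a (S k)) 1 A) by (apply (slope_expands g a Hg)).
  assert (HA : holo 1 A) by (apply (expands_holo _ _ _ PA)).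
  assert (A0 : A (RtoC 0) = RtoC 1) by (apply (slope_0 g a a1 Hg)).
  assert (EA : forall z, Cmod z < 1 -> g z = (z * A z)%C) by (intros; now apply slope_eq).
  assert (NA : forall z, Cmod z < 1 -> A z <> RtoC 0) by (intros; now apply (slope_neq0 g a a0 a1 Hg Hu)).
  exists A. split; [exact HA|]. split; [exact A0|]. split; [exact EA|].
  set (A1 := pseries_value (fun k => a (S (S k)))).
  assert (PA1 : expands (fun k => a (S (S k))) 1 A1) by (apply (expands_shift (fun k => a (S k)) 1 A PA)).
  assert (EA1 : forall z, Cmod z < 1 -> A z = (1 + z * A1 z)%C).
  { intros z Hz. pose proof (pseries_unshift (fun k => a (S k)) z _ (PA1 z Hz)) as U.
    rewrite (pseries_unique _ _ _ _ (PA z Hz) U), a1. reflexivity. }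
  set (v := fun z => (A1 z / A z)%C).
  assert (Hv : holo 1 v) by (apply holo_div; auto; apply (expands_holo _ _ _ PA1)).
  set (w := fun z => (z * v z)%C).
  assert (Hw : holo 1 w) by (apply holo_mul; [apply holo_id|exact Hv]).
  assert (Ew : forall z, Cmod z < 1 -> (1 - w z)%C = (/ A z)%C).
  { intros z Hz. unfold w, v. pose proof (EA1 z Hz) as E. pose proof (NA z Hz).
    transitivity ((A z - z * A1 z) / A z)%C; [field; auto|].
    replace (A z - z * A1 z)%C with (RtoC 1) by (rewrite E; ring). field. auto. }
  assert (Main : forall z, Cmod z < 1 -> Cmod (w z) < 1).
  { apply radius_continuation; auto.
    - unfold w. ring.
    - intros z0 Hz0 W1 Wle. set (r := Cmod z0) in *.
      assert (Nz : z0 <> RtoC 0) by (apply Cmod_gt_0; fold r; lra).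
      assert (Mw : forall z, Cmod (w z) = Cmod z * Cmod (v z)) by (intros; unfold w; apply Cmod_mult).
      assert (V0 : Cmod (v z0) = / r).
      { rewrite Mw in W1. fold r in W1. apply Rmult_eq_reg_l with r; [|lra]. rewrite W1. field. lra. }
      assert (Vr : forall z, Cmod z = r -> Cmod (v z) <= / r).
      { intros z Hz. pose proof (Wle z ltac:(lra)) as B. rewrite Mw, Hz in B.
        apply Rmult_le_reg_l with r; [lra|]. rewrite Rinv_r by lra. exact B. }
      assert (Vle : forall z, Cmod z <= r -> Cmod (v z) <= Cmod (v z0)).
      { intros z Hz. rewrite V0. destruct (Rle_lt_or_eq_dec _ _ Hz); [|now apply Vr].
        apply (max_modulus 1 v r); auto. }
      pose proof Hv as [v' Hv']. destruct (Hv' z0 ltac:(fold r; lra)) as [Dv _].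
      destruct (jack_lemma v (v' z0) z0 r Hv Dv Hz0 eq_refl Vle) as [J1 J2].
      set (y := (Cconj (v z0) * (v' z0 * z0))%C) in *.
      assert (Ey : y = RtoC (Re y)) by (apply C_ext_ReIm; [reflexivity|exact J2]).
      (* z v'/v = y / |v|^2 with |v| = 1/r, and w = z v adds 1 *)
      set (m := 1 + Re y * (r * r)).
      assert (Hm : 1 <= m) by (unfold m; nra).
      assert (Nv : v z0 <> RtoC 0).
      { apply Cmod_gt_0. rewrite V0. apply Rinv_0_lt_compat; lra. }
      assert (Edv : (z0 * v' z0)%C = (RtoC (m - 1) * v z0)%C).
      { replace (m - 1) with (Re y * (r * r)) by (unfold m; ring). rewrite RtoC_mult, <- Ey. unfold y.
        assert (X : (Cconj (v z0) * v z0)%C = RtoC (/ r * / r)).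
        { rewrite Cconj_mul_self, V0. f_equal. ring. }
        transitivity (z0 * v' z0 * (Cconj (v z0) * v z0 * RtoC (r * r)))%C; [|ring].
        rewrite X, <- RtoC_mult. replace (/ r * / r * (r * r)) with 1 by (field; lra). ring. }
      destruct (dmap_der g a Hg z0 ltac:(fold r; lra)) as [Dg _].
      (* differentiate g (1 - z v) = z *)
      assert (Eg : (dmap a z0 * (1 - w z0) + g z0 * (RtoC 0 - (1 * v z0 + z0 * v' z0)))%C = RtoC 1).
      { apply (cder_unique (fun z => g z * (1 - z * v z))%C z0).
        - apply (cder_mul g (fun z => 1 - z * v z)%C); [exact Dg|].
          apply cder_sub; [apply cara_deriv_const|].
          apply (cder_mul (fun z => z) v); [ |exact Dv].
          apply cder_id.
        - apply (cara_deriv_ext_loc (U := C_UniformSpace) (fun w => w) (fun z => z)).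
          + generalize (locally_Cmod_lt z0 1 ltac:(fold r; lra)). apply filter_imp.
            refine (fun (z : C) Hz => _). change (z = g z * (1 - w z))%C. rewrite Ew, EA by auto. field. now apply NA.
          + apply cder_id. }
      assert (Hr1 : Cmod z0 < 1) by (fold r; lra).
      assert (Na : (1 - w z0)%C <> RtoC 0).
      { rewrite Ew by auto. apply Cmod_gt_0. rewrite Cmod_inv by (now apply NA).
        apply Rinv_0_lt_compat. apply Cmod_gt_0. now apply NA. }
      assert (EAz : A z0 = (/ (1 - w z0))%C) by (rewrite Ew by auto; field; now apply NA).
      assert (Edg : dmap a z0 = ((1 + RtoC (m - 1) * w z0) / ((1 - w z0) * (1 - w z0)))%C).
      { assert (K : (dmap a z0 * (1 - w z0))%C = (1 + z0 / (1 - w z0) * (v z0 + RtoC (m - 1) * v z0))%C).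
        { rewrite EA, EAz, Edv in Eg by auto.
          transitivity ((dmap a z0 * (1 - w z0) + z0 * / (1 - w z0) * (0 - (1 * v z0 + RtoC (m - 1) * v z0)))
             + z0 / (1 - w z0) * (v z0 + RtoC (m - 1) * v z0))%C; [field; exact Na|].
          rewrite Eg. reflexivity. }
        replace (dmap a z0) with (dmap a z0 * (1 - w z0) / (1 - w z0))%C by (field; auto).
        rewrite K. unfold w in *. field. exact Na. }
      apply (marx_algebra (w z0) m W1 Na Hm).
      + intros E. apply (dmap_neq0 g a Hg Hu z0 Hr1). rewrite Edg, E. field. exact Na.
      + intros s. rewrite <- Edg, <- EAz. apply (convex_strict g a a0 a1 Hg Hu Hc z0 s Hr1). }
  intros z Hz. pose proof (Main z Hz) as B. pose proof (Ew z Hz) as E.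
  pose proof (NA z Hz) as N. pose proof (proj1 (Cmod_gt_0 _) N) as Hp.
  assert (B2 : Cmod (A z - 1)%C < Cmod (A z)).
  { replace (A z - 1)%C with (w z * A z)%C.
    - rewrite Cmod_mult. nra.
    - replace (w z) with (1 - (1 - w z))%C by ring. rewrite E. field. exact N. }
  pose proof (Cmod_sqr (A z)) as S1. pose proof (Cmod_sqr (A z - 1)%C) as S2.
  replace (Re (A z - 1)%C) with (Re (A z) - 1) in S2 by (unfold Re; simpl; ring).
  replace (Im (A z - 1)%C) with (Im (A z)) in S2 by (unfold Im; simpl; ring).
  pose proof (Cmod_ge_0 (A z - 1)%C). nra.
Qed.

(** * The Salagean operator *)

(** Coefficients of the m-th iterate of alpha + z d/dz; conjugating by z^alpha
    turns the Salagean operator into this one. *)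
Definition euler_coef (alpha : R) (m : nat) (a : nat -> C) : nat -> C :=
  fun k => (RtoC (alpha + INR k) ^ m * a k)%C.

Lemma euler_coef_step alpha m a R0 F : expands (euler_coef alpha m a) R0 F ->
  expands (euler_coef alpha (S m) a) R0 (fun z => RtoC alpha * F z + z * pseries_value (deriv_coef (euler_coef alpha m a)) z)%C.
Proof.
  intros H z Hz.
  apply (pseries_ext (fun k => RtoC alpha * euler_coef alpha m a k + RtoC (INR k) * euler_coef alpha m a k)%C).
  - intros k. unfold euler_coef. rewrite RtoC_plus. simpl. ring.
  - apply pseries_plus; [apply pseries_scal; now apply H|].
    pose proof (expands_deriv_coef _ _ _ H z Hz) as D.
    pose proof (pseries_unshift (fun k => RtoC (INR k) * euler_coef alpha m a k)%C z _ D) as U.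
    simpl in U. rewrite Cmult_0_l, Cplus_0_l in U. exact U.
Qed.

Lemma euler_coef_expands alpha m a R0 F : expands a R0 F -> expands (euler_coef alpha m a) R0 (pseries_value (euler_coef alpha m a)).
Proof.
  intros H. induction m.
  - intros z Hz. assert (E : cpseries (euler_coef alpha 0 a) z (F z)).
    { apply (pseries_ext a); [intros k; unfold euler_coef; simpl; ring|now apply H]. }
    now rewrite (pseries_value_correct _ _ _ E).
  - intros z Hz. pose proof (euler_coef_step _ _ _ _ _ IHm z Hz) as E. now rewrite (pseries_value_correct _ _ _ E).
Qed.

Lemma euler_coef_value_step alpha m a R0 F z : expands a R0 F -> Cmod z < R0 ->
  pseries_value (euler_coef alpha (S m) a) z =
  (RtoC alpha * pseries_value (euler_coef alpha m a) z + z * pseries_value (deriv_coef (euler_coef alpha m a)) z)%C.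
Proof.
  intros H Hz. apply pseries_value_correct. apply (euler_coef_step alpha m a R0 (pseries_value (euler_coef alpha m a))); auto.
  now apply (euler_coef_expands alpha m a R0 F).
Qed.

Lemma locally_slit z : slit z -> locally z slit.
Proof.
  intros H. destruct (Rlt_or_le 0 (Re z)) as [L|L].
  - generalize (cont_Re_gt (U := C_UniformSpace) (fun w => w) z 0 (cont_id z) L).
    apply filter_imp. intros w Hw. now apply Re_pos_slit.
  - assert (N : RtoC (Im z) <> RtoC 0).
    { intros E. apply H. split; auto. apply (f_equal Re) in E. exact E. }
    generalize (cont_neq0 (U := C_UniformSpace) (fun w => RtoC (Im w)) z
      (cont_RtoC _ _ (cont_Im (U := C_UniformSpace) (fun w => w) z (cont_id z))) N).
    apply filter_imp. intros w Hw [E _]. apply Hw. now rewrite E.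
Qed.

(** The product rule gives z (z^alpha p)' = z^alpha (alpha p + z p'). *)
Lemma salagean_formula alpha a P : expands a 1 P -> forall m z, in_slit_disc z ->
  Salagean m (fun w => Cpower w alpha * P w)%C z = (Cpower z alpha * pseries_value (euler_coef alpha m a) z)%C.
Proof.
  intros HP. induction m; intros z [Hz Hs].
  - simpl. f_equal. symmetry. apply pseries_value_correct.
    apply (pseries_ext a); [intros k; unfold euler_coef; simpl; ring|now apply HP].
  - simpl. change (slit z) in Hs. pose proof (slit_neq0 z Hs) as Nz.
    pose proof (euler_coef_expands alpha m a 1 P HP) as HW.
    assert (D : cder (Salagean m (fun w => Cpower w alpha * P w)%C) z
      (RtoC alpha * Cpower z alpha / z * pseries_value (euler_coef alpha m a) z +
        Cpower z alpha * pseries_value (deriv_coef (euler_coef alpha m a)) z)%C).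
    { apply (cara_deriv_ext_loc (U := C_UniformSpace) (fun w => w) (fun w => Cpower w alpha * pseries_value (euler_coef alpha m a) w)%C).
      - generalize (filter_and _ _ (locally_slit z Hs) (locally_Cmod_lt z 1 Hz)). apply filter_imp.
        refine (fun (w : C) => _). intros [A B]. symmetry. apply IHm. split; auto.
      - apply (cder_mul (fun w => Cpower w alpha) (pseries_value (euler_coef alpha m a)));
          [now apply cder_Cpower|now apply (expands_cder _ 1)]. }
    rewrite (cder_C_derive _ _ _ D), (euler_coef_value_step alpha m a 1 P z HP Hz). field. exact Nz.
Qed.

(** * Coefficients of powers *)

Lemma Cmult_div_cancel_l z w : z <> RtoC 0 -> (z * w / z)%C = w.
Proof. intros. field; auto. Qed.

(** Both expansions represent the same function at small positive points. *)
Lemma power_coeffs_unique alpha f a b : power_coeffs alpha f a -> power_coeffs alpha f b ->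
  forall k, a k = b k.
Proof.
  intros [r [Hr Ha]] [s [Hs Hb]].
  apply (pseries_coeff_unique a b (fun z => Cpower (f z / z)%C alpha) (Rmin r s)).
  - now apply Rmin_pos.
  - intros x Hx. apply Ha. rewrite Cmod_pos_real by lra. pose proof (Rmin_l r s). lra.
  - intros x Hx. apply Hb. rewrite Cmod_pos_real by lra. pose proof (Rmin_r r s). lra.
Qed.

Lemma power_coeffs_ext alpha f a b : (forall k, a k = b k) -> power_coeffs alpha f a -> power_coeffs alpha f b.
Proof.
  intros E [r [Hr Ha]]. exists r. split; auto. intros z Hz. apply (pseries_ext a b z _ E). now apply Ha.
Qed.

(** Near 0 the quotient f(z)/z is holomorphic with the value 1, so its power has
    an expansion with the constant term 1, and expansions are unique. *)
Lemma power_coeffs_0 alpha f a : class_A f -> power_coeffs alpha f a -> a O = RtoC 1.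
Proof.
  intros [c [c0 [c1 Hf]]] [r [Hr Ha]]. change (expands c 1 f) in Hf.
  set (A := pseries_value (fun k => c (S k))).
  assert (PA : expands (fun k => c (S k)) 1 A) by (apply (expands_shift c 1 f Hf)).
  assert (EA : forall z, Cmod z < 1 -> f z = (z * A z)%C).
  { intros z Hz. pose proof (pseries_unshift c z _ (PA z Hz)) as U.
    rewrite (pseries_unique _ _ _ _ (Hf z Hz) U), c0. ring. }
  assert (A0 : A (RtoC 0) = RtoC 1) by (rewrite (expands_value_0 _ 1 _ ltac:(lra) PA); exact c1).
  assert (Z1 : Cmod (RtoC 0) < 1) by (rewrite Cmod_0; lra).
  destruct (locally_Cmod_ex _ _ (cont_Re_gt A (RtoC 0) 0 (expands_cont _ _ _ _ PA Z1) ltac:(rewrite A0; unfold Re; simpl; lra)))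
    as [d [Hd Hd']].
  set (s := Rmin (Rmin d 1) r).
  assert (Hs : 0 < s) by (repeat apply Rmin_pos; lra).
  assert (s <= d /\ s <= 1 /\ s <= r) as [S1 [S2 S3]].
  { unfold s. pose proof (Rmin_l (Rmin d 1) r). pose proof (Rmin_r (Rmin d 1) r).
    pose proof (Rmin_l d 1). pose proof (Rmin_r d 1). lra. }
  assert (HU : holo s (fun z => Cpower (A z) alpha)).
  { apply holo_Cpower; [apply (holo_weaken 1); [lra|apply (expands_holo _ _ _ PA)]|].
    intros z Hz. apply Hd'. replace (z - 0)%C with z by ring. lra. }
  destruct (taylor s _ Hs HU) as [u Hu].
  rewrite (pseries_coeff_unique a u (fun z => Cpower (f z / z)%C alpha) s Hs).
  - rewrite <- (expands_value_0 u s _ Hs Hu), A0. apply Cpower_1_l.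
  - intros x Hx. apply Ha. rewrite Cmod_pos_real; lra.
  - intros x Hx. rewrite EA by (rewrite Cmod_pos_real; lra).
    rewrite Cmult_div_cancel_l by (apply pos_real_neq0; lra). apply Hu. rewrite Cmod_pos_real; lra.
Qed.

Lemma expands_product a b P G : expands a 1 P -> expands b 1 G ->
  expands (fun k => a k * b k)%C 1 (pseries_value (fun k => a k * b k)%C).
Proof.
  intros Ha Hb z Hz. pose proof (Cmod_ge_0 z). set (r := (1 + Cmod z) / 2).
  assert (Hr : 0 <= r < 1) by (unfold r; lra).
  destruct (expands_coef_bound a 1 P r Ha Hr) as [M1 H1]. destruct (expands_coef_bound b 1 G r Hb Hr) as [M2 H2].
  apply (coef_bound_converges _ (r * r) (M1 * M2)).
  - intros k. rewrite Cmod_mult, Rpow_mult_distr. specialize (H1 k). specialize (H2 k).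
    replace (Cmod (a k) * Cmod (b k) * (r ^ k * r ^ k)) with ((Cmod (a k) * r ^ k) * (Cmod (b k) * r ^ k)) by ring.
    apply Rmult_le_compat; auto; apply Rmult_le_pos; auto using Cmod_ge_0; apply pow_le; lra.
  - unfold r. nra.
Qed.

Lemma convex_power_half_plane alpha g : 0 < alpha <= 1 -> convex_map g ->
  exists b G, expands b 1 G /\ b O = RtoC 1 /\ power_coeffs alpha g b /\
    forall z, Cmod z < 1 -> 1 / 2 <= Re (G z).
Proof.
  intros Ha Hg. destruct (marx_strohhacker g Hg) as [A [HA [A0 [EA HR]]]].
  assert (HG : holo 1 (fun z => Cpower (A z) alpha)).
  { apply holo_Cpower; auto. intros z Hz. pose proof (HR z Hz). lra. }
  destruct (taylor 1 _ ltac:(lra) HG) as [b Hb].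
  exists b, (fun z => Cpower (A z) alpha). split; [exact Hb|]. split; [|split].
  - rewrite <- (expands_value_0 b 1 _ ltac:(lra) Hb), A0. apply Cpower_1_l.
  - exists 1. split; [lra|]. intros z Hz.
    rewrite EA, Cmult_div_cancel_l by (try apply Cmod_gt_0; lra). apply Hb. lra.
  - intros z Hz. left. apply Cpower_Re_half; auto.
Qed.

(** * Existence of the quasi-convolution *)

(** For S = sum (alpha + k)^m c_k z^k, the derivative of t^alpha S(tz) is
    t^(alpha - 1) times the next weighted series at tz.  So t^alpha Re S(tz) is
    increasing in t, and it is positive for small t. *)
Lemma half_plane_step alpha m c F : 0 < alpha -> expands c 1 F -> c O = RtoC 1 ->
  (forall z, Cmod z < 1 -> 0 < Re (pseries_value (euler_coef alpha (S m) c) z)) ->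
  forall z, Cmod z < 1 -> 0 < Re (pseries_value (euler_coef alpha m c) z).
Proof.
  intros Ha Hc c0 Hpos z Hz. pose proof (euler_coef_expands alpha m c 1 F Hc) as HW.
  set (Sm := pseries_value (euler_coef alpha m c)) in *. set (Sm' := pseries_value (deriv_coef (euler_coef alpha m c))).
  pose proof (Cmod_ge_0 z) as Hz0.
  assert (S0 : 0 < Re (Sm (RtoC 0))).
  { rewrite (expands_value_0 _ 1 _ ltac:(lra) HW). unfold euler_coef. change (INR 0) with 0. rewrite c0, Cmult_1_r, Rplus_0_r, <- RtoC_pow.
    unfold Re; simpl. now apply pow_lt. }
  assert (Z1 : Cmod (RtoC 0) < 1) by (rewrite Cmod_0; lra).
  destruct (locally_Cmod_ex _ _ (cont_Re_gt Sm (RtoC 0) 0 (expands_cont _ _ _ _ HW Z1) S0)) as [d [Hd Hd']].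
  set (e := Rmin (1 / 2) (d / 2)).
  assert (He : 0 < e <= 1 / 2) by (split; [apply Rmin_pos; lra|apply Rmin_l]).
  assert (He2 : e <= d / 2) by apply Rmin_r.
  assert (Se : 0 < Re (Sm (RtoC e * z)%C)).
  { apply Hd'. replace (RtoC e * z - 0)%C with (RtoC e * z)%C by ring.
    rewrite Cmod_mult, Cmod_pos_real by lra. nra. }
  set (N := fun t => Rpower t alpha * Re (Sm (RtoC t * z)%C)).
  set (dN := fun t => Rpower t alpha / t * Re (pseries_value (euler_coef alpha (S m) c) (RtoC t * z)%C)).
  assert (In : forall t, e <= t <= 1 -> Cmod (RtoC t * z)%C < 1).
  { intros t Ht. rewrite Cmod_mult, Cmod_pos_real by lra. nra. }
  assert (D : forall t, e <= t <= 1 -> is_derive N t (dN t)).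
  { intros t Ht. assert (Dr : rder (fun t => Sm (RtoC t * z)%C) t (Sm' (RtoC t * z) * z)%C).
    { apply (rder_comp Sm (fun t => (RtoC t * z)%C)); [ |].
      - apply (expands_cder _ 1 Sm); auto.
      - apply rder_scaled. }
    apply rder_Re in Dr.
    assert (Dp : is_derive (fun t => Rpower t alpha) t (alpha * (Rpower t alpha / t))).
    { unfold Rpower. auto_derive; [lra|]. field. lra. }
    assert (DN := is_derive_mult (K := R_AbsRing) _ _ t _ _ Dp Dr (fun x y => Rmult_comm x y)).
    replace (dN t) with (alpha * (Rpower t alpha / t) * Re (Sm (RtoC t * z)%C) +
       Rpower t alpha * Re (Sm' (RtoC t * z) * z)%C); [exact DN|].
    unfold dN. rewrite (euler_coef_value_step alpha m c 1 F _ Hc (In t Ht)). fold Sm Sm'.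
    replace (Re (RtoC alpha * Sm (RtoC t * z) + RtoC t * z * Sm' (RtoC t * z))%C) with
      (alpha * Re (Sm (RtoC t * z)%C) + t * Re (Sm' (RtoC t * z) * z)%C).
    - field. lra.
    - unfold Re; simpl. ring. }
  destruct (MVT_gen N e 1 dN) as [x [Hx E]].
  - rewrite Rmin_left, Rmax_right by lra. intros; apply D; lra.
  - rewrite Rmin_left, Rmax_right by lra. intros x Hx. apply continuity_pt_filterlim.
    apply (ex_derive_continuous N). eexists; now apply D.
  - rewrite Rmin_left, Rmax_right in Hx by lra.
    assert (P1 : 0 < dN x).
    { unfold dN. apply Rmult_lt_0_compat; [apply Rdiv_lt_0_compat; [apply exp_pos|lra]|]. apply Hpos. now apply In. }
    assert (P2 : 0 < N e) by (unfold N; apply Rmult_lt_0_compat; [apply exp_pos|exact Se]).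
    assert (P3 : 0 < N 1) by nra.
    unfold N in P3. rewrite Cmult_1_l in P3. unfold Rpower in P3. rewrite ln_1, Rmult_0_r, exp_0 in P3. lra.
Qed.

Lemma half_plane_unweight alpha m c F : 0 < alpha -> expands c 1 F -> c O = RtoC 1 ->
  (forall z, Cmod z < 1 -> 0 < Re (pseries_value (euler_coef alpha m c) z)) ->
  forall z, Cmod z < 1 -> 0 < Re (F z).
Proof.
  intros Ha Hc c0. induction m; intros H.
  - intros z Hz. replace (F z) with (pseries_value (euler_coef alpha 0 c) z); [now apply H|].
    apply pseries_value_correct. apply (pseries_ext c); [intros k; unfold euler_coef; simpl; ring|now apply Hc].
  - apply IHm. now apply (half_plane_step alpha m c F).
Qed.

(** Take z F(z)^(1/alpha).  Its principal alpha-th power is z^alpha F where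
    |arg F| < alpha PI, which holds near 0. *)
Lemma power_root_exists alpha c F : 0 < alpha -> expands c 1 F -> c O = RtoC 1 ->
  (forall z, Cmod z < 1 -> 0 < Re (F z)) ->
  exists phi, class_A phi /\ power_coeffs alpha phi c.
Proof.
  intros Ha Hc c0 Hpos.
  assert (HU : holo 1 (fun z => Cpower (F z) (/ alpha))).
  { apply holo_Cpower; auto. apply (expands_holo _ _ _ Hc). }
  destruct (taylor 1 _ ltac:(lra) HU) as [u Hu].
  assert (F0 : F (RtoC 0) = RtoC 1) by (rewrite (expands_value_0 c 1 F ltac:(lra) Hc); exact c0).
  exists (fun z => z * Cpower (F z) (/ alpha))%C. split.
  - exists (fun k => match k with O => RtoC 0 | S j => u j end). split; [reflexivity|]. split.
    + rewrite <- (expands_value_0 u 1 _ ltac:(lra) Hu), F0. apply Cpower_1_l.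
    + intros z Hz.
      pose proof (pseries_unshift (fun k => match k with O => RtoC 0 | S j => u j end) z _ (Hu z Hz)) as U.
      cbv beta iota in U. rewrite Cplus_0_l in U. exact U.
  - assert (CC : continuous (fun z : C => Carg (F z)) (RtoC 0)).
    { apply (continuous_comp F Carg).
      - apply (expands_cont c 1); auto. rewrite Cmod_0; lra.
      - rewrite F0. apply cont_Carg_1. }
    assert (Carg1 : Carg (RtoC 1) = 0) by exact (f_equal Im Clog_1).
    assert (Hp : 0 < alpha * PI) by (apply Rmult_lt_0_compat; [auto|apply PI_RGT_0]).
    assert (B : locally (Carg (F (RtoC 0))) (fun y => Rabs y < alpha * PI)).
    { rewrite F0, Carg1. exists (mkposreal _ Hp). intros y Hy. change (Rabs (y - 0) < alpha * PI) in Hy.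
      now rewrite Rminus_0_r in Hy. }
    destruct (locally_Cmod_ex _ _ (CC _ B)) as [d [Hd Hd']].
    exists (Rmin d 1). split; [apply Rmin_pos; lra|]. intros z Hz.
    pose proof (Rmin_l d 1). pose proof (Rmin_r d 1).
    assert (Bz : Rabs (Carg (F z)) < alpha * PI).
    { apply Hd'. replace (z - 0)%C with z by ring. lra. }
    apply Rabs_lt_between in Bz.
    rewrite Cmult_div_cancel_l by (apply Cmod_gt_0; lra).
    rewrite Cpower_Cpower_inv.
    + apply Hc. lra.
    + apply slit_neq0, Re_pos_slit, Hpos. lra.
    + lra.
    + assert (X : forall y, y < alpha * PI -> / alpha * y < PI).
      { intros y Hy. apply Rmult_lt_reg_l with alpha; [auto|]. rewrite <- Rmult_assoc, Rinv_r by lra. lra. }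
      pose proof (X (Carg (F z)) ltac:(lra)). pose proof (X (- Carg (F z)) ltac:(lra)). lra.
Qed.

Theorem theorem2 :
  forall (n : nat) (alpha beta : R) (f g : C -> C),
    0 <= beta < 1 ->
    0 < alpha <= 1 ->
    class_T n alpha beta f ->
    convex_map g ->
    (exists phi : C -> C, quasi_convolution alpha f g phi) /\
    (forall phi : C -> C,
       quasi_convolution alpha f g phi -> class_T n alpha beta phi).
Proof.
  intros n alpha beta f g Hbeta Halpha [HfA [a [P [Q [Ha [HP [[q HQ] [EQ HRe]]]]]]]] Hg.
  change (expands a 1 P) in HP. change (expands q 1 Q) in HQ.
  destruct (convex_power_half_plane alpha g Halpha Hg) as [b [G [HG [b0 [Hb HReG]]]]].
  assert (a0 : a O = RtoC 1) by (apply (power_coeffs_0 alpha f); auto).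
  assert (Nal : (RtoC alpha ^ n)%C <> RtoC 0) by (apply Cpow_nz, pos_real_neq0; lra).
  (* Q is only known off the slit, but positive points determine its coefficients *)
  assert (Eq : forall k, q k = (euler_coef alpha n a k / RtoC alpha ^ n)%C).
  { apply (pseries_coeff_unique _ _ Q 1); [lra| |]; intros x Hx.
    - apply HQ. rewrite Cmod_pos_real; lra.
    - rewrite EQ.
      + rewrite (salagean_formula alpha a P HP).
        * replace (Cpower x alpha * pseries_value (euler_coef alpha n a) x / (RtoC alpha ^ n * Cpower x alpha))%C
            with (/ (RtoC alpha ^ n) * pseries_value (euler_coef alpha n a) x)%C by (field; split; [apply Cpower_neq0|exact Nal]).
          apply (pseries_ext (fun k => / (RtoC alpha ^ n) * euler_coef alpha n a k)%C).
          { intros k. unfold Cdiv. ring. }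
          apply pseries_scal. apply (euler_coef_expands alpha n a 1 P HP). rewrite Cmod_pos_real; lra.
        * split; [unfold in_disc; rewrite Cmod_pos_real; lra|]. unfold Re, Im; simpl. lra.
      + split; [unfold in_disc; rewrite Cmod_pos_real; lra|]. unfold Re, Im; simpl. lra. }
  assert (q0 : q O = RtoC 1).
  { rewrite Eq. unfold euler_coef. rewrite a0. simpl. rewrite Rplus_0_r. field. exact Nal. }
  destruct (conv_half_plane q Q b G beta HQ HG b0 HReG) as [HF HReF].
  { intros z Hz. left. apply HRe. exact Hz. }
  { rewrite q0. unfold Re; simpl. lra. }
  set (c := fun k => (a k * b k)%C).
  pose proof (expands_product a b P G HP HG) as Hc. fold c in Hc.
  assert (c0 : c O = RtoC 1) by (unfold c; rewrite a0, b0; ring).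
  set (F := pseries_value (fun k => q k * b k)%C) in *.
  assert (EF : forall z, Cmod z < 1 -> pseries_value (euler_coef alpha n c) z = (RtoC alpha ^ n * F z)%C).
  { intros z Hz. apply pseries_value_correct.
    apply (pseries_ext (fun k => RtoC alpha ^ n * (q k * b k))%C).
    - intros k. rewrite Eq. unfold euler_coef, c. field. exact Nal.
    - apply pseries_scal. now apply HF. }
  split.
  - destruct (power_root_exists alpha c (pseries_value c)) as [phi [HA Hphi]]; auto; [lra| |].
    + apply (half_plane_unweight alpha n c); auto; [lra|]. intros z Hz.
      rewrite EF, <- RtoC_pow, Re_Cscal by auto. apply Rmult_lt_0_compat; [apply pow_lt; lra|].
      pose proof (HReF z Hz). lra.
    + exists phi. split; auto. exists a, b. auto.
  - intros phi [HA [a' [b' [Ha' [Hb' Hphi]]]]]. split; [exact HA|].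
    exists c, (pseries_value c), F. split; [|split; [exact Hc|split; [|split; [|exact HReF]]]].
    + apply (power_coeffs_ext alpha phi (fun k => a' k * b' k)%C); auto. intros k. unfold c.
      now rewrite (power_coeffs_unique alpha f a a' Ha Ha'), (power_coeffs_unique alpha g b b' Hb Hb').
    + exists (fun k => (q k * b k)%C). exact HF.
    + intros z Hz. rewrite (salagean_formula alpha c (pseries_value c) Hc) by auto. rewrite EF by apply Hz.
      field. split; [apply Cpower_neq0|exact Nal].
Qed.
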